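(* Fix $u \in (0,\bar{u})$ and consider the IPS of intensity $u$. There exist $K(u) > 0$ and $\eta(u) \in (0,1)$ such that for any $0 < l_1 < l_2$ we have $$\mathbb{P}\bigl(\mathrm{Arm}_0(l_1, l_2)\bigr) \le K \bigl(l_1/l_2 \bigr)^{\eta}.$$
   Context: **IPS.** Let $S := \mathbb{R}^2\times(0,\infty)\times(-\pi/2,\pi/2]$. A point $s=(z,R,V)\in S$ represents the closed segment (stick) $E_0(s)$ centered at $z$, of length $2R$ and direction (angle) $V$. The scale-invariant Poisson stick soup (IPS) of intensity $u>0$ is the Poisson point process $\xi=\xi_0$ on $S$ with intensity $u\mu_2$, where $\mu_2=\mathrm{d}z\otimes 2R^{-3}\,\mathrm{d}R\otimes\frac1\pi\,\mathrm{d}V$. **Arm event.** $D(l_1,l_2)=\{w\in\mathbb{R}^2: l_1<|w|\le l_2\}$ and $\mathrm{Arm}_0(l_1,l_2)$ is the event that there is a finite sequence of sticks of $\xi$ crossing $D(l_1,l_2)$, i.e. sticks $E_0(s_1),\dots,E_0(s_n)$ with consecutive ones intersecting, whose union connects the circles of radii $l_1$ and $l_2$ centered at the origin. **Crossing a segment.** For $z\ne w$ let $[z,w]$ be the closed segment, $(z,w)=[z,w]\setminus\{z,w\}$, $\ell$ the line containing it, and $H_1,H_2$ the two open half-planes of $\mathbb{R}^2\setminus\ell$. Let $f:[0,1]\to\mathbb{R}^2$ be continuous and $f(t_0)\in\ell$. Let $[t_0^-,t_0^+]$ be the largest interval containing $t_0$ with $f([t_0^-,t_0^+])\subset\ell$.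 The point $t_0$ is a left-access point if $t_0=t_0^-\neq0$, and a right-access point if $t_0=t_0^+\ne1$. It is a left-oscillation point if for all $\delta>0$ the set $f((t_0-\delta,t_0))$ meets both $H_1$ and $H_2$, and a right-oscillation point if for all $\delta>0$ the set $f((t_0,t_0+\delta))$ meets both $H_1$ and $H_2$. If $t_0^-$ is a left-access point that is not a left-oscillation point, then $s^-(t_0^-)$ is the unique half-plane met by $f((t_0^--\delta,t_0^-))$ for all small $\delta>0$; similarly $s^+(t_0^+)$ is defined for a right-access point that is not a right-oscillation point, using $f((t_0^+,t_0^++\delta))$. A curve crosses $[z,w]$ if for some parametrization $f$ either (S1) there is a left-oscillation or right-oscillation point $t_0$ with $f(t_0)\in(z,w)$, or (S2) there is $t_0$ with $f([t_0^-,t_0^+])\subset(z,w)$ and $s^-(t_0^-)\ne s^+(t_0^+)$ (both being defined). **The parameter $\bar u$.** The IPS of intensity $u$ has the box-crossing property if for every $k,l>0$ there is $\delta=\delta(u,k)>0$ (not depending on $l$) such that the probability that there is a curve contained in $[0,kl]\times[0,l]$, with one endpoint on the left side and the other on the right side, that does not cross any stick of $\xi$, lies in $[\delta,1-\delta]$. Then $\bar u:=\sup\{u:\ \text{the IPS of intensity } u \text{ has the box-crossing property}\}$, which is positive. *)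

(* Defs.v *)
From HB Require Import structures.
From mathcomp Require Import all_boot all_order all_algebra.
From mathcomp Require Import all_classical all_reals all_analysis measurable_realfun.

Set Implicit Arguments.
Unset Strict Implicit.
Unset Printing Implicit Defensive.

Import Order.TTheory GRing.Theory Num.Theory.
Import numFieldNormedType.Exports.

Local Open Scope classical_set_scope.
Local Open Scope ring_scope.

Section PointProcess.
Local Open Scope ereal_scope.
Context {R : realType} {d d' : measure_display}.
Context {Omega : measurableType d} {T : measurableType d'}.

(* A point process is given by its random set of points: the processes used
   here have an atomless intensity, hence no multiple points. *)
Definition npoints (xi : Omega -> set T) (A : set T) (w : Omega) : \bar R :=
  counting (xi w `&` A).

Definition is_poisson_process (P : probability Omega R) (nu : set T -> \bar R)
    (xi : Omega -> set T) : Prop :=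
  [/\ forall A, measurable A -> measurable_fun setT (npoints xi A),
      forall A (k : nat), measurable A -> nu A < +oo ->
        P [set w | npoints xi A w = k%:R%:E] =
        ((fine (nu A)) ^+ k / k`!%:R * expR (- fine (nu A)))%:E,
      forall A, measurable A -> nu A = +oo ->
        P [set w | npoints xi A w = +oo] = 1 &
      forall (n : nat) (A : 'I_n -> set T) (B : 'I_n -> set (\bar R)),
        (forall i, measurable (A i)) -> (forall i, measurable (B i)) ->
        trivIset setT A ->
        P [set w | forall i, B i (npoints xi (A i) w)] =
        \prod_(i < n) P [set w | B i (npoints xi (A i) w)]].

(* [E] lies in the [P]-completion of the sigma-algebra ([completed_algebra_gen])
   and the completion of [P] gives it mass [p]. Events such as the existence of
   a curve avoiding all sticks are projections, hence in general measurable
   only for the completion. *)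
Definition has_prob (P : probability Omega R) (E : set Omega) (p : R) :=
  exists A N : set Omega,
    [/\ measurable A, P.-negligible N, E = A `|` N & P A = p%:E].

End PointProcess.

Section Plane.
Context {R : realType}.
Implicit Types (x z w : R * R) (l : R).

(* The norm of the library on [R * R] is the sup norm. *)
Definition euclid_norm x : R := Num.sqrt (x.1 ^+ 2 + x.2 ^+ 2).

Definition circle l : set (R * R) := [set x | euclid_norm x = l].

Definition segment z w : set (R * R) :=
  [set z + t *: (w - z) | t in `[0%R, 1%R]].

Definition open_segment z w : set (R * R) := segment z w `\` [set z; w].

Definition line z w : set (R * R) := [set z + t *: (w - z) | t in setT].

(* The two sides of the line from [z] to [w], told apart by the sign of
   det (w - z, x - z). *)
Definition side z w x : R :=
  (w.1 - z.1) * (x.2 - z.2) - (w.2 - z.2) * (x.1 - z.1).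

Definition half_plane z w (b : bool) : set (R * R) :=
  [set x | if b then 0 < side z w x else side z w x < 0].

End Plane.

(* ((z, r), v) : centre z, half-length r, angle v *)
Notation stick R :=
  (measurableTypeR R * measurableTypeR R * measurableTypeR R
   * measurableTypeR R)%type.

Section Sticks.
Context {R : realType}.

Definition centre (s : stick R) : R * R := s.1.1.
Definition radius (s : stick R) : R := s.1.2.
Definition angle (s : stick R) : R := s.2.

Local Notation leb := (@lebesgue_measure R).

(* 2 r^-3 dr on (0, +oo) *)
Definition radius_measure (A : set (measurableTypeR R)) : \bar R :=
  (\int[leb]_(r in A `&` `]0%R, +oo[) (2 * r ^- 3)%:E)%E.

Let radius_density_ge0 (A : set R) r :
  (A `&` `]0%R, +oo[) r -> (0 <= (2 * r ^- 3)%:E :> \bar R)%E.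
Proof.
by move=> [_]; rewrite /= in_itv/= andbT lee_fin => r0; rewrite mulr_ge0 ?invr_ge0 ?exprn_ge0// ltW.
Qed.

Let measurable_radius_density (A : set (measurableTypeR R)) : measurable A ->
  measurable_fun (A `&` `]0%R, +oo[) (fun r : R => (2 * r ^- 3)%:E).
Proof.
move=> mA; apply/measurable_EFinP; apply: measurable_funM => //.
apply: (@measurable_comp _ _ _ _ _ _ [set x : R | x != 0]) => //.
- by apply: open_measurable; exact: open_neq.
- move=> _ /= [r [_ +] <-]; rewrite /= in_itv/= andbT => r0.
  by rewrite expf_neq0// gt_eqF.
- apply: open_continuous_measurable_fun; first exact: open_neq.
  by move=> x; rewrite inE => /= x0; exact: inv_continuous.
Qed.

Let radius_measure0 : radius_measure set0 = 0%E.
Proof. by rewrite /radius_measure set0I integral_set0. Qed.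

Let radius_measure_ge0 A : (0 <= radius_measure A)%E.
Proof. by apply: integral_ge0 => r; exact: radius_density_ge0. Qed.

Let radius_measure_sigma_additive : semi_sigma_additive radius_measure.
Proof.
move=> /= F mF tF mUF; apply: cvg_toP.
  apply: ereal_nondecreasing_is_cvgn => m n mn.
  by apply: lee_sum_nneg_natr => // k _ _; exact: radius_measure_ge0.
rewrite /radius_measure setI_bigcupl ge0_integral_bigcup//.
- by move=> k; apply: measurableI => //; exact: measurable_itv.
- by rewrite -setI_bigcupl; exact: measurable_radius_density.
- by rewrite -setI_bigcupl => r; exact: radius_density_ge0.
- apply/trivIsetP => i j _ _ ij; move/trivIsetP : tF => /(_ i j I I ij).
  by rewrite setIACA => ->; rewrite set0I.
Qed.

HB.instance Definition _ := isMeasure.Build _ _ _ radius_measure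
  radius_measure0 radius_measure_ge0 radius_measure_sigma_additive.

Let radius_measure_sigma_finite : sigma_finite setT radius_measure.
Proof.
pose F (n : nat) : set R := `]-oo, 0%R] `|` `[n.+1%:R^-1, n.+1%:R].
exists F.
  apply/seteqP; split => // r _; have [r0|r0] := leP r 0.
    by exists 0%N => //; left; rewrite /= in_itv.
  pose n := maxn (Num.truncn r) (Num.truncn r^-1); exists n => //; right.
  have H (x : R) : (Num.truncn x <= n)%N -> x <= n.+1%:R.
    move=> xn; rewrite (le_trans (ltW (truncnS_gt x)))//.
    by rewrite ler_nat ltnS.
  rewrite /= in_itv/= H ?leq_maxl// andbT -[leRHS]invrK lef_pV2 ?posrE ?invr_gt0//.
  by rewrite H// leq_maxr.
move=> n; have mF : measurable (F n) by apply: measurableU; exact: measurable_itv.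
split => //; rewrite /radius_measure.
have -> : F n `&` `]0%R, +oo[ = `[n.+1%:R^-1, n.+1%:R]%classic.
  apply/seteqP; split => r; rewrite /F/= !in_itv/= andbT.
    by move=> [[|//]]; rewrite leNgt => /negP.
  by move=> /[dup] ? /andP[r0 _]; split; [right|exact: lt_le_trans r0].
apply: (@le_lt_trans _ _ (\int[leb]_(r in `[n.+1%:R^-1%R, n.+1%:R])
    (2 * n.+1%:R ^+ 3)%:E)%E).
  apply: ge0_le_integral => //.
  - by move=> r /=; rewrite in_itv/= => /andP[r0 _]; rewrite lee_fin mulr_ge0// invr_ge0 exprn_ge0// (le_trans _ r0).
  - have -> : `[n.+1%:R^-1, n.+1%:R]%classic =
        `[n.+1%:R^-1, n.+1%:R]%classic `&` `](0 : R), +oo[%classic.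
      rewrite setIidl// => r /=; rewrite !in_itv/= => /andP[r0 _].
      by rewrite andbT; exact: lt_le_trans r0.
    by apply: measurable_radius_density; exact: measurable_itv.
  - move=> r /=; rewrite in_itv/= => /andP[r0 _]; rewrite lee_fin ler_pM2l//.
    rewrite -exprVn lerXn2r ?nnegrE// ?invr_ge0 ?(le_trans _ r0)//.
    by rewrite -[leRHS]invrK lef_pV2 ?posrE ?(lt_le_trans _ r0) ?invr_gt0.
rewrite integral_cst//= lebesgue_measure_itv/=; case: ifPn => _.
  by rewrite -EFinB -EFinM ltry.
by rewrite mule0 ltry.
Qed.

HB.instance Definition _ := @Measure_isSigmaFinite.Build _ _ _ radius_measure
  radius_measure_sigma_finite.

(* (1 / pi) dv on (-pi/2, pi/2] *)
Definition angle_range : set (measurableTypeR R) :=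
  `](- (pi / 2) : R), (pi / 2 : R)]%classic.

Let measurable_angle_range : measurable angle_range.
Proof. exact: measurable_itv. Qed.

Let angle_range_lty : (leb angle_range < +oo)%E.
Proof. by rewrite lebesgue_measure_itv/=; case: ifPn => _; rewrite ltry. Qed.

Definition angle_measure : set (measurableTypeR R) -> \bar R :=
  mscale ((PosNum (pi_gt0 R))%:num^-1)%:nng
    (mfrestr measurable_angle_range angle_range_lty).

HB.instance Definition _ := FiniteMeasure.on angle_measure.
HB.instance Definition _ := SigmaFiniteMeasure.on angle_measure.

Definition stick_space : set (stick R) :=
  [set s | 0 < radius s /\ angle_range (angle s)].

Definition stick_intensity : set (stick R) -> \bar R :=
  (((leb \x leb) \x radius_measure) \x angle_measure)%E.

Definition half_stick (s : stick R) : R * R :=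
  radius s *: (cos (angle s), sin (angle s)).

Definition stick_left (s : stick R) : R * R := centre s - half_stick s.
Definition stick_right (s : stick R) : R * R := centre s + half_stick s.

Definition stick_segment (s : stick R) : set (R * R) :=
  segment (stick_left s) (stick_right s).

Definition is_ips {d} {Omega : measurableType d} (u : R)
    (P : probability Omega R) (xi : Omega -> set (stick R)) : Prop :=
  (forall w, xi w `<=` stick_space) /\
  is_poisson_process P (fun A => u%:E * stick_intensity A)%E xi.

Definition arm {Omega : Type} (xi : Omega -> set (stick R)) (l1 l2 : R) :
    set Omega :=
  [set w | exists (n : nat) (s : nat -> stick R),
    let U := \bigcup_(i in `I_n.+1) stick_segment (s i) in
    [/\ forall i, (i <= n)%N -> xi w (s i),
        forall i, (i < n)%N ->
          stick_segment (s i) `&` stick_segment (s i.+1) !=set0,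
        U `&` circle l1 !=set0 &
        U `&` circle l2 !=set0]].

End Sticks.
Arguments stick_space : clear implicits.

Section Crossing.
Context {R : realType}.
Implicit Types (f g : R -> R * R) (z w : R * R).

(* A curve is represented by a parametrization, a function on [R] whose values
   matter on [0, 1] only. *)
Definition is_path f := {within `[0%R, 1%R], continuous f}.

(* A continuous bijection of [0, 1] is monotone; curves are not oriented. *)
Definition same_curve f g := exists phi : R -> R,
  [/\ {within `[0%R, 1%R], continuous phi},
      set_bij `[0%R, 1%R] `[0%R, 1%R] phi &
      {in `[0%R, 1%R], forall t, g t = f (phi t)}].

Section Access.
Variables (f : R -> R * R) (z w : R * R).

Definition stays_on_line (t0 a b : R) :=
  [/\ 0 <= a <= t0, t0 <= b <= 1 & f @` `[a, b] `<=` line z w].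

(* [a] is t0^- and [b] is t0^+ *)
Definition max_on_line (t0 a b : R) :=
  stays_on_line t0 a b /\
  forall a' b', stays_on_line t0 a' b' -> a <= a' /\ b' <= b.

Definition left_access t0 := exists b, max_on_line t0 t0 b /\ t0 <> 0.
Definition right_access t0 := exists a, max_on_line t0 a t0 /\ t0 <> 1.

Definition meets_before (t0 e : R) (H : set (R * R)) :=
  f @` (`](t0 - e), t0[ `&` `[0%R, 1%R]) `&` H !=set0.
Definition meets_after (t0 e : R) (H : set (R * R)) :=
  f @` (`]t0, (t0 + e)[ `&` `[0%R, 1%R]) `&` H !=set0.

Definition left_oscillation t0 :=
  forall e, 0 < e -> forall c, meets_before t0 e (half_plane z w c).
Definition right_oscillation t0 :=
  forall e, 0 < e -> forall c, meets_after t0 e (half_plane z w c).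

(* s^-(t0) is defined and equal to the half-plane [c] *)
Definition left_side t0 c :=
  [/\ left_access t0, ~ left_oscillation t0 &
      \forall e \near 0^'+, meets_before t0 e (half_plane z w c)].
Definition right_side t0 c :=
  [/\ right_access t0, ~ right_oscillation t0 &
      \forall e \near 0^'+, meets_after t0 e (half_plane z w c)].

Definition crosses_by_oscillation := exists t0,
  [/\ 0 <= t0 <= 1, left_oscillation t0 \/ right_oscillation t0 &
      open_segment z w (f t0)].

Definition crosses_by_sides := exists t0 a b c c',
  [/\ max_on_line t0 a b, f @` `[a, b] `<=` open_segment z w,
      left_side a c, right_side b c' & c != c'].

End Access.

Definition crosses f z w := exists2 g, same_curve f g &
  crosses_by_oscillation g z w \/ crosses_by_sides g z w.

End Crossing.

Section BoxCrossing.
Context {R : realType}.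

Definition vacant_crossing {Omega : Type} (xi : Omega -> set (stick R))
    (k l : R) : set Omega :=
  [set w | exists f : R -> R * R,
    [/\ is_path f,
        f @` `[0%R, 1%R] `<=` `[0%R, k * l] `*` `[0%R, l],
        (f 0).1 = 0,
        (f 1).1 = k * l &
        forall s, xi w s -> ~ crosses f (stick_left s) (stick_right s)]].

Definition box_crossing_property (u : R) : Prop :=
  forall k, 0 < k -> exists2 delta, 0 < delta &
  forall l, 0 < l ->
  forall d (Omega : measurableType d) (P : probability Omega R) xi,
    is_ips u P xi ->
    exists2 p, has_prob P (vacant_crossing xi k l) p &
               delta <= p <= 1 - delta.

(* In [\bar R], as [sup] of an unbounded set of reals would be [0]. *)
Definition ubar : \bar R :=
  ereal_sup [set u%:E | u in [set u | 0 < u /\ box_crossing_property u]].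

End BoxCrossing.
Arguments ubar : clear implicits.

(* Main.v *)
(** Idea. Choose [u'] in the box-crossing range with [u < u']. Lengthening every
    stick of the soup of intensity [u] by the factor sqrt (u' / u) > 1 gives a
    soup of intensity [u']. If a chain of sticks traverses a 6l x 2l rectangle,
    its lengthened version admits no vacant path along the rectangle: near the
    contact points the path cannot slip past the ends of the longer sticks. So
    such chains have probability at most 1 - delta, and by positive association
    the annulus between the boxes of radii l and 3l is traversed with probability
    at most q = 1 - delta^4.

    Sticks are arbitrarily long, so distinct scales are not independent. An arm
    from l to M^J l is split according to the last k such that a stick meeting
    the box of radius 3l reaches distance M^k l (probability O(M^-k)): the sticks
    avoiding the box of radius 3l then form an arm from M^(k+1) l to M^J l, which
    is independent of the sticks meeting that box. For M large this recursion
    gives the bound lam^J with lam < 1. *)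

From HB Require Import structures.
Require Import Defs.
From mathcomp Require Import all_boot all_order all_algebra.
From mathcomp Require Import all_classical all_reals all_analysis measurable_realfun.
From mathcomp Require Import finmap ring lra zify.

Set Implicit Arguments.
Unset Strict Implicit.
Unset Printing Implicit Defensive.

Import Order.TTheory GRing.Theory Num.Theory.
Import numFieldNormedType.Exports.

Local Open Scope classical_set_scope.
Local Open Scope ring_scope.

(** * Chains of sticks block paths *)

(** A path in [vacant_crossing] is merely continuous and [crosses] looks at one stick at a time, so
    blocking is a parity argument: the number of edges of the chain below the moving point keeps its
    parity along a path that crosses no stick, yet the two ends of the path have different parities.
    It asks that no stick be vertical and that consecutive sticks coincide or be non-parallel, which
    holds outside a null set.

    The Poisson hypothesis only speaks of counts, while the existence of a chain is not determined
    by finitely many of them. Association and independence are first proved for functionals of the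
    occupied cells of a partition, then carried to chains by two monotone limits: finer cells, which
    works because meeting is a closed condition on pairs of sticks, and larger windows, which works
    because a chain is finite.

    A stick reaching scale k costs O(M^-k) but spoils the gain lam^(k+1) of the first k+1 scales.
    With M = N^2 and lam >= 1/2, half of the exponent pays for this loss and the other half leaves a
    geometric series. *)

Section Topology.
Context {R : realType}.

Lemma path_eps (f : R -> R * R) t e : is_path f -> 0 <= t <= 1 -> 0 < e ->
  exists2 d, 0 < d & forall r, 0 <= r <= 1 -> `|r - t| < d ->
    `|(f r).1 - (f t).1| < e /\ `|(f r).2 - (f t).2| < e.
Proof.
move=> /subspace_continuousP fc t01 e0.
have /fc : `[0, 1]%classic t by rewrite /= in_itv.
move/cvgrPdist_lt => /(_ e e0); rewrite near_withinE => /nbhs_ballP[d /= d0 H].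
exists d => // r r01 rd; have := H r; rewrite -ball_normE /= distrC => /(_ rd).
rewrite in_itv/= r01 => /(_ isT).
rewrite prod_normE /= gt_max => /andP[h1 h2].
by split; rewrite distrC.
Qed.

Definition cont01 (g : R -> R) := forall t e, 0 <= t <= 1 -> 0 < e ->
  exists2 d, 0 < d & forall r, 0 <= r <= 1 -> `|r - t| < d -> `|g r - g t| < e.

(** [c] is the supremum of the times in [[t1, t2]] where [g] is positive and [d] the infimum of the
    later times where it is negative; in between [g] can only vanish. For [g] the side of a line,
    [[c, d]] is a maximal stay on the line, entered from one side and left to the other. *)
Lemma sign_switch (g : R -> R) t1 t2 : cont01 g -> 0 <= t1 -> t2 <= 1 -> t1 < t2 ->
  0 < g t1 -> g t2 < 0 ->
  exists c d, [/\ t1 < c <= d, d < t2,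
    (forall r, c <= r <= d -> g r = 0),
    (forall e, 0 < e -> exists r, [/\ c - e < r, r < c, t1 <= r & 0 < g r]) &
    (forall e, 0 < e -> exists r, [/\ d < r, r < d + e, r <= t2 & g r < 0])].
Proof.
move=> gc t10 t21 t12 g1 g2.
pose S := [set r | t1 <= r <= t2 /\ 0 < g r].
have S1 : S t1 by split => //; rewrite lexx ltW.
have supS : has_sup S.
  by split; [exists t1|exists t2 => r [/andP[]]].
pose c := sup S.
have c1 : t1 <= c by apply: ub_le_sup => //; case: supS.
have c2 : c <= t2 by apply: ge_sup => [|r [/andP[]]//]; exists t1.
have c01 : 0 <= c <= 1 by apply/andP; split; lra.
have Sc : forall r, c < r -> r <= t2 -> g r <= 0.
  move=> r cr rt; rewrite leNgt; apply/negP => gr.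
  have : r <= c by apply: ub_le_sup => //; [case: supS|split => //; apply/andP; split; lra].
  by lra.
have gc0 : g c = 0.
  apply/eqP; rewrite eq_le; apply/andP; split; rewrite leNgt; apply/negP => h.
    have ct2 : c < t2 by rewrite lt_neqAle c2 andbT; apply/eqP => ct2; move: h; rewrite ct2; lra.
    have [d d0 /(_ (Num.min (c + d / 2) t2))] := gc c (g c) c01 h.
    set r := Num.min _ _.
    have rt : r <= t2 by rewrite ge_min lexx orbT.
    have rd : r <= c + d / 2 by rewrite ge_min lexx.
    have cr : c < r by rewrite lt_min ct2 andbT; lra.
    have := Sc r cr rt => gr.
    have r01 : 0 <= r <= 1 by apply/andP; split; lra.
    move=> /(_ r01); rewrite ger0_norm; last lra.
    move=> /(_ ltac:(lra)); rewrite ltr_norml; lra.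
  have [d d0 H] := gc c (- g c) c01 ltac:(lra).
  have [r [/andP[r1 r2] gr] cr] := @sup_adherent _ S d d0 supS.
  have rc : r <= c by apply: ub_le_sup => //; [case: supS|split => //; rewrite r1 r2].
  have r01 : 0 <= r <= 1 by apply/andP; split; lra.
  have := H r r01; rewrite ler0_norm; last lra.
  rewrite -/c in cr.
  by move=> /(_ ltac:(lra)); rewrite ltr_norml; lra.
have t1c : t1 < c by rewrite lt_neqAle c1 andbT; apply/eqP => h; move: gc0; rewrite -h; lra.
have ct2 : c < t2 by rewrite lt_neqAle c2 andbT; apply/eqP => h; move: gc0; rewrite h; lra.
pose S' := [set r | c <= r <= t2 /\ g r < 0].
have S'2 : S' t2 by split => //; rewrite lexx c2.
have infS : has_inf S'.
  by split; [exists t2|exists c => r [/andP[]]].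
pose d := inf S'.
have cd : c <= d by apply: lb_le_inf => [|r [/andP[]]//]; exists t2.
have dt2 : d <= t2 by apply: ge_inf => //; case: infS.
have z r : c <= r -> r < d -> g r = 0.
  move=> cr rd.
  have h1 : 0 <= g r.
    rewrite leNgt; apply/negP => gr.
    suff : d <= r by lra.
    by apply: ge_inf => //; [case: infS|split => //; apply/andP; split; lra].
  have [->//|nc] := eqVneq r c.
  have h2 : g r <= 0 by apply: Sc; [rewrite lt_neqAle eq_sym nc|lra].
  by apply/eqP; rewrite eq_le h1 h2.
have d01 : 0 <= d <= 1 by apply/andP; split; lra.
have gd0 : g d = 0.
  have [dc|nc] := eqVneq d c; first by rewrite dc.
  have cd' : c < d by rewrite lt_neqAle eq_sym nc.
  apply/eqP; rewrite -normr_eq0 eq_le normr_ge0 andbT; apply/ler_addgt0Pl => e e0.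
  rewrite addr0.
  have [dl d0 H] := gc d e d01 e0.
  pose r := Num.max c (d - dl / 2).
  have cr : c <= r by rewrite le_max lexx.
  have dr : d - dl / 2 <= r by rewrite le_max lexx orbT.
  have rd : r < d by rewrite gt_max cd'; lra.
  have := H r; rewrite (z r)// sub0r normrN ler0_norm; last lra.
  by move=> h; apply/ltW/h; [apply/andP; split|]; lra.
have dt2' : d < t2 by rewrite lt_neqAle dt2 andbT; apply/eqP => h; move: gd0; rewrite h; lra.
exists c, d; split => //; first by rewrite t1c.
- move=> r /andP[cr]; rewrite le_eqVlt => /predU1P[->//|rd]; exact: z.
- move=> e e0; have [r [/andP[r1 r2] gr] cr] := @sup_adherent _ S e e0 supS.
  exists r; split => //.
  have : r <= c by apply: ub_le_sup => //; [case: supS|split => //; rewrite r1 r2].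
  rewrite le_eqVlt => /predU1P[rc|//]; move: gr; rewrite rc gc0; lra.
- move=> e e0; have [r [/andP[r1 r2] gr] cr] := @inf_adherent _ S' e e0 infS.
  exists r; split => //.
  have : d <= r by apply: ge_inf => //; [case: infS|split => //; rewrite r1 r2].
  rewrite le_eqVlt => /predU1P[rc|//]; move: gr; rewrite -rc gd0; lra.
Qed.

Lemma scaleRE (a b : R) : a *: b = a * b. Proof. by []. Qed.

Lemma lineP (z w x : R * R) : z <> w -> line z w x <-> side z w x = 0.
Proof.
case: z w x => z1 z2 [w1 w2] [x1 x2] zw; rewrite /line /side /=; split.
  move=> [t _ [<- <-]] /=; rewrite !scaleRE; ring.
move=> h.
have [e1|n1] := eqVneq w1 z1.
  have n2 : w2 - z2 != 0.
    by rewrite subr_eq0; apply/eqP => e2; apply: zw; rewrite e1 e2.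
  exists ((x2 - z2) / (w2 - z2)) => //; congr pair; rewrite /= !scaleRE.
    rewrite e1 subrr mulr0 addr0; move: h; rewrite e1 subrr mul0r sub0r => /eqP.
    by rewrite oppr_eq0 mulf_eq0 (negbTE n2)/= subr_eq0 => /eqP.
  by field.
have n1' : w1 - z1 != 0 by rewrite subr_eq0.
exists ((x1 - z1) / (w1 - z1)) => //; congr pair; rewrite /= !scaleRE.
  by field.
have h' : (w1 - z1) * (x2 - z2) = (w2 - z2) * (x1 - z1) by lra.
have -> : x2 = z2 + (w2 - z2) * (x1 - z1) / (w1 - z1).
  by rewrite -h' [_ * (x2 - z2)]mulrC mulfK//; ring.
by congr (_ + _); rewrite mulrC mulrA.
Qed.

End Topology.

Section Topology.
Context {R : realType}.
Section NoCross.
Variables (f : R -> R * R) (z w : R * R).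
Hypotheses (fp : is_path f) (zw : z <> w) (nc : ~ crosses f z w).

Lemma side_cont : cont01 (fun t => side z w (f t)).
Proof.
move=> t e t01 e0.
pose M := 1 + `|w.1 - z.1| + `|w.2 - z.2|.
have M0 : 0 < M by rewrite /M; have := normr_ge0 (w.1 - z.1); have := normr_ge0 (w.2 - z.2); lra.
have [d d0 H] := path_eps fp t01 (divr_gt0 e0 M0).
exists d => // r r01 rd; have [h1 h2] := H r r01 rd.
have -> : side z w (f r) - side z w (f t) =
  (w.1 - z.1) * ((f r).2 - (f t).2) - (w.2 - z.2) * ((f r).1 - (f t).1).
  by rewrite /side; ring.
apply: le_lt_trans (ler_normB _ _) _; rewrite !normrM.
have -> : e = M * (e / M) by rewrite mulrC divfK// gt_eqF.
set e' := e / M in h1 h2 *.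
have e'0 : 0 < e' by exact: divr_gt0.
have k1 := ler_wpM2l (normr_ge0 (w.1 - z.1)) (ltW h2).
have k2 := ler_wpM2l (normr_ge0 (w.2 - z.2)) (ltW h1).
rewrite /M; lra.
Qed.

Let not_crossing : ~ crosses_by_oscillation f z w /\ ~ crosses_by_sides f z w.
Proof.
have sc : same_curve f f.
  exists id; split => //.
    by apply: continuous_subspaceT => x; exact: cvg_id.
  by split; [by []|by []|by move=> x /= ?; exists x].
by split => h; apply: nc; exists f => //; [left|right].
Qed.

Definition in_slit_plane (t : R) := side z w (f t) = 0 -> open_segment z w (f t).

Let hp (b : bool) x := half_plane z w b x.

(** Otherwise [sign_switch] gives a stay [[c, d]] on the line, inside the open segment by
    hypothesis. An oscillation before [c] or after [d] would be a crossing of the first kind;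
    without one both sides are defined and differ, a crossing of the second kind. *)
Lemma no_switch (b : bool) t1 t2 : 0 <= t1 -> t2 <= 1 -> t1 < t2 ->
  (forall r, t1 <= r <= t2 -> in_slit_plane r) -> hp b (f t1) -> hp (~~ b) (f t2) -> False.
Proof.
move=> t10 t21 t12 fr h1 h2; have [nosc nsid] := not_crossing.
(* The factor makes [g] positive on the side [b], so that both directions of switching are one
   case. *)
pose g t := (if b then 1 else -1) * side z w (f t).
have gE e x : hp (e == b) (f x) <-> (if e then 0 < g x else g x < 0).
  rewrite /hp /half_plane /g /= {h1 h2 g}; case: e; case: (b) => /=; rewrite ?mul1r ?mulN1r ?oppr_gt0 ?oppr_lt0//.
have gc : cont01 g.
  move=> t e t01 e0; have [d d0 H] := side_cont t01 e0; exists d => // r r01 /(H r r01).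
  by rewrite /g -mulrBr normrM; case: (b); rewrite ?normrN ?normr1 mul1r.
have g1 : 0 < g t1 by apply/(gE true); suff -> : (true == b) = b by []; case: (b).
have g2 : g t2 < 0 by apply/(gE false); suff -> : (false == b) = ~~ b by []; case: (b).
have [c [d [/andP[t1c cd] dt2 z0 accl accr]]] := sign_switch gc t10 t21 t12 g1 g2.
have zero r : c <= r <= d -> side z w (f r) = 0.
  by move=> /z0 /eqP; rewrite mulf_eq0 => /orP[|/eqP//]; case: (b); rewrite ?oppr_eq0 oner_eq0.
have on r : c <= r <= d -> open_segment z w (f r).
  by move=> h; apply: fr; [lra|exact: zero].
have mol t0 : c <= t0 <= d -> max_on_line f z w t0 c d.
  move=> h; split.
    split; [lra|lra|].
    by move=> _ [r /= + <-]; rewrite in_itv/= => /zero/lineP; apply.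
  move=> a' b' [ha hb ls]; split; rewrite leNgt; apply/negP => hh.
    have [r [r1 r2 r3 r4]] := accl (c - a') ltac:(lra).
    have : line z w (f r) by apply: ls; exists r => //=; rewrite in_itv/=; lra.
    by move=> /lineP - /(_ zw) s0; move: r4; rewrite /g s0 mulr0 ltxx.
  have [r [r1 r2 r3 r4]] := accr (b' - d) ltac:(lra).
  have : line z w (f r) by apply: ls; exists r => //=; rewrite in_itv/=; lra.
  by move=> /lineP - /(_ zw) s0; move: r4; rewrite /g s0 mulr0 ltxx.
have c01 : 0 <= c <= 1 by lra.
have d01 : 0 <= d <= 1 by lra.
have no1 : ~ left_oscillation f z w c.
  by move=> h; apply: nosc; exists c; split => //; [left|apply: on; lra].
have no2 : ~ right_oscillation f z w d.
  by move=> h; apply: nosc; exists d; split => //; [right|apply: on; lra].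
apply: nsid; exists c, c, d, b, (~~ b); split.
- by apply: mol; lra.
- by move=> _ [r /= + <-]; rewrite in_itv/=; exact: on.
- split => //.
    exists d; split; [by apply: mol; lra|lra].
  near=> e.
  have e0 : 0 < e by near: e; exact: nbhs_right_gt.
  have [r [r1 r2 r3 r4]] := accl e e0.
  exists (f r); split; last by move/(gE true): r4; rewrite /hp; case: (b).
  by exists r => //; split; rewrite /= in_itv/=; lra.
- split => //.
    exists c; split; [by apply: mol; lra|lra].
  near=> e.
  have e0 : 0 < e by near: e; exact: nbhs_right_gt.
  have [r [r1 r2 r3 r4]] := accr e e0.
  exists (f r); split; last by move/(gE false): r4; rewrite /hp; case: (b).
  by exists r => //; split; rewrite /= in_itv/=; lra.
- by case: (b).
Unshelve. all: by end_near.
Qed.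

Definition between (s t r : R) := (s <= r <= t) \/ (t <= r <= s).

(* The side of the slit plane (the plane minus the part of the line outside the
   open segment) from which a curve that does not cross the segment comes. *)
Definition stick_side (t : R) : Prop := exists s, [/\ 0 <= s <= 1,
  0 < side z w (f s) & forall r, between s t r -> in_slit_plane r].

Lemma stick_side_gt0 t : 0 <= t <= 1 -> 0 < side z w (f t) -> stick_side t.
Proof.
move=> t01 h; exists t; split => // r h' s0.
have rt : r = t by case: h'; lra.
by move: h; rewrite -rt s0 ltxx.
Qed.

Lemma stick_side_lt0 t : 0 <= t <= 1 -> side z w (f t) < 0 -> ~ stick_side t.
Proof.
move=> t01 h [s [s01 s0 fr]].
have [st|ts|st] := ltgtP s t.
- by apply: (@no_switch true s t) => //; [lra|lra|move=> r hr; apply: fr; left].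
- by apply: (@no_switch false t s) => //; [lra|lra|move=> r hr; apply: fr; right].
- by move: h; rewrite -st; lra.
Qed.

(** A time between the starting time [s'] of the witness and [t] lies between [s] and [t] or between
    [s'] and [s], so the witness for [s] also serves [t]. *)
Lemma stick_side_free s t : (forall r, between s t r -> in_slit_plane r) ->
  stick_side s -> stick_side t.
Proof.
move=> h [s' [s01 s0 fr]]; exists s'; split => // r hr.
have [h1|h1] := pselect (between s t r); first exact: h.
apply: fr; move: hr h1; rewrite /between.
move=> [] /andP[a b] h1.
  have [rs|rs] := leP r s; [left; lra|exfalso; apply: h1; left; lra].
have [rs|rs] := leP s r; [right; lra|exfalso; apply: h1; right; lra].
Qed.

End NoCross.
End Topology.

(** * Parity of the edges of a chain below a moving point *)

Section Parity.
Context {R : realType}.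

Lemma common_delta n (P : nat -> R -> Prop) (t : R) :
  (forall i, (i < n)%N -> exists2 d, 0 < d &
     forall r, 0 <= r <= 1 -> `|r - t| < d -> P i r) ->
  exists2 d, 0 < d &
     forall r, 0 <= r <= 1 -> `|r - t| < d -> forall i, (i < n)%N -> P i r.
Proof.
elim: n => [|n IH] H; first by exists 1.
have [d d0 Hd] := IH (fun i (h : (i < n)%N) => H i (ltnW h)).
have [d' d'0 Hd'] := H n (ltnSn n).
exists (Num.min d d'); first by rewrite lt_min d0 d'0.
move=> r r01; rewrite lt_min => /andP[h1 h2] i; rewrite ltnS leq_eqVlt => /predU1P[->|].
  exact: Hd'.
exact: Hd.
Qed.

(** Recoded with values 1 and -1, a change of value would force a zero by [sign_switch]. *)
Lemma locally_constant01 (W : R -> bool) :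
  (forall t, 0 <= t <= 1 -> exists2 d, 0 < d &
     forall r, 0 <= r <= 1 -> `|r - t| < d -> W r = W t) -> W 0 = W 1.
Proof.
move=> H; apply/eqP/negPn/negP => W01.
pose g t : R := if W t == W 0 then 1 else -1.
have gc : cont01 g.
  move=> t e /H[d d0 Hd] e0; exists d => // r r01 rt.
  by rewrite /g (Hd r)// subrr normr0.
have := sign_switch gc (lexx 0) (lexx 1) ltr01.
rewrite /g eqxx eq_sym (negbTE W01) => /(_ ltac:(lra) ltac:(lra)).
move=> [c [d [/andP[c0 cd] d1 h _ _]]].
have : g c = 0 by apply: h; lra.
rewrite /g; case: ifP => _; lra.
Qed.

(* Parity of the number of edges of a polygonal line that lie below a point:
   [A i] says that the i-th vertex is to the left of the point, [s i.+1] that the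
   point is above the i-th edge. The line is prolonged to the right from its
   lowest vertex, so the parity is [false] far to the left of the line and
   [true] far to its right. *)
Fixpoint parity (A s : nat -> bool) n : bool :=
  if n is m.+1 then parity A s m (+) ((A m (+) A m.+1) && s m.+1) else A 0%N.

Lemma eq_parity A s s' n :
  (forall i, (i < n)%N -> (A i (+) A i.+1) && s i.+1 = (A i (+) A i.+1) && s' i.+1) ->
  parity A s n = parity A s' n.
Proof.
elim: n => //= n IH H; rewrite H//; congr (_ (+) _); apply: IH => i h; apply: H.
exact: ltnW.
Qed.

(** Flipping the bit of vertex [i] toggles its two adjacent edges, whose contributions [s i] and
    [s i.+1] cancel when they agree; for [i = 0] the first of them is the prolonging ray, counted by
    [s 0]. Only the last vertex, which has a single edge, leaves a trace. *)
Lemma parity_diff (A B s : nat -> bool) n : s 0%N ->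
  (forall i, (i < n)%N -> A i = B i \/ s i = s i.+1) ->
  parity A s n (+) parity B s n = (A n (+) B n) && s n.
Proof.
move=> s0; elim: n => [_|n IH H] /=; first by rewrite s0 andbT.
have := IH (fun i (h : (i < n)%N) => H i (ltnW h)).
have := H n (ltnSn n).
case: (parity A s n); case: (parity B s n); case: (A n); case: (B n); case: (A n.+1);
case: (B n.+1); case: (s n); case: (s n.+1) => //= -[]//.
Qed.

Lemma open_segmentE (z w x : R * R) : z.1 < w.1 -> side z w x = 0 ->
  open_segment z w x <-> z.1 < x.1 < w.1.
Proof.
case: z w x => z1 z2 [w1 w2] [x1 x2] /= zw h.
have d0 : w1 - z1 != 0 by rewrite subr_eq0 gt_eqF.
have d0' : 0 < w1 - z1 by lra.
split.
  move=> [[t /= + e]]; rewrite in_itv/= => /andP[t0 t1].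
  move: e => [e1 e2] /=; rewrite scaleRE in e1; rewrite scaleRE in e2.
  move=> /not_orP[n1 n2].
  have t0' : t != 0.
    by apply/eqP => t0'; apply: n1; rewrite -e1 -e2 t0' !mul0r !addr0.
  have t1' : t != 1.
    by apply/eqP => t1'; apply: n2; rewrite -e1 -e2 t1' !mul1r; congr pair => /=; lra.
  have a : 0 < t by rewrite lt_neqAle eq_sym t0'.
  have b : t < 1 by rewrite lt_neqAle t1'.
  rewrite -e1 ltrDl mulr_gt0//=; nra.
move=> /andP[h1 h2].
have [t _ ht] : line (z1, z2) (w1, w2) (x1, x2).
  by apply/lineP => //; case=> e _; move: d0; rewrite e subrr eqxx.
have [e1 e2] := ht; rewrite /= scaleRE in e1; rewrite /= in h1 h2.
split.
  exists t => //; rewrite /= in_itv/=; apply/andP; split.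
    by rewrite -(pmulr_lge0 _ d0'); lra.
  by rewrite -(ler_pM2r d0'); lra.
by move=> []; case=> e _; lra.
Qed.

Section PolygonalChain.
Implicit Types t r : R.
Variables (f : R -> R * R) (n : nat) (z w p : nat -> R * R).
Hypothesis fp : is_path f.
Hypothesis nc : forall i, (i <= n)%N -> ~ crosses f (z i) (w i).
Hypothesis zw : forall i, (i <= n)%N -> (z i).1 < (w i).1.
Hypothesis pl : forall i, (i <= n)%N -> open_segment (z i) (w i) (p i).
Hypothesis pr : forall i, (i <= n)%N -> open_segment (z i) (w i) (p i.+1).
Definition slope_det (v v' : R * R) := v.1 * v'.2 - v.2 * v'.1.
Hypothesis turn : forall i, (i < n)%N ->
  (z i = z i.+1 /\ w i = w i.+1) \/ slope_det (w i - z i) (w i.+1 - z i.+1) != 0.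
Hypothesis left_end : forall i, (i <= n.+1)%N -> (f 0).1 < (p i).1.
Hypothesis right_end : forall i, (i <= n.+1)%N -> (p i).1 < (f 1).1.
Hypothesis bottom : forall t, 0 <= t <= 1 -> (p 0%N).2 < (f t).2.
Hypothesis top : forall t, 0 <= t <= 1 -> (f t).2 < (p n.+1).2.

Let sd i t := side (z i) (w i) (f t).

Let zw' i : (i <= n)%N -> z i <> w i.
Proof. by move=> /zw h e; move: h; rewrite e ltxx. Qed.

(** Shifted by one: [s t 0] is for the ray that prolongs the chain at [p 0], which the path stays
    above; [s t i.+1] is for stick [i]; past the last stick the value is [false], since the path
    stays below [p n.+1]. *)
Let s t i : bool :=
  if i is j.+1 then if (j <= n)%N then `[< stick_side f (z j) (w j) t >] else false
  else true.

Let s_gt0 i t : 0 <= t <= 1 -> (i <= n)%N -> 0 < sd i t -> s t i.+1 = true.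
Proof. by move=> t01 ni h /=; rewrite ni; apply/asboolT/stick_side_gt0. Qed.

Let s_lt0 i t : 0 <= t <= 1 -> (i <= n)%N -> sd i t < 0 -> s t i.+1 = false.
Proof.
by move=> t01 ni h /=; rewrite ni; apply/asboolF/stick_side_lt0 => //; [exact: zw'|exact: nc].
Qed.

Let sd_line i j t : (i <= n)%N -> (j = i \/ j = i.+1) ->
  sd i t = ((w i).1 - (z i).1) * ((f t).2 - (p j).2) -
           ((w i).2 - (z i).2) * ((f t).1 - (p j).1).
Proof.
move=> ni ij.
have : side (z i) (w i) (p j) = 0.
  apply/lineP; first exact: zw'.
  have : open_segment (z i) (w i) (p j) by case: ij => ->; [exact: pl|exact: pr].
  by move=> [[r _ <-] _]; exists r.
rewrite /sd /side; lra.
Qed.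

(** Off the line the sign of [sd i] is locally constant and decides the side. On the open segment a
    short time interval keeps the path in the slit plane, where [stick_side_free] transports the
    side. *)
Let s_const i t : 0 <= t <= 1 -> (i <= n)%N -> in_slit_plane f (z i) (w i) t ->
  exists2 d, 0 < d & forall r, 0 <= r <= 1 -> `|r - t| < d -> s r i.+1 = s t i.+1.
Proof.
move=> t01 ni fr; have sc := side_cont (z i) (w i) fp.
have [neg|pos|zero] := ltgtP (sd i t) 0.
- have [d d0 H] := sc t (- sd i t) t01 ltac:(lra).
  exists d => // r r01 /(H r r01); rewrite ltr_norml => /andP[_ h].
  by rewrite !s_lt0//; rewrite /sd in neg h *; lra.
- have [d d0 H] := sc t (sd i t) t01 ltac:(lra).
  exists d => // r r01 /(H r r01); rewrite ltr_norml => /andP[h _].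
  by rewrite !s_gt0//; rewrite /sd in pos h *; lra.
have /(open_segmentE (zw ni) zero)/andP[h1 h2] := fr zero.
have e0 : 0 < Num.min ((f t).1 - (z i).1) ((w i).1 - (f t).1).
  by rewrite lt_min; apply/andP; split; lra.
have [d d0 H] := path_eps fp t01 e0.
have frn r : 0 <= r <= 1 -> `|r - t| < d -> in_slit_plane f (z i) (w i) r.
  move=> r01 /(H r r01)[+ _] s0; rewrite lt_min !ltr_norml => h.
  by apply/(open_segmentE (zw ni) s0); lra.
exists d => // r r01 rt /=; rewrite ni.
have frb q : between r t q -> in_slit_plane f (z i) (w i) q.
  move=> hq; apply: frn; first by case: hq; lra.
  by move: rt; rewrite !ltr_norml; case: hq; lra.
by apply: asbool_equiv_eq; split; apply: stick_side_free => q hq; apply: frb => //; case: hq; [right|left].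
Qed.

(* When the path sits at the vertex [p i], it does so in the sector given by its
   sides [s t i] and [s t i.+1] of the two adjacent edges; [dir] is the first
   coordinate of the vector whose determinants with both edges are the
   corresponding signs. *)
Let dir t i : R :=
  if i is j.+1 then
    let v := w j - z j in let v' := w i - z i in
    (v'.1 * (-1) ^+ (~~ s t i) - v.1 * (-1) ^+ (~~ s t i.+1)) / slope_det v v'
  else 0.

Let A t i : bool := if f t == p i then 0 <= dir t i else (p i).1 <= (f t).1.

Let A_far i t : (f t).1 != (p i).1 -> A t i = ((p i).1 <= (f t).1).
Proof. by move=> h; rewrite /A; case: eqP => // e; move: h; rewrite e eqxx. Qed.

Let A_const i t : 0 <= t <= 1 -> (i <= n.+1)%N -> (f t).1 != (p i).1 ->
  exists2 d, 0 < d & forall r, 0 <= r <= 1 -> `|r - t| < d ->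
    A r i = A t i /\ A r i = ((p i).1 <= (f r).1).
Proof.
move=> t01 ni ne.
have e0 : 0 < `|(f t).1 - (p i).1| by rewrite normr_gt0 subr_eq0.
have [d d0 H] := path_eps fp t01 e0.
exists d => // r r01 /(H r r01)[+ _]; rewrite ltr_norml => h.
have nr : (f r).1 != (p i).1.
  apply/eqP => e; move: h; rewrite e.
  by have [a|a] := ger0P ((f t).1 - (p i).1) => h; lra.
rewrite !A_far//; split => //.
move: h; have [a|a] := ger0P ((f t).1 - (p i).1) => h.
  by apply/idP/idP; lra.
by apply/idP/idP; lra.
Qed.

(** The side of stick [i] can jump only when the path is on its line outside the open stick. The
    abscissa of the path is then outside the range of the stick, so both contact points lie on the
    same side of it and the term vanishes near [t]. *)
Let term_const i t : 0 <= t <= 1 -> (i < n.+1)%N ->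
  exists2 d, 0 < d & forall r, 0 <= r <= 1 -> `|r - t| < d ->
    (A r i (+) A r i.+1) && s r i.+1 = (A r i (+) A r i.+1) && s t i.+1.
Proof.
move=> t01 ni.
have [fr|nfr] := pselect (in_slit_plane f (z i) (w i) t).
  by have [d d0 H] := s_const t01 ni fr; exists d => // r r01 /(H r r01) ->.
have /not_implyP[zero nos] := nfr.
have /negP : ~ (z i).1 < (f t).1 < (w i).1.
  by move=> h; apply: nos; apply/(open_segmentE (zw ni) zero).
have in_seg j : (j = i \/ j = i.+1) -> (z i).1 < (p j).1 < (w i).1.
  move=> ij; have os : open_segment (z i) (w i) (p j) by case: ij => ->; [exact: pl|exact: pr].
  apply/(open_segmentE (zw ni)) => //; apply/lineP; first exact: zw'.
  by case: os => [[r _ <-] _]; exists r.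
have h1 := in_seg i (or_introl erefl); have h2 := in_seg i.+1 (or_intror erefl).
move=> out.
have n1 : (f t).1 != (p i).1 by apply/eqP => e; move/negP: out; apply; rewrite e.
have n2 : (f t).1 != (p i.+1).1 by apply/eqP => e; move/negP: out; apply; rewrite e.
have [d d0 H] := A_const t01 (ltnW ni) n1.
have [d' d'0 H'] := A_const t01 ni n2.
exists (Num.min d d'); first by rewrite lt_min d0 d'0.
move=> r r01; rewrite lt_min => /andP[/(H r r01)[-> _] /(H' r r01)[-> _]].
suff -> : A t i = A t i.+1 by rewrite addbb.
rewrite !A_far//; apply/idP/idP => h; rewrite leNgt; apply/negP => h';
  by move/negP: out; apply; lra.
Qed.

(** Straight above or below [p i] the path is on the same side of both edges, as neither is
    vertical. At [p i] itself with different sides, it stays for a while in the sector of the two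
    lines given by these sides; that sector is entirely to the left or entirely to the right of the
    vertex, and [dir] tells which. *)
Let vertex i t : 0 <= t <= 1 -> (i < n.+2)%N ->
  exists2 d, 0 < d & forall r, 0 <= r <= 1 -> `|r - t| < d ->
    A r i = A t i \/ s t i = s t i.+1.
Proof.
move=> t01 ni.
have [e1|n1] := eqVneq (f t).1 (p i).1; last first.
  by have [d d0 H] := A_const t01 ni n1; exists d => // r r01 /(H r r01)[]; left.
have [e2|n2] := eqVneq (f t).2 (p i).2; last first.
  exists 1 => // r _ _; right.
  have sE j : (j <= n)%N -> (i = j \/ i = j.+1) -> s t j.+1 = ((p i).2 < (f t).2).
    move=> jn ij; have h := sd_line t jn ij.
    move: h; rewrite e1 subrr mulr0 subr0 => h; have v0 := zw jn.
    move: n2; rewrite neq_lt => /orP[lt|lt].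
      by rewrite s_lt0// ?[RHS]ltNge ?(ltW lt)// h; nra.
    by rewrite s_gt0// ?lt// h; nra.
  have b0 := bottom t01; have tn := top t01.
  case: i ni e1 n2 sE => [|i] ni e1 n2 sE.
    by rewrite (sE 0%N) ?b0 //; left.
  rewrite (sE i)//; last by right.
  move: ni; rewrite !ltnS leq_eqVlt => /predU1P[ein|ni].
    by rewrite /= ein ltnn [LHS]ltNge (ltW tn).
  by rewrite (sE i.+1)//; left.
have ftp : f t = p i by rewrite [LHS]surjective_pairing [RHS]surjective_pairing e1 e2.
case: i ni e1 e2 ftp => [|i] ni e1 e2 ftp; first by have := bottom t01; rewrite ftp ltxx.
have {ni}ni : (i < n)%N.
  move: ni; rewrite !ltnS leq_eqVlt => /predU1P[ein|//].
  by have := top t01; rewrite ftp ein ltxx.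
have fr1 : in_slit_plane f (z i) (w i) t by move=> _; rewrite ftp; apply: pr; exact: ltnW.
have fr2 : in_slit_plane f (z i.+1) (w i.+1) t by move=> _; rewrite ftp; apply: pl.
have [d d0 H] := s_const t01 (ltnW ni) fr1.
have [d' d'0 H'] := s_const t01 ni fr2.
exists (Num.min d d'); first by rewrite lt_min d0 d'0.
move=> r r01; rewrite lt_min => /andP[/(H r r01) s1 /(H' r r01) s2].
have [ss|nss] := eqVneq (s t i.+1) (s t i.+2); first by right.
left; rewrite /A ftp eqxx.
have dirE : dir r i.+1 = dir t i.+1 by rewrite /dir s1 s2.
case: eqP => [_|nfr]; first by rewrite dirE.
(* By [turn] a zero determinant means equal sticks, whose sides would agree. *)
have D0 : slope_det (w i - z i) (w i.+1 - z i.+1) != 0.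
  case: (turn ni) => // -[ez ew]; exfalso; move/eqP: nss; apply.
  by rewrite /= ez ew ni (ltnW ni).
have k1 := sd_line r (ltnW ni) (or_intror erefl : i.+1 = i \/ i.+1 = i.+1).
have k2 := sd_line r ni (or_introl erefl : i.+1 = i.+1 \/ i.+1 = i.+2).
have v1 := zw (ltnW ni); have v2 := zw ni.
have g1 : if s t i.+1 then 0 <= sd i r else sd i r <= 0.
  case E : (s t i.+1); rewrite leNgt; apply/negP => h.
    by move: E; rewrite -s1 s_lt0// ltnW.
  by move: E; rewrite -s1 s_gt0// ltnW.
have g2 : if s t i.+2 then 0 <= sd i.+1 r else sd i.+1 r <= 0.
  case E : (s t i.+2); rewrite leNgt; apply/negP => h.
    by move: E; rewrite -s2 s_lt0.
  by move: E; rewrite -s2 s_gt0.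
have nr : ~ ((f r).1 = (p i.+1).1 /\ (f r).2 = (p i.+1).2).
  by move=> [a b]; apply: nfr; rewrite [LHS]surjective_pairing [RHS]surjective_pairing a b.
rewrite /dir; set D := slope_det _ _ in D0 *.
have DE : D = ((w i).1 - (z i).1) * ((w i.+1).2 - (z i.+1).2) -
              ((w i).2 - (z i).2) * ((w i.+1).1 - (z i.+1).1) by [].
clearbody D.
have -> : (w i - z i).1 = (w i).1 - (z i).1 by [].
have -> : (w i.+1 - z i.+1).1 = (w i.+1).1 - (z i.+1).1 by [].
move: g1 g2 k1 k2 nr DE v1 v2; rewrite -!(subr_gt0 (z _).1).
set a := (w i).1 - (z i).1; set a' := (w i.+1).1 - (z i.+1).1.
set b := (w i).2 - (z i).2; set b' := (w i.+1).2 - (z i.+1).2.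
have -> : ((p i.+1).1 <= (f r).1) = (0 <= (f r).1 - (p i.+1).1) by rewrite subr_ge0.
have -> : ((f r).1 = (p i.+1).1 /\ (f r).2 = (p i.+1).2) =
  ((f r).1 - (p i.+1).1 = 0 /\ (f r).2 - (p i.+1).2 = 0).
  by apply/propext; split => -[h1 h2]; split; lra.
set y1 := (f r).1 - (p i.+1).1; set y2 := (f r).2 - (p i.+1).2.
set S1 := sd i r; set S2 := sd i.+1 r.
move=> g1 g2 k1 k2 nr DE a0 a'0.
(* Cramer's rule for the first coordinate [y1] of the displacement from the vertex. As [a] and [a']
   are positive and the two sides differ, the right-hand side has a known sign. *)
have key : D * y1 = a' * S1 - a * S2 by rewrite k1 k2 DE; ring.
have ynz : y1 = 0 -> S1 = a * y2 /\ S2 = a' * y2.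
  by move=> y10; rewrite k1 k2 y10; split; ring.
have quo e : 0 < e -> (0 <= e / D) = (0 < D).
  move=> e0; have [Dp|Dn] := ltP 0 D; first by rewrite divr_ge0// ltW.
  apply/negP/negP; rewrite -ltNge pmulr_rlt0// invr_lt0 lt_neqAle D0; exact: Dn.
have y2z : y1 = 0 -> y2 = 0 -> False by move=> h1 h2; apply: nr.
have Dn : D <= 0 -> D < 0 by move=> ?; rewrite lt_neqAle D0.
move: g1 g2 nss; case: (s t i.+1); case: (s t i.+2) => //= g1 g2 _.
  have -> : a' * (-1) ^+ false - a * (-1) ^+ true = a' + a by rewrite expr0 expr1; ring.
  rewrite (quo _ (addr_gt0 a'0 a0)); have [Dp|/Dn Dn'] := ltP 0 D.
    have : 0 <= D * y1 by rewrite key; nra.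
    by rewrite pmulr_rge0.
  have h : 0 <= D * y1 by rewrite key; nra.
  rewrite nmulr_rge0// in h; apply/negbTE; rewrite -ltNge lt_neqAle h andbT.
  apply/eqP => y10; have [q1 q2] := ynz y10; apply: y2z => //.
  by apply/eqP; rewrite eq_le; apply/andP; split; nra.
have -> : a' * (-1) ^+ true - a * (-1) ^+ false = - (a' + a) by rewrite expr0 expr1; ring.
have -> : (0 <= - (a' + a) / D) = (D < 0).
  have -> : - (a' + a) / D = (a' + a) / (- D) by rewrite mulNr invrN mulrN.
  have aa := addr_gt0 a'0 a0.
  have [Dp|Dn'] := ltP D 0; first by rewrite divr_ge0// ?oppr_ge0 ltW.
  apply/negbTE; rewrite -ltNge pmulr_rlt0// invr_lt0 oppr_lt0.
  by rewrite lt_neqAle eq_sym D0.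
have h : D * y1 <= 0 by rewrite key; nra.
have [Dp|Dn'] := ltP D 0; first by rewrite nmulr_rle0 in h.
have Dp : 0 < D by rewrite lt_neqAle eq_sym D0.
rewrite pmulr_rle0// in h; apply/negbTE; rewrite -ltNge lt_neqAle h andbT.
apply/eqP => y10; have [q1 q2] := ynz y10; apply: y2z => //.
by apply/eqP; rewrite eq_le; apply/andP; split; nra.
Qed.

(** At time 0 all vertices are to the right of the path, at time 1 all are to its left, so the
    parity goes from [false] to [true]. Yet it is locally constant: [term_const] freezes the edge
    terms and [vertex] only lets vertex bits change where the adjacent terms cancel. *)
Lemma chain_blocks_path : False.
Proof.
have W : parity (A 0) (s 0) n.+1 = parity (A 1) (s 1) n.+1.
  apply: (@locally_constant01 (fun t => parity (A t) (s t) n.+1)) => t t01.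
  have [d d0 H] := common_delta (fun i => @term_const i t t01).
  have [d' d'0 H'] := common_delta (fun i => @vertex i t t01).
  exists (Num.min d d'); first by rewrite lt_min d0 d'0.
  move=> r r01; rewrite lt_min => /andP[/(H r r01){}H /(H' r r01){}H'].
  rewrite (eq_parity H); apply/eqP; rewrite -[_ == _]negbK negb_eqb; apply/negP.
  rewrite parity_diff//; last by move=> i ni; apply: H'; exact: ltnW.
  (* If the bit of the last vertex changes, [vertex] equates [s t n.+1] with [s t n.+2], which is
     [false] by its default value. *)
  by move=> /andP[h1 h2]; case: (H' n.+1 (ltnSn _)) => [e|];
    [move: h1; rewrite e addbb|rewrite h2 /= ltnn].
have A0 i : (i <= n.+1)%N -> A 0 i = false.
  move=> /left_end h; rewrite A_far; last by rewrite lt_eqF.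
  by rewrite leNgt h.
have A1 i : (i <= n.+1)%N -> A 1 i = true.
  move=> /right_end h; rewrite A_far; last by rewrite gt_eqF.
  by rewrite ltW.
have P0 m : (m <= n.+1)%N -> parity (A 0) (s 0) m = false.
  elim: m => [_|m IH mn]; first exact: A0.
  by rewrite /= IH ?(ltnW mn)// !A0// ltnW.
have P1 m : (m <= n.+1)%N -> parity (A 1) (s 1) m = true.
  elim: m => [_|m IH mn]; first exact: A1.
  by rewrite /= IH ?(ltnW mn)// !A1// ltnW.
by move: W; rewrite P0// P1.
Qed.

End PolygonalChain.
End Parity.

(** * The stick intensity under moves, swaps and on strips *)

Section ProductMeasure.
Local Open Scope ereal_scope.
Context d1 d2 (T1 : measurableType d1) (T2 : measurableType d2) (R : realType).
Variable m1 : {sigma_finite_measure set T1 -> \bar R}.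
Variable m2 : {sigma_finite_measure set T2 -> \bar R}.

(* A copy of the product measure: the library's own sigma-finiteness instance is
   shadowed by the one for products of subprobabilities. *)
Definition prod_measure : set (T1 * T2) -> \bar R := m1 \x m2.

HB.instance Definition _ := Measure.on prod_measure.

Let prod_measure_sigma_finite : sigma_finite setT prod_measure.
Proof.
have /sigma_finiteP[A [coverA incA finA]] := sigma_finiteT m1.
have /sigma_finiteP[B [coverB incB finB]] := sigma_finiteT m2.
exists (fun k => A k `*` B k); last first.
  move=> k; have [[mA Aoo] [mB Boo]] := (finA k, finB k).
  split; first exact: measurableX.
  rewrite /prod_measure product_measure1E//.
  by apply: lte_mul_pinfty => //; rewrite ge0_fin_numE.
apply/esym/seteqP; split=> // -[x y] _.
have [i _ Ax] : (\bigcup_n A n) x by rewrite -coverA.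
have [j _ By] : (\bigcup_n B n) y by rewrite -coverB.
exists (maxn i j) => //; split => /=.
  by have /subsetPset := incA _ _ (leq_maxl i j); exact.
by have /subsetPset := incB _ _ (leq_maxr i j); exact.
Qed.

HB.instance Definition _ := Measure_isSigmaFinite.Build _ _ _ prod_measure
  prod_measure_sigma_finite.

End ProductMeasure.

Section Pushforward.
Local Open Scope ereal_scope.
Context {R : realType}.
Local Notation leb := (@lebesgue_measure R).
Local Notation image_measure :=
  measure_function_pushforward__canonical__measure_function_Measure.

Lemma lebesgue_measure_affine (c a : R) (A : set (measurableTypeR R)) :
  (0 < c)%R -> measurable A ->
  leb ((fun x => c * x + a)%R @^-1` A) = (c^-1)%:E * leb A.
Proof.
move=> c0 mA.
have mf : measurable_fun [set: measurableTypeR R]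
    ((fun x => c * x + a)%R : measurableTypeR R -> measurableTypeR R).
  by apply: measurable_funD => //; exact: measurable_funM.
set F := (X in measurable_fun _ X) in mf.
have -> : leb A = mscale (NngNum (ltW c0)) (image_measure leb mf) A.
  apply: lebesgue_measure_unique => // _ [[x y] _ <-].
  change (leb `]x, y] = c%:E * leb (F @^-1` `]x, y])).
  have -> : F @^-1` `]x, y]%classic = `]((x - a) / c)%R, ((y - a) / c)%R]%classic.
    apply/seteqP; split => r /=; rewrite !in_itv/= ltr_pdivrMr// ler_pdivlMr//;
    by rewrite ltrBlDr lerBrDr mulrC.
  rewrite !lebesgue_measure_itv/= !lte_fin ltr_pM2r ?invr_gt0// ltrD2r.
  case: ifPn => _; last by rewrite mule0.
  by rewrite -!EFinD -EFinM; congr EFin; field; rewrite gt_eqF.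
by rewrite /mscale/= muleA -EFinM mulVf ?gt_eqF// mul1e.
Qed.

Lemma lebesgue_measure_reflect (a : R) (A : set (measurableTypeR R)) :
  measurable A -> leb ((fun x => a - x)%R @^-1` A) = leb A.
Proof.
move=> mA.
have mB : measurable ((fun x : measurableTypeR R => 1 * x + a)%R @^-1` A).
  rewrite -[X in measurable X]setTI; apply: (_ : measurable_fun setT _) => //.
  by apply: measurable_funD => //; exact: measurable_funM.
have := lebesgue_measure_affine a ltr01 mA.
rewrite invr1 mul1e => <-; rewrite -(lebesgue_measureN mB) /pushforward.
by congr (leb _); apply/funext => x /=; rewrite mul1r addrC.
Qed.

(** In the substitution the density contributes [c ^+ 3] and Lebesgue measure [c^-1]. This is why
    lengthening all sticks by [c] multiplies the intensity of the soup by [c ^+ 2]. *)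
Lemma radius_measure_scale (c : R) (A : set (measurableTypeR R)) :
  (0 < c)%R -> measurable A ->
  radius_measure ((fun r => c * r)%R @^-1` A) = (c ^+ 2)%:E * radius_measure A.
Proof.
move=> c0 mA; rewrite /radius_measure.
have mf : measurable_fun [set: measurableTypeR R]
    ((fun x => c * x)%R : measurableTypeR R -> measurableTypeR R).
  exact: measurable_funM.
set F := (X in measurable_fun _ X) in mf.
have mD : measurable (A `&` `]0%R, +oo[ : set (measurableTypeR R)).
  by apply: measurableI => //; exact: measurable_itv.
have mg k : measurable_fun (A `&` `]0%R, +oo[) (fun r : R => (k * r ^- 3)%:E).
  apply/measurable_EFinP; apply: measurable_funM => //.
  apply: (@measurable_comp _ _ _ _ _ _ [set x : R | x != 0%R]) => //.
  - by apply: open_measurable; exact: open_neq.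
  - move=> _ /= [r [_ +] <-]; rewrite /= in_itv/= andbT => r0.
    by rewrite expf_neq0// gt_eqF.
  - apply: open_continuous_measurable_fun; first exact: open_neq.
    by move=> x /set_mem /= x0; exact: inv_continuous.
have g0 k : (0 <= k)%R ->
    {in A `&` `]0%R, +oo[, forall r : R, 0 <= (k * r ^- 3)%:E}.
  move=> k0 r; rewrite in_setE => -[_]; rewrite /= in_itv/= andbT => r0.
  by rewrite lee_fin mulr_ge0// invr_ge0 exprn_ge0// ltW.
transitivity (\int[image_measure leb mf]_(r in A `&` `]0%R, +oo[)
    (2 * c ^+ 3 * r ^- 3)%:E).
  rewrite ge0_integral_pushforward//; last first.
    by apply: g0; rewrite mulr_ge0// exprn_ge0// ltW.
  have -> : F @^-1` (A `&` `]0%R, +oo[) =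
      (fun r => c * r)%R @^-1` A `&` `]0%R, +oo[.
    apply/seteqP; split => r /= []; rewrite !in_itv/= !andbT => Ar r0; split => //.
      by rewrite pmulr_rgt0// in r0.
    exact: mulr_gt0.
  apply: eq_integral => r; rewrite in_setE => -[_] /=; rewrite in_itv/= andbT => r0.
  by congr EFin; rewrite /F /=; field; rewrite !gt_eqF.
have cV0 : (0 < c^-1)%R by rewrite invr_gt0.
transitivity (\int[mscale (NngNum (ltW cV0)) leb]_(r in A `&` `]0%R, +oo[)
    (2 * c ^+ 3 * r ^- 3)%:E).
  apply: eq_measure_integral => B mB _.
  change (leb (F @^-1` B) = (c^-1)%:E * leb B).
  rewrite -(lebesgue_measure_affine 0 c0 mB).
  by congr (leb _); apply/funext => x /=; rewrite addr0.
rewrite ge0_integral_mscale//; last first.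
  by move=> r h; apply: g0; [rewrite mulr_ge0// exprn_ge0// ltW|rewrite in_setE].
transitivity ((c^-1)%:E * ((c ^+ 3)%:E * \int[leb]_(r in A `&` `]0%R, +oo[) (2 * r ^- 3)%:E)).
  congr (_ * _).
  rewrite -ge0_integralZl//.
  - by apply: eq_integral => r _; rewrite -EFinM; congr EFin; ring.
  - by move=> r h; apply: g0; rewrite ?in_setE.
  - by rewrite lee_fin exprn_ge0// ltW.
rewrite muleA -EFinM; congr (_%:E * _); field; by rewrite gt_eqF.
Qed.

Let scale_cancel (c1 c2 : R) (x y : \bar R) : (0 < c1)%R -> (0 < c2)%R ->
  ((c1 * c2)^-1)%:E * ((c1%:E * x) * (c2%:E * y)) = x * y.
Proof.
move=> c10 c20; rewrite (_ : x * y = 1%:E * (x * y)); last by rewrite mul1e.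
rewrite -[1%R](@mulVf _ (c1 * c2)); last by rewrite gt_eqF// mulr_gt0.
rewrite [in RHS]EFinM -[RHS]muleA; congr (_ * _).
by rewrite EFinM -!muleA; congr (_ * _); rewrite muleCA.
Qed.

Lemma product_measure_preimage d1 d2 (T1 : measurableType d1) (T2 : measurableType d2)
    (m1 : {sigma_finite_measure set T1 -> \bar R})
    (m2 : {sigma_finite_measure set T2 -> \bar R})
    (f1 : T1 -> T1) (f2 : T2 -> T2) (c1 c2 : R) :
  measurable_fun setT f1 -> measurable_fun setT f2 -> (0 < c1)%R -> (0 < c2)%R ->
  (forall A, measurable A -> m1 (f1 @^-1` A) = c1%:E * m1 A) ->
  (forall A, measurable A -> m2 (f2 @^-1` A) = c2%:E * m2 A) ->
  forall X, measurable X ->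
    (m1 \x m2) ((fun x => (f1 x.1, f2 x.2)) @^-1` X) = (c1 * c2)%:E * (m1 \x m2) X.
Proof.
move=> mf1 mf2 c10 c20 H1 H2 X mX.
have mf : measurable_fun setT (fun x : T1 * T2 => (f1 x.1, f2 x.2)).
  by apply: measurable_fun_pair; exact: measurableT_comp.
set F := (X in measurable_fun _ X) in mf.
have c0 : (0 < c1 * c2)%R by exact: mulr_gt0.
have cV0 : (0 < (c1 * c2)^-1)%R by rewrite invr_gt0.
have -> : (m1 \x m2) X = mscale (NngNum (ltW cV0))
    (image_measure (m1 \x m2) mf) X.
  apply: product_measure_unique => // A B mA mB.
  change (((c1 * c2)^-1)%:E * (m1 \x m2) ((f1 @^-1` A) `*` (f2 @^-1` B)) = m1 A * m2 B).
  have mA' : measurable (f1 @^-1` A) by rewrite -[X in measurable X]setTI; exact: mf1.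
  have mB' : measurable (f2 @^-1` B) by rewrite -[X in measurable X]setTI; exact: mf2.
  have -> : (m1 \x m2) ((f1 @^-1` A) `*` (f2 @^-1` B)) =
      m1 (f1 @^-1` A) * m2 (f2 @^-1` B) by exact: product_measure1E.
  by rewrite (H1 _ mA) (H2 _ mB); exact: scale_cancel.
change ((m1 \x m2) ((fun x => (f1 x.1, f2 x.2)) @^-1` X) = (c1 * c2)%:E *
  (((c1 * c2)^-1)%:E * (m1 \x m2) ((fun x => (f1 x.1, f2 x.2)) @^-1` X))).
by rewrite muleA -EFinM mulfV ?gt_eqF// mul1e.
Qed.

Lemma product_measure_swap d1 (T1 : measurableType d1)
    (m1 : {sigma_finite_measure set T1 -> \bar R}) X :
  measurable X -> (m1 \x m1) ((fun x => (x.2, x.1)) @^-1` X) = (m1 \x m1) X.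
Proof.
move=> mX.
have mf : measurable_fun setT (fun x : T1 * T1 => (x.2, x.1)) by exact: measurable_swap.
set F := (X in measurable_fun _ X) in mf.
have -> : (m1 \x m1) X = image_measure (m1 \x m1) mf X; last by [].
apply: product_measure_unique => //.
move=> A B mA mB.
change ((m1 \x m1) ((fun x => (x.2, x.1)) @^-1` (A `*` B)) = m1 A * m1 B).
have -> : (fun x => (x.2, x.1)) @^-1` (A `*` B) = B `*` A.
  by apply/seteqP; split => -[x y] [].
by rewrite product_measure1E// muleC.
Qed.
(** The two centre coordinates form one block, so that [g] may be a translation as well as the
    exchange of the axes. *)
Lemma product_measure4_preimage d1 d2 d3 d4 (T1 : measurableType d1)
    (T2 : measurableType d2) (T3 : measurableType d3) (T4 : measurableType d4)
    (m1 : {sigma_finite_measure set T1 -> \bar R})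
    (m2 : {sigma_finite_measure set T2 -> \bar R})
    (m3 : {sigma_finite_measure set T3 -> \bar R})
    (m4 : {sigma_finite_measure set T4 -> \bar R})
    (g : T1 * T2 -> T1 * T2) (f3 : T3 -> T3) (f4 : T4 -> T4) (c c3 c4 : R) :
  measurable_fun setT g -> measurable_fun setT f3 -> measurable_fun setT f4 ->
  (0 < c)%R -> (0 < c3)%R -> (0 < c4)%R ->
  (forall A, measurable A -> (m1 \x m2) (g @^-1` A) = c%:E * (m1 \x m2) A) ->
  (forall A, measurable A -> m3 (f3 @^-1` A) = c3%:E * m3 A) ->
  (forall A, measurable A -> m4 (f4 @^-1` A) = c4%:E * m4 A) ->
  forall X, measurable X ->
    (((m1 \x m2) \x m3) \x m4) ((fun x => ((g x.1.1, f3 x.1.2), f4 x.2)) @^-1` X) =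
    (c * c3 * c4)%:E * (((m1 \x m2) \x m3) \x m4) X.
Proof.
move=> mg mf3 mf4 c0 c30 c40 H H3 H4.
have mg3 : measurable_fun setT (fun x : (T1 * T2) * T3 => (g x.1, f3 x.2)).
  by apply: measurable_fun_pair; exact: measurableT_comp.
have H' := @product_measure_preimage _ _ _ _ (prod_measure m1 m2) m3 _ _ _ _ mg mf3 c0 c30 H H3.
exact: (@product_measure_preimage _ _ _ _ (prod_measure (prod_measure m1 m2) m3) m4
  _ _ _ _ mg3 mf4 (mulr_gt0 c0 c30) c40 H' H4).
Qed.

End Pushforward.

Section StickMaps.
Context {R : realType}.

Lemma counting_image (T : choiceType) (f : T -> T) (A : set T) :
  {in A &, injective f} -> counting (f @` A) = counting A :> \bar R.
Proof.
move=> fi; have fA := inj_card_eq fi.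
rewrite /counting (eq_finite_set fA).
case: asboolP => // /finite_setP[n An].
by rewrite (card_fset_set An) (card_fset_set (card_eq_trans fA An)).
Qed.

Lemma is_ips_image {d} {Omega : measurableType d} (u u' : R)
    (P : probability Omega R) (xi : Omega -> set (stick R))
    (phi : stick R -> stick R) :
  measurable_fun setT phi ->
  (forall A, measurable A ->
    u%:E * stick_intensity (phi @^-1` A) = u'%:E * stick_intensity A)%E ->
  {in stick_space R &, injective phi} ->
  (forall s, stick_space R s -> stick_space R (phi s)) ->
  is_ips u P xi -> is_ips u' P (fun w => phi @` xi w).
Proof.
move=> mphi nuE phi_inj phi_sub [xi_sub [mN law law_oo indep]].
have NE A : npoints (R := R) (fun w => phi @` xi w) A = npoints xi (phi @^-1` A).
  apply/funext => w; rewrite /npoints.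
  have -> : phi @` xi w `&` A = phi @` (xi w `&` phi @^-1` A).
    apply/seteqP; split => [_ [[s xs <-] As]|_ [s [xs As] <-]]; first by exists s.
    by split => //; exists s.
  apply: counting_image => s s' /[!in_setE] -[h _] [h' _].
  by apply: phi_inj; rewrite in_setE; exact: (xi_sub w).
have mpre A : measurable A -> measurable (phi @^-1` A).
  by move=> mA; rewrite -[X in measurable X]setTI; exact: mphi.
split; first by move=> w _ [s xs <-]; apply: phi_sub; exact: (xi_sub w).
split.
- by move=> A mA; rewrite NE; apply: mN; exact: mpre.
- by move=> A k mA; rewrite NE -nuE//; apply: law; exact: mpre.
- by move=> A mA; rewrite NE -nuE//; apply: law_oo; exact: mpre.
- move=> n A B mA mB tA.
  have := indep n (fun i => phi @^-1` A i) B (fun i => mpre _ (mA i)) mB.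
  have tA' : trivIset setT (fun i => phi @^-1` A i).
    apply/trivIsetP => i j _ _ ij; move/trivIsetP : tA => /(_ i j I I ij).
    by rewrite -preimage_setI => ->; rewrite preimage_set0.
  move=> /(_ tA').
  have -> : [set w | forall i, B i (npoints xi (phi @^-1` A i) w)] =
      [set w | forall i, B i (npoints (fun w => phi @` xi w) (A i) w)].
    by apply/seteqP; split => w /= h i; have := h i; rewrite NE.
  by move=> ->; apply: eq_bigr => i _; rewrite NE.
Qed.

Definition stick_move (a : R * R) (c : R) (s : stick R) : stick R :=
  ((s.1.1.1 + a.1, s.1.1.2 + a.2), c * s.1.2, s.2).

Lemma measurable_addr (a : R) :
  measurable_fun setT ((fun x => x + a) : measurableTypeR R -> measurableTypeR R).
Proof. exact: measurable_funD. Qed.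

Lemma measurable_scale (c : R) :
  measurable_fun setT ((fun x => c * x) : measurableTypeR R -> measurableTypeR R).
Proof. exact: measurable_funM. Qed.

Let move_centre (a : R * R) (z : measurableTypeR R * measurableTypeR R) :
  measurableTypeR R * measurableTypeR R := (z.1 + a.1, z.2 + a.2).

Lemma measurable_stick_move a c : measurable_fun setT (stick_move a c).
Proof.
apply: measurable_fun_pair; last exact: measurable_snd.
apply: measurable_fun_pair; last first.
  apply: (measurableT_comp (measurable_scale c)).
  exact: measurableT_comp.
apply: measurable_fun_pair.
  apply: (measurableT_comp (measurable_addr a.1)).
  by do 2 apply: measurableT_comp => //.
apply: (measurableT_comp (measurable_addr a.2)).
by do 2 apply: measurableT_comp => //.
Qed.

Lemma stick_intensity_move (a : R * R) (c : R) (A : set (stick R)) :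
  0 < c -> measurable A ->
  (stick_intensity (stick_move a c @^-1` A) = (c ^+ 2)%:E * stick_intensity A)%E.
Proof.
move=> c0 mA.
have lebD b (B : set (measurableTypeR R)) : measurable B ->
    (lebesgue_measure ((fun x => x + b)%R @^-1` B) = 1%:E * lebesgue_measure B)%E.
  move=> mB; have := lebesgue_measure_affine b ltr01 mB; rewrite invr1 => <-.
  by congr (lebesgue_measure _); apply/funext => x /=; rewrite mul1r.
have mmc : measurable_fun setT (move_centre a).
  apply: measurable_fun_pair.
    by apply: (measurableT_comp (measurable_addr a.1)); exact: measurable_fst.
  by apply: (measurableT_comp (measurable_addr a.2)); exact: measurable_snd.
have h1 := product_measure_preimage (measurable_addr a.1) (measurable_addr a.2)
  ltr01 ltr01 (lebD a.1) (lebD a.2).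
have mid : measurable_fun setT (id : measurableTypeR R -> measurableTypeR R) by [].
have idE B : measurable B -> angle_measure (id @^-1` B) = (1%:E * angle_measure (R := R) B)%E.
  by rewrite mul1e.
have := product_measure4_preimage mmc (measurable_scale c) mid (mulr_gt0 ltr01 ltr01)
  (exprn_gt0 2 c0) ltr01 h1 (fun B => @radius_measure_scale R c B c0) idE mA.
by rewrite !mul1r mulr1.
Qed.

Lemma stick_space_move a c s : 0 < c -> stick_space R s -> stick_space R (stick_move a c s).
Proof. by move=> c0 [r0 v]; split => //; exact: mulr_gt0. Qed.

Lemma stick_move_inj a c : 0 < c -> injective (stick_move a c).
Proof.
move=> c0 [[[x y] r] v] [[[x' y'] r'] v'] [] /addIr-> /addIr-> /mulfI e ->.
by rewrite e// gt_eqF.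
Qed.

Lemma is_ips_move {d} {Omega : measurableType d} (u c : R)
    (P : probability Omega R) (xi : Omega -> set (stick R)) (a : R * R) :
  0 < c -> is_ips u P xi -> is_ips (c ^+ 2 * u) P (fun w => stick_move a c @` xi w).
Proof.
move=> c0; apply: is_ips_image.
- exact: measurable_stick_move.
- by move=> A mA; rewrite stick_intensity_move// muleA -EFinM [u * _]mulrC.
- by move=> s s' _ _; exact: stick_move_inj.
- by move=> s; exact: stick_space_move.
Qed.

(** The reflection in the diagonal sends direction [v] to [pi / 2 - v]; directions count modulo
    [pi], and the second branch brings the result back into the half-open range. *)
Definition swap_angle (v : R) : R := if 0 <= v then pi / 2 - v else - (pi / 2) - v.

Definition stick_swap (s : stick R) : stick R := ((s.1.1.2, s.1.1.1), s.1.2, swap_angle s.2).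

Lemma measurable_swap_angle :
  measurable_fun setT (swap_angle : measurableTypeR R -> measurableTypeR R).
Proof.
apply: measurable_fun_ifT => /=.
- by apply: measurable_fun_ler.
- by apply: measurable_funB.
- by apply: measurable_funB.
Qed.

Lemma measurable_stick_swap : measurable_fun setT stick_swap.
Proof.
apply: measurable_fun_pair; last first.
  by apply: (measurableT_comp measurable_swap_angle); exact: measurable_snd.
apply: measurable_fun_pair; last exact: measurableT_comp.
apply: (measurableT_comp (@measurable_swap _ _ _ _)).
exact: measurableT_comp.
Qed.

Let pi2 := @pi_gt0 R.

(** The negative and the nonnegative half of the angle range are each reflected onto themselves. *)
Lemma angle_measure_swap (A : set (measurableTypeR R)) : measurable A ->
  (angle_measure (swap_angle @^-1` A) = 1%:E * angle_measure A)%E.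
Proof.
move=> mA; rewrite mul1e /angle_measure /mscale/=; congr (_ * _)%E.
rewrite /mfrestr /mrestr.
pose N : set (measurableTypeR R) := `](- (pi / 2))%R, 0%R[%classic.
pose Q : set (measurableTypeR R) := `[0%R, (pi / 2)%R]%classic.
have mN : measurable N by exact: measurable_itv.
have mQ : measurable Q by exact: measurable_itv.
have split_range (B : set (measurableTypeR R)) : measurable B ->
    lebesgue_measure (B `&` angle_range) =
    (lebesgue_measure (B `&` N) + lebesgue_measure (B `&` Q))%E.
  move=> mB; have -> : angle_range = N `|` Q.
    apply/seteqP; split => v; rewrite /N /Q /angle_range /= !in_itv/=.
      by move=> /andP[a b]; have [v0|v0] := ltP v 0; [left; rewrite a|right].
    by case=> /andP[a b]; apply/andP; split; have := pi2; lra.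
  rewrite setIUr measureU//; [exact: measurableI|exact: measurableI|].
  by apply/seteqP; split => v //; rewrite /N /Q /= !in_itv/=; move=> [[_ ?] [_ ?]]; lra.
have mpre : measurable (swap_angle @^-1` A).
  by rewrite -[X in measurable X]setTI; exact: measurable_swap_angle.
rewrite !split_range//; congr (_ + _)%E.
- rewrite -[RHS](@lebesgue_measure_reflect R (- (pi / 2)%R)); last exact: measurableI.
  congr lebesgue_measure; apply/seteqP; split => v; rewrite /N /= !in_itv/= /swap_angle.
    by move=> [+ /andP[a b]]; rewrite leNgt b /= => Av; split => //; apply/andP; split; lra.
  move=> [Av /andP[a b]]; have v0 : v < 0 by lra.
  by rewrite leNgt v0 /=; split; [exact: Av|lra].
- rewrite -[RHS](@lebesgue_measure_reflect R (pi / 2)%R); last exact: measurableI.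
  congr lebesgue_measure; apply/seteqP; split => v; rewrite /Q /= !in_itv/= /swap_angle.
    by move=> [+ /andP[a b]]; rewrite a => Av; split => //; apply/andP; split; lra.
  move=> [Av /andP[a b]]; have v0 : 0 <= v by lra.
  by rewrite v0; split; [exact: Av|lra].
Qed.

Lemma stick_intensity_swap (A : set (stick R)) : measurable A ->
  stick_intensity (stick_swap @^-1` A) = stick_intensity A.
Proof.
move=> mA.
have mid : measurable_fun setT (id : measurableTypeR R -> measurableTypeR R) by [].
have idE B : measurable B -> radius_measure (id @^-1` B) = (1%:E * radius_measure (R := R) B)%E.
  by rewrite mul1e.
have h1 (B : set (measurableTypeR R * measurableTypeR R)) : measurable B ->
    ((lebesgue_measure \x lebesgue_measure) ((fun x => (x.2, x.1)) @^-1` B) =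
     1%:E * (lebesgue_measure \x lebesgue_measure) B)%E.
  by move=> mB; rewrite mul1e; exact: product_measure_swap.
have := product_measure4_preimage (@measurable_swap _ _ _ _) mid measurable_swap_angle
  ltr01 ltr01 ltr01 h1 idE angle_measure_swap mA.
by rewrite !mul1r mul1e.
Qed.

Lemma swap_angleK v : angle_range v -> swap_angle (swap_angle v) = v.
Proof.
rewrite /angle_range /= in_itv/= /swap_angle => /andP[a b].
have [v0|v0] := leP 0 v.
  have -> : 0 <= pi / 2 - v by lra.
  lra.
have -> : (0 <= - (pi / 2) - v) = false by apply/negbTE; rewrite -ltNge; lra.
lra.
Qed.

Lemma stick_space_swap s : stick_space R s -> stick_space R (stick_swap s).
Proof.
move=> [r0 v]; split => //; move: v; rewrite /angle_range /= !in_itv/= /angle /swap_angle.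
move=> /= /andP[a b]; have p0 := pi2.
by have [v0|v0] := leP 0 s.2; apply/andP; split; rewrite /angle in a b; lra.
Qed.

Lemma is_ips_swap {d} {Omega : measurableType d} (u : R)
    (P : probability Omega R) (xi : Omega -> set (stick R)) :
  is_ips u P xi -> is_ips u P (fun w => stick_swap @` xi w).
Proof.
apply: is_ips_image.
- exact: measurable_stick_swap.
- by move=> A mA; rewrite stick_intensity_swap.
- move=> [[[x y] r] v] [[[x' y'] r'] v']; rewrite !in_setE => -[_ v1] [_ v2] [] -> -> -> h.
  by congr pair; rewrite -[v](swap_angleK v1) -[v'](swap_angleK v2) h.
- exact: stick_space_swap.
Qed.

End StickMaps.

Section StickIntensity.
Context {R : realType}.
Local Notation leb := (@lebesgue_measure R).

Lemma stick_intensityX (A B C D : set (measurableTypeR R)) :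
  measurable A -> measurable B -> measurable C -> measurable D ->
  (stick_intensity (A `*` B `*` C `*` D) =
   leb A * leb B * radius_measure C * angle_measure D)%E.
Proof.
move=> mA mB mC mD; rewrite /stick_intensity.
rewrite product_measure1E//=; last by do 2 apply: measurableX => //.
by rewrite product_measure1E//=; [rewrite product_measure1E|exact: measurableX].
Qed.

Lemma radius_measure_itv (a b : R) : 0 < a -> a <= b ->
  (radius_measure `[a, b]%classic <= (2 * a ^- 3 * (b - a))%:E)%E.
Proof.
move=> a0 ab; rewrite /radius_measure.
have -> : `[a, b]%classic `&` `]0%R, +oo[%classic = `[a, b]%classic.
  rewrite setIidl// => r /=; rewrite !in_itv/= => /andP[ar _].
  by rewrite andbT; exact: lt_le_trans ar.
apply: (@le_trans _ _ (\int[leb]_(r in `[a, b]) (2 * a ^- 3)%:E)%E).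
  apply: ge0_le_integral => //.
  - move=> r /=; rewrite in_itv/= => /andP[ar _].
    by have r0 := le_trans (ltW a0) ar; rewrite lee_fin mulr_ge0// invr_ge0 exprn_ge0.
  - apply/measurable_EFinP; apply: measurable_funM => //.
    apply: (@measurable_comp _ _ _ _ _ _ [set x : R | x != 0]) => //.
    + by apply: open_measurable; exact: open_neq.
    + move=> _ /= [r + <-]; rewrite /= in_itv/= => /andP[ar _].
      by rewrite expf_neq0// gt_eqF// (lt_le_trans a0).
    + apply: open_continuous_measurable_fun; first exact: open_neq.
      by move=> x /set_mem /= x0; exact: inv_continuous.
  - move=> r /=; rewrite in_itv/= => /andP[ar _]; rewrite lee_fin ler_pM2l//.
    have r0 := lt_le_trans a0 ar.
    rewrite lef_pV2 ?posrE ?exprn_gt0//.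
    by apply: lerXn2r => //; rewrite nnegrE ltW.
rewrite integral_cst//= lebesgue_measure_itv/= lte_fin.
case: ifPn => [_|]; first by rewrite -EFinB -EFinM.
by rewrite mule0 lee_fin !mulr_ge0// ?invr_ge0 ?exprn_ge0 ?subr_ge0// ltW.
Qed.

Lemma angle_measure_le (D : set (measurableTypeR R)) : measurable D ->
  (angle_measure D <= (pi^-1)%:E * leb D)%E.
Proof.
move=> mD; rewrite /angle_measure /mscale/=.
apply: lee_wpmul2l; first by rewrite lee_fin invr_ge0 pi_ge0.
rewrite /mfrestr /mrestr; apply: le_measure; rewrite ?in_setE//.
by apply: measurableI => //; exact: measurable_itv.
Qed.

Lemma angle_measureT : (angle_measure [set: measurableTypeR R] <= 1)%E.
Proof.
rewrite /angle_measure /mscale/= /mfrestr /mrestr setTI /angle_range.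
rewrite lebesgue_measure_itv/= lte_fin; case: ifPn => _; last by rewrite mule0 lee_fin.
rewrite -EFinB -EFinM lee_fin.
have p0 := @pi_gt0 R.
by rewrite -(ler_pM2l p0) mulrA mulfV ?gt_eqF//; lra.
Qed.

(** The second condition says that the line of the stick passes within [2 * rho] of the origin. The
    lower bound on the cosine keeps the slices at fixed abscissa and angle short; steeper sticks are
    handled through [stick_swap]. *)
Definition strip (rho a : R) : set (stick R) :=
  [set s | [/\ `|s.1.1.1| <= 4 * a,
    `|cos s.2 * s.1.1.2 - sin s.2 * s.1.1.1| <= 2 * rho,
    1 / 2 <= `|cos s.2| & a <= s.1.2 <= 2 * a]].

Lemma measurable_centre1 : measurable_fun setT (fun s : stick R => s.1.1.1 : measurableTypeR R).
Proof. by do 2 apply: measurableT_comp => //. Qed.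

Lemma measurable_centre2 : measurable_fun setT (fun s : stick R => s.1.1.2 : measurableTypeR R).
Proof. by do 2 apply: measurableT_comp => //. Qed.

Lemma measurable_radius : measurable_fun setT (fun s : stick R => s.1.2 : measurableTypeR R).
Proof. exact: measurableT_comp. Qed.

Lemma measurable_angle : measurable_fun setT (fun s : stick R => s.2 : measurableTypeR R).
Proof. exact: measurable_snd. Qed.

Lemma measurable_cos_angle : measurable_fun setT (fun s : stick R => cos s.2 : measurableTypeR R).
Proof.
apply: (measurableT_comp _ measurable_angle).
by apply: continuous_measurable_fun; exact: continuous_cos.
Qed.

Lemma measurable_sin_angle : measurable_fun setT (fun s : stick R => sin s.2 : measurableTypeR R).
Proof.
apply: (measurableT_comp _ measurable_angle).
by apply: continuous_measurable_fun; exact: continuous_sin.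
Qed.

Lemma measurable_strip rho a : measurable (strip rho a).
Proof.
have -> : strip rho a = [set s | `|s.1.1.1| <= 4 * a] `&`
    [set s | `|cos s.2 * s.1.1.2 - sin s.2 * s.1.1.1| <= 2 * rho] `&`
    [set s | 1 / 2 <= `|cos s.2|] `&` [set s | a <= s.1.2] `&` [set s | s.1.2 <= 2 * a].
  apply/seteqP; split => s; first by move=> [? ? ? /andP[? ?]].
  by move=> [[[[? ?] ?] ?] ?]; split => //; apply/andP.
have mle (f : stick R -> measurableTypeR R) c : measurable_fun setT f ->
    measurable [set s | f s <= c].
  move=> mf; have -> : [set s | f s <= c] = setT `&` f @^-1` `]-oo, c]%classic.
    by rewrite setTI; apply/seteqP; split => s /=; rewrite in_itv.
  by apply: mf => //; exact: measurable_itv.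
have mge (f : stick R -> measurableTypeR R) c : measurable_fun setT f ->
    measurable [set s | c <= f s].
  move=> mf; have -> : [set s | c <= f s] = setT `&` f @^-1` `[c, +oo[%classic.
    by rewrite setTI; apply/seteqP; split => s /=; rewrite in_itv/= andbT.
  by apply: mf => //; exact: measurable_itv.
have mnorm (f : stick R -> measurableTypeR R) : measurable_fun setT f ->
    measurable_fun setT (fun s => `|f s| : measurableTypeR R).
  by move=> mf; exact: measurableT_comp.
apply: measurableI; last by apply: mle; exact: measurable_radius.
apply: measurableI; last by apply: mge; exact: measurable_radius.
apply: measurableI; last by apply: mge; apply: mnorm; exact: measurable_cos_angle.
apply: measurableI; first by apply: mle; apply: mnorm; exact: measurable_centre1.
apply: mle; apply: mnorm; apply: measurable_funB; apply: measurable_funM.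
- exact: measurable_cos_angle.
- exact: measurable_centre2.
- exact: measurable_sin_angle.
- exact: measurable_centre1.
Qed.

End StickIntensity.

Section Slices.
Local Open Scope ereal_scope.
Context d1 d2 (T1 : measurableType d1) (T2 : measurableType d2) (R : realType).
Variable m1 : {sigma_finite_measure set T1 -> \bar R}.
Variable m2 : {sigma_finite_measure set T2 -> \bar R}.

Lemma product_measure_xslice (A : set (T1 * T2)) (B : set T1) (c : R) :
  (0 <= c)%R -> measurable A -> measurable B ->
  (forall x y, A (x, y) -> B x) ->
  (forall x, m2 (xsection A x) <= c%:E) ->
  (m1 \x m2) A <= c%:E * m1 B.
Proof.
move=> c0 mA mB AB Ac; rewrite /product_measure1.
apply: (@le_trans _ _ (\int[m1]_x (c%:E * (\1_B x)%:E))).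
  apply: ge0_le_integral => //.
  - exact: measurable_fun_xsection.
  - by apply: measurable_funeM; apply/measurable_EFinP; exact: measurable_indic.
  - move=> x _ /=; rewrite indicE.
    have [Bx|nBx] := boolP (x \in B); first by rewrite mule1.
    rewrite mule0 (_ : xsection A x = set0) ?measure0//.
    apply/seteqP; split => // y /xsectionP /AB Bx.
    by move: nBx; rewrite notin_setE.
rewrite ge0_integralZl//; last first.
  by apply/measurable_EFinP; exact: measurable_indic.
by rewrite integral_indic// setIT.
Qed.

Lemma product_measure_yslice (A : set (T1 * T2)) (B : set T2) (c : R) :
  (0 <= c)%R -> measurable A -> measurable B ->
  (forall x y, A (x, y) -> B y) ->
  (forall y, m1 (ysection A y) <= c%:E) ->
  (m1 \x m2) A <= c%:E * m2 B.
Proof.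
move=> c0 mA mB AB Ac.
have -> : (m1 \x m2) A = (m1 \x^ m2) A.
  by apply: product_measure_unique => // C D mC mD; exact: product_measure2E.
rewrite /product_measure2.
apply: (@le_trans _ _ (\int[m2]_x (c%:E * (\1_B x)%:E))).
  apply: ge0_le_integral => //.
  - exact: measurable_fun_ysection.
  - by apply: measurable_funeM; apply/measurable_EFinP; exact: measurable_indic.
  - move=> y _ /=; rewrite indicE.
    have [By|nBy] := boolP (y \in B); first by rewrite mule1.
    rewrite mule0 (_ : ysection A y = set0) ?measure0//.
    apply/seteqP; split => // x /ysectionP /AB By.
    by move: nBy; rewrite notin_setE.
rewrite ge0_integralZl//; last first.
  by apply/measurable_EFinP; exact: measurable_indic.
by rewrite integral_indic// setIT.
Qed.

End Slices.

Section StripIntensity.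
Context {R : realType}.

(** The factors are [8 * rho] for the second coordinate of the centre, [8 * a] for the first, at
    most [2 / a ^+ 2] for the half-length, and at most 1 for the angle. *)
Lemma strip_intensity (rho a : R) : 0 < rho -> 0 < a ->
  (stick_intensity (strip rho a) <= (128 * rho / a)%:E)%E.
Proof.
move=> rho0 a0.
pose leb : {sigma_finite_measure set (measurableTypeR R) -> \bar R} := @lebesgue_measure R.
pose rad : {sigma_finite_measure set (measurableTypeR R) -> \bar R} := @radius_measure R.
pose ang : {sigma_finite_measure set (measurableTypeR R) -> \bar R} := @angle_measure R.
have c0 : 0 <= 128 * rho / a by rewrite divr_ge0 ?mulr_ge0 ?ltW.
have lebE (x y : R) : x <= y -> leb `[x, y]%classic = (y - x)%:E.
  move=> xy; have := @lebesgue_measure_itv R `[x, y]; rewrite /= lte_fin.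
  by case: ltgtP xy => [_ _ //|//|-> _]; rewrite subrr.
have c1 : 0 <= 64 * rho * a by rewrite !mulr_ge0 ?ltW.
have c2 : 0 <= 8 * rho by rewrite mulr_ge0 ?ltW.
apply: (@le_trans _ _ ((128 * rho / a)%:E * ang setT)%E); last first.
  rewrite -[leRHS]mule1; apply: lee_wpmul2l; first by rewrite lee_fin.
  exact: angle_measureT.
apply: (@product_measure_yslice _ _ _ _ _ (prod_measure (prod_measure leb leb) rad) ang) => //.
  exact: measurable_strip.
move=> v.
have mS : measurable (ysection (strip rho a) v).
  by apply: measurable_ysection; exact: measurable_strip.
have [cv|cv] := leP (1 / 2) `|cos v|; last first.
  have -> : ysection (strip rho a) v = set0.
    by apply/seteqP; split => // -[z r] /ysectionP [_ _ /=]; rewrite leNgt cv.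
  by rewrite measure0 lee_fin.
apply: (@le_trans _ _ ((64 * rho * a)%:E * rad `[a, (2 * a)%R]%classic)%E); last first.
  apply: (@le_trans _ _ ((64 * rho * a)%:E * (2 * a ^- 3 * (2 * a - a))%R%:E)%E).
    apply: lee_wpmul2l; first by rewrite lee_fin.
    by apply: radius_measure_itv => //; lra.
  rewrite -EFinM lee_fin le_eqVlt; apply/orP; left; apply/eqP; field; exact: lt0r_neq0.
apply: (@product_measure_yslice _ _ _ _ _ (prod_measure leb leb) rad) => //.
  by move=> z r /ysectionP [_ _ _ /=]; rewrite in_itv.
move=> r.
have mT : measurable (ysection (ysection (strip rho a) v) r) by exact: measurable_ysection.
apply: (@le_trans _ _ ((8 * rho)%:E * leb `[(- (4 * a))%R, (4 * a)%R]%classic)%E); last first.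
  by rewrite lebE ?lee_fin//; lra.
apply: (@product_measure_xslice _ _ _ _ _ leb leb) => //.
  by move=> x y /ysectionP/ysectionP [/= + _ _ _]; rewrite in_itv/= ler_norml.
move=> x.
(* The line of direction [v] through the origin has height [y0] at abscissa [x]; dividing by a
   cosine of size at least 1/2 at most doubles the tolerance [2 * rho]. *)
set y0 : R := sin v / cos v * x.
have cv0 : cos v != 0 by rewrite -normr_gt0; lra.
apply: (@le_trans _ _ (leb `[(y0 - 4 * rho)%R, (y0 + 4 * rho)%R]%classic)).
  apply: le_measure; rewrite ?in_setE//; first exact: measurable_xsection.
  move=> y /xsectionP/ysectionP/ysectionP [/= _ h _ _]; rewrite in_itv/=.
  have : `|y - y0| <= 4 * rho.
    have e : cos v * y - sin v * x = cos v * (y - y0) by rewrite /y0; field.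
    move: h; rewrite e normrM => h.
    have := ler_wpM2r (normr_ge0 (y - y0)) cv.
    by move=> /le_trans/(_ h); lra.
  by rewrite ler_norml => /andP[h1 h2]; apply/andP; split; lra.
by rewrite lebE ?lee_fin; lra.
Qed.

End StripIntensity.

Section LongSticks.
Context {R : realType}.
Implicit Types (s : stick R) (x y : R * R).

Definition in_box (r : R) x := `|x.1| <= r /\ `|x.2| <= r.
Definition out_box (r : R) x := r <= `|x.1| \/ r <= `|x.2|.

Lemma stick_segmentP s x : stick_segment s x <-> exists2 a, -1 <= a <= 1 &
  x = (s.1.1.1 + a * s.1.2 * cos s.2, s.1.1.2 + a * s.1.2 * sin s.2).
Proof.
rewrite /stick_segment /segment /stick_left /stick_right /half_stick /centre /Defs.radius /angle.
case: s => [[[z1 z2] r] v] /=; split.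
  move=> [t + <-]; rewrite /= in_itv/= => t01; exists (2 * t - 1); first lra.
  by congr pair; rewrite /= !scaleRE; ring.
move=> [a a11 ->]; exists ((a + 1) / 2); first by rewrite /= in_itv/=; lra.
by congr pair; rewrite /= !scaleRE; field.
Qed.

Lemma cos_sin_swap (v : R) : exists b : bool,
  cos (swap_angle v) = (-1) ^+ b * sin v /\ sin (swap_angle v) = (-1) ^+ b * cos v.
Proof.
rewrite /swap_angle; case: ifPn => _.
  exists false; rewrite expr0 !mul1r; split.
    by rewrite cosB cos_pihalf sin_pihalf mul0r mul1r add0r.
  by rewrite sinB cos_pihalf sin_pihalf mul0r mul1r subr0.
exists true; rewrite expr1 !mulN1r; split.
  by rewrite cosB cosN sinN cos_pihalf sin_pihalf mul0r mulN1r add0r.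
by rewrite sinB cosN sinN cos_pihalf sin_pihalf mul0r mulN1r subr0.
Qed.

Lemma dyadic_scale (a r : R) : 0 < a -> a <= r ->
  exists j : nat, 2 ^+ j * a <= r <= 2 * (2 ^+ j * a).
Proof.
move=> a0 ar.
have ex : exists n, r < 2 ^+ n * a.
  exists (Num.truncn (r / a)).+1; rewrite -ltr_pdivrMr//.
  apply: (lt_trans (truncnS_gt _)); rewrite -natrX ltr_nat; exact: ltn_expl.
case: (ex_minnP ex) => -[|n] h1 h2; first by move: h1; rewrite expr0 mul1r ltNge ar.
exists n; rewrite mulrA -exprS (ltW h1) andbT leNgt; apply/negP => /h2.
by rewrite ltnn.
Qed.

(** Going from the box to distance [L] takes a length of at least [L - rho], so the half-length is
    at least [L / 3] and falls in a dyadic range. The distance from the origin to the line of the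
    stick can be estimated at the point [x] of the box, and the cosine or the sine is at least 1/2
    in size. *)
Lemma long_stick_strip (rho L : R) s x y : 0 < rho -> 3 * rho <= L -> 0 < s.1.2 ->
  stick_segment s x -> in_box rho x -> stick_segment s y -> out_box L y ->
  exists j, let a := 2 ^+ j * (L / 3) in strip rho a s \/ strip rho a (stick_swap s).
Proof.
case: s => [[[z1' z2] r] v] /= rho0 L0 r0.
move=> /stick_segmentP[/= a a1 ->] [/= x1 x2] /stick_segmentP[/= b b1 ->] /= oy.
have c1 : `|cos v| <= 1 by rewrite ler_norml cos_geN1 cos_le1.
have s1 : `|sin v| <= 1 by rewrite ler_norml sin_geN1 sin_le1.
have ab : `|(b - a) * r| <= 2 * r.
  rewrite normrM (gtr0_norm r0) ler_pM2r// ler_norml; lra.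
have ar : `|a * r| <= r.
  rewrite normrM (gtr0_norm r0); apply: ler_piMl; [exact: ltW|rewrite ler_norml; lra].
have Lr : L / 3 <= r.
  have aux (c z : R) : `|c| <= 1 -> `|z + a * r * c| <= rho ->
      L <= `|z + b * r * c| -> L / 3 <= r.
    move=> hc h1 h2.
    have e : z + b * r * c = (z + a * r * c) + (b - a) * r * c by ring.
    have h3 := ler_normD (z + a * r * c) ((b - a) * r * c).
    have : `|(b - a) * r * c| <= 2 * r.
      by rewrite normrM; apply: le_trans ab; apply: ler_piMr.
    by rewrite -e in h3; lra.
  by case: oy; [exact: aux c1 x1|exact: aux s1 x2].
have L30 : 0 < L / 3 by lra.
have [j /andP[j1 j2]] := dyadic_scale L30 Lr.
exists j; set a' := 2 ^+ j * (L / 3) in j1 j2 *.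
have z_le (c z : R) : `|c| <= 1 -> `|z + a * r * c| <= rho -> `|z| <= 4 * a'.
  move=> hc h1; have := ler_normB (z + a * r * c) (a * r * c).
  rewrite addrK; have : `|a * r * c| <= r.
    by rewrite normrM; apply: le_trans ar; apply: ler_piMr.
  by lra.
have z1 := z_le _ _ c1 x1; have z2' := z_le _ _ s1 x2.
have det : `|cos v * z2 - sin v * z1'| <= 2 * rho.
  have -> : cos v * z2 - sin v * z1' =
      cos v * (z2 + a * r * sin v) - sin v * (z1' + a * r * cos v) by ring.
  apply: (le_trans (ler_normB _ _)); rewrite !normrM.
  have := ler_piMl (normr_ge0 (z2 + a * r * sin v)) c1.
  by have := ler_piMl (normr_ge0 (z1' + a * r * cos v)) s1; lra.
have [hc|hc] := leP (1 / 2) `|cos v|; first by left; split => //=; rewrite j1 j2.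
have hs : 1 / 2 <= `|sin v|.
  rewrite leNgt; apply/negP => hs; have := cos2Dsin2 v.
  rewrite -[cos v ^+ 2]real_normK ?num_real// -[sin v ^+ 2]real_normK ?num_real//.
  have sq (c : R) : 0 <= c -> c < 1 / 2 -> c ^+ 2 < 1 / 2 by move=> ? ?; rewrite expr2; nra.
  by have := sq _ (normr_ge0 (cos v)) hc; have := sq _ (normr_ge0 (sin v)) hs; lra.
right; have [e [ce se]] := cos_sin_swap v; split => //=.
- rewrite ce se -!mulrA -mulrBr normrM normrX normrN1 expr1n mul1r.
  by rewrite distrC.
- by rewrite ce normrM normrX normrN1 expr1n [_ * `|sin v|]mul1r.
- by rewrite j1 j2.
Qed.

Definition long_strips (rho L : R) : set (stick R) :=
  \bigcup_j (strip rho (2 ^+ j * (L / 3)) `|` stick_swap @^-1` strip rho (2 ^+ j * (L / 3))).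

Let measurable_pieces rho a : measurable (strip rho a `|` stick_swap @^-1` strip rho a : set (stick R)).
Proof.
apply: measurableU; first exact: measurable_strip.
by rewrite -[X in measurable X]setTI; apply: measurable_stick_swap => //; exact: measurable_strip.
Qed.

(** The function [stick_intensity] equipped with its structure of measure, for positivity and
    subadditivity. *)
Definition stick_measure : {measure set (stick R) -> \bar R} :=
  prod_measure (prod_measure (prod_measure (@lebesgue_measure R) (@lebesgue_measure R))
    (@radius_measure R)) (@angle_measure R).

Lemma measurable_long_strips rho L : measurable (long_strips rho L).
Proof. by apply: bigcup_measurable => j _; exact: measurable_pieces. Qed.

(** For [a = 2 ^+ j * (L / 3)] a strip and its swap contribute twice [128 * rho / a], that is
    [768 * rho / L] divided by [2 ^+ j]; the sum over [j] doubles 768. *)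
Lemma long_strips_intensity rho L : 0 < rho -> 0 < L ->
  (stick_intensity (long_strips rho L) <= (1536 * rho / L)%:E)%E.
Proof.
move=> rho0 L0.
have mS j : measurable (strip rho (2 ^+ j * (L / 3))) by exact: measurable_strip.
have piece j : (stick_measure (strip rho (2 ^+ j * (L / 3)) `|`
    stick_swap @^-1` strip rho (2 ^+ j * (L / 3))) <=
    (768 * rho / L * (2 ^+ j)^-1)%:E)%E.
  have a0 : 0 < 2 ^+ j * (L / 3) by rewrite mulr_gt0 ?exprn_gt0// divr_gt0.
  have h : (stick_measure (strip rho (2 ^+ j * (L / 3))) <=
      (128 * rho / (2 ^+ j * (L / 3)))%:E)%E by exact: strip_intensity.
  have m2 : measurable (stick_swap @^-1` strip rho (2 ^+ j * (L / 3)) : set (stick R)).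
    by rewrite -[X in measurable X]setTI; exact: measurable_stick_swap.
  apply: (le_trans (measureU2 stick_measure (mS j) m2)).
  have h' : (stick_measure (stick_swap @^-1` strip rho (2 ^+ j * (L / 3))) <=
      (128 * rho / (2 ^+ j * (L / 3)))%:E)%E.
    have e : stick_measure (stick_swap @^-1` strip rho (2 ^+ j * (L / 3))) =
        stick_measure (strip rho (2 ^+ j * (L / 3))) by exact: stick_intensity_swap.
    by rewrite e.
  apply: (le_trans (leeD h h')).
  rewrite -EFinD lee_fin le_eqVlt; apply/orP; left; apply/eqP; field.
  by rewrite !gt_eqF// exprn_gt0.
apply: (@le_trans _ _ (\sum_(0 <= j <oo) stick_measure (strip rho (2 ^+ j * (L / 3)) `|`
    stick_swap @^-1` strip rho (2 ^+ j * (L / 3))))%E).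
  exact: (measure_sigma_subadditive stick_measure
    (fun j => measurable_pieces rho _) (measurable_long_strips rho L) (@subset_refl _ _)).
apply: lime_le; first by apply: is_cvg_nneseries => j _ _; exact: measure_ge0.
have geo n : \sum_(0 <= j < n) ((2 : R) ^+ j)^-1 = 2 - 2 * (2 ^+ n)^-1.
  elim: n => [|n IH]; first by rewrite big_geq// expr0 invr1; ring.
  by rewrite big_nat_recr//= IH exprS; field; exact: expf_neq0.
near=> n.
apply: (@le_trans _ _ (\sum_(0 <= j < n) (768 * rho / L * (2 ^+ j)^-1)%:E)%E).
  by apply: lee_sum => j _; exact: piece.
rewrite sumEFin lee_fin -mulr_sumr.
rewrite geo.
have h : 0 <= 768 * rho / L by rewrite divr_ge0 ?mulr_ge0 ?ltW.
have h' : 0 <= (2 ^+ n)^-1 :> R by rewrite invr_ge0 exprn_ge0.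
have -> : 1536 * rho / L = 768 * rho / L * 2 by ring.
by apply: ler_wpM2l => //; lra.
Unshelve. all: by end_near.
Qed.

End LongSticks.

(** * Independence and positive association in a Poisson process *)

Section PoissonHits.
Context {R : realType} {d d' : measure_display}.
Context {Omega : measurableType d} {T : measurableType d'}.
Variables (P : probability Omega R) (nu : set T -> \bar R) (xi : Omega -> set T).
Hypothesis poisson : is_poisson_process P nu xi.

Local Notation np := (npoints (R := R) xi).

Definition hit (A : set T) : set Omega := [set w | xi w `&` A !=set0].

Lemma counting_eq0 (A : set T) : counting A = 0%E :> \bar R <-> A = set0.
Proof.
split=> [|->]; last by rewrite /counting asboolT ?fset_set0.
rewrite /counting; case: asboolP => // fA /eqP; rewrite eqe pnatr_eq0 cardfs_eq0 => /eqP.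
exact: fset_set_set0.
Qed.

Lemma hitE A : hit A = ~` [set w | np A w = 0%E].
Proof.
apply/seteqP; split => w.
  by move=> [s sA] /counting_eq0 e; move: sA; rewrite e.
by move=> h; apply/set0P/eqP => e; apply: h; apply/counting_eq0.
Qed.

Let mN A B : measurable A -> measurable B -> measurable [set w | B (np A w)].
Proof.
move=> mA mB; have [mN _ _ _] := poisson.
by rewrite -[X in measurable X]setTI; exact: mN.
Qed.

Let mpt (x : \bar R) : measurable [set x].
Proof. exact: emeasurable_set1. Qed.

Lemma measurable_hit A : measurable A -> measurable (hit A).
Proof. by move=> mA; rewrite hitE; apply: measurableC; exact: (mN mA (mpt 0%E)). Qed.

Let law A k : measurable A -> (nu A < +oo)%E ->
  P [set w | np A w = k%:R%:E] =
    ((fine (nu A)) ^+ k / k`!%:R * expR (- fine (nu A)))%:E.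
Proof. by have [_ + _ _] := poisson => h mA; exact: h. Qed.

Lemma hit_le A (c : R) : measurable A -> (0 <= nu A)%E -> (nu A <= c%:E)%E ->
  (P (hit A) <= c%:E)%E.
Proof.
move=> mA nu0 nuc.
have nuy : (nu A < +oo)%E by apply: le_lt_trans nuc _; rewrite ltry.
rewrite hitE probability_setC; last exact: (mN mA (mpt 0%E)).
have := law 0 mA nuy; rewrite expr0 fact0 divr1 mul1r => ->.
rewrite -EFinB lee_fin.
have := expR_ge1Dx (- fine (nu A)).
suff : fine (nu A) <= c by lra.
by rewrite -lee_fin fineK// ge0_fin_numE.
Qed.

(** The Poisson weights of all integers sum to 1, which leaves probability 0 for an infinite
    count. *)
Lemma points_finite A : measurable A -> (nu A < +oo)%E ->
  exists N : set Omega, [/\ measurable N, P N = 0%E &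
    forall w, ~ N w -> finite_set (xi w `&` A)].
Proof.
move=> mA nuy.
pose F k := [set w | np A w = k%:R%:E].
have mF k : measurable (F k) by exact: (mN mA (mpt k%:R%:E)).
have mU : measurable (\bigcup_k F k) by exact: bigcup_measurable.
exists (~` \bigcup_k F k); split; first exact: measurableC.
  rewrite probability_setC// measure_bigcup//; last first.
    apply/trivIsetP => i j _ _ ij; apply/seteqP; split => // w [].
    rewrite /F /= => -> [] /eqP.
    by rewrite eqr_nat (negbTE ij).
  suff -> : (\sum_(0 <= i <oo | i \in setT) P (F i) = 1)%E by rewrite subee.
  under eq_eseriesl do rewrite in_setT.
  rewrite -[RHS]/(1%:E) -(expR0 R) -(subrr (fine (nu A))) expRD.
  set l := fine (nu A).
  apply/cvg_lim => //.
  have -> : (fun n => \sum_(0 <= k < n) P (F k))%E =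
      (fun n => (series (exp_coeff l) n * expR (- l))%:E).
    apply/funext => n; rewrite /series/= mulr_suml -sumEFin.
    by apply: eq_bigr => k _; rewrite law.
  apply: cvg_EFin; first exact: nearW.
  apply: cvgMl; exact: is_cvg_series_exp_coeff.
move=> w /contrapT[k _]; rewrite /F /= /npoints /counting.
by case: asboolP.
Qed.

(** With [l = nu A], two or more points have probability [1 - (1 + l) * expR (- l)], and
    [expR (- l) >= 1 - l] bounds this by [l ^+ 2]. *)
Lemma double_le A (c : R) : measurable A -> (0 <= nu A)%E -> (nu A <= c%:E)%E ->
  exists D : set Omega, [/\ measurable D, (P D <= (c ^+ 2)%:E)%E &
    forall w s t, s <> t -> (xi w `&` A) s -> (xi w `&` A) t -> D w].
Proof.
move=> mA nu0 nuc.
have nuy : (nu A < +oo)%E by apply: le_lt_trans nuc _; rewrite ltry.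
pose F (k : nat) := [set w | np A w = k%:R%:E].
have mF k : measurable (F k) by exact: (mN mA (mpt k%:R%:E)).
exists (~` (F 0%N `|` F 1%N)); split; first by apply: measurableC; exact: measurableU.
  rewrite probability_setC; last exact: measurableU.
  have -> : P (F 0%N `|` F 1%N) = (P (F 0%N) + P (F 1%N))%E.
    apply: measureU => //.
    by apply/seteqP; split => // w; rewrite /F => -[] /= -> /eqP; rewrite eqe (eqr_nat _ 0 1).
  have -> : P (F 0%N) = _ := law 0 mA nuy.
  have -> : P (F 1%N) = _ := law 1 mA nuy.
  rewrite expr0 expr1 fact0 !divr1 mul1r -EFinD lee_fin.
  have l0 : 0 <= fine (nu A) by exact: fine_ge0.
  have lc : fine (nu A) <= c by rewrite -lee_fin fineK// ge0_fin_numE.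
  have := expR_ge1Dx (- fine (nu A)); set e := expR _ => e1.
  set l := fine (nu A) in l0 lc e1 *; clearbody l e; clear nu0 nuc nuy.
  have h1 : (1 + l) * (1 - l) <= (1 + l) * e by apply: ler_wpM2l => //; lra.
  have h2 : l * l <= c * c by apply: ler_pM.
  by rewrite expr2; lra.
move=> w s t st sA tA [|]; rewrite /F /= /npoints.
  by move=> /counting_eq0 e; move: sA; rewrite e.
rewrite /counting; case: asboolP => // fA /eqP; rewrite eqe eqr_nat => /cardfs1P[x fx].
have inx y : (xi w `&` A) y -> y = x.
  by move=> yA; apply/eqP; rewrite -in_fset1 -fx in_fset_set//; exact: mem_set.
by apply: st; rewrite (inx _ sA) (inx _ tA).
Qed.

Lemma hit_indep (n : nat) (A : 'I_n -> set T) (b : 'I_n -> bool) :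
  (forall i, measurable (A i)) -> trivIset setT A ->
  P [set w | forall i, `[< hit (A i) w >] = b i] =
  (\prod_(i < n) P [set w | `[< hit (A i) w >] = b i])%E.
Proof.
move=> mA tA; have [_ _ _ indep] := poisson.
pose B i : set (\bar R) := if b i then ~` [set 0%E] else [set 0%E].
have mB i : measurable (B i).
  by rewrite /B; case: (b i) => //; apply: measurableC.
have BE i w : (`[< hit (A i) w >] = b i) <-> B i (np (A i) w).
  rewrite /B hitE; case: (b i); first by split => [/asboolP|/asboolT].
  split; first by move=> /asboolP h; apply: contrapT.
  by move=> h; apply/asboolP; apply.
have -> : [set w | forall i, `[< hit (A i) w >] = b i] =
    [set w | forall i, B i (np (A i) w)].
  by apply/seteqP; split => w /= h i; apply/BE.
rewrite indep//; apply: eq_bigr => i _; congr (P _).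
by apply/seteqP; split => w /= /BE.
Qed.

End PoissonHits.

(** * Independent bits and the Harris inequality *)

Section BernoulliProduct.
Context {R : realType}.
Implicit Types (ps : seq R) (f g : seq bool -> R).

Fixpoint expect ps f : R :=
  if ps is p :: ps' then
    p * expect ps' (f \o cons true) + (1 - p) * expect ps' (f \o cons false)
  else f [::].

Definition probs ps := all (fun p => 0 <= p <= 1) ps.

Definition le_bits (s t : seq bool) := all2 implb s t.

Lemma le_bits_refl s : le_bits s s.
Proof. by elim: s => //= -[] s ->. Qed.

Definition decreasing_bits f := forall s t, le_bits s t -> f t <= f s.

Lemma expect_le ps f g : probs ps -> (forall s, f s <= g s) -> expect ps f <= expect ps g.
Proof.
elim: ps f g => [|p ps IH] f g /=; first by move=> _ ->.
move=> /andP[/andP[p0 p1] hps] fg; apply: lerD; apply: ler_wpM2l => //; rewrite ?subr_ge0//;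
by apply: IH => // s; exact: fg.
Qed.

Lemma expect_eq ps f g : (forall s, size s = size ps -> f s = g s) -> expect ps f = expect ps g.
Proof.
elim: ps f g => [|p ps IH] f g /= fg; first by apply: fg.
by congr (_ * _ + _ * _); apply: IH => s hs; apply: fg; rewrite /= hs.
Qed.

Lemma expect_scale ps c f : expect ps (fun s => c * f s) = c * expect ps f.
Proof.
elim: ps f => //= p ps IH f.
rewrite -[_ \o cons true]/(fun s => c * (f \o cons true) s).
by rewrite -[_ \o cons false]/(fun s => c * (f \o cons false) s) !IH; ring.
Qed.

(** Condition on the first bit. The conditional means of [f] and [g] are ordered alike, so this bit
    contributes the nonnegative covariance [p * (1 - p) * ((F0 - F1) * (G0 - G1))]; the other bits
    are covered by induction. *)
Lemma harris ps f g : probs ps -> decreasing_bits f -> decreasing_bits g ->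
  expect ps f * expect ps g <= expect ps (fun s => f s * g s).
Proof.
elim: ps f g => [//|p ps IH] f g /= /andP[/andP[p0 p1] hps] df dg.
have dcons h b : decreasing_bits h -> decreasing_bits (h \o cons b).
  by move=> dh s t st; apply: dh; rewrite /le_bits /= -/(le_bits s t) st; case: b.
have tf h : decreasing_bits h -> expect ps (h \o cons true) <= expect ps (h \o cons false).
  by move=> dh; apply: expect_le => // s; apply: dh; exact: le_bits_refl.
have h1 := IH _ _ hps (dcons f true df) (dcons g true dg).
have h0 := IH _ _ hps (dcons f false df) (dcons g false dg).
have tff := tf f df; have tfg := tf g dg.
set F1 := expect ps (f \o cons true) in h1 tff *.
set F0 := expect ps (f \o cons false) in h0 tff *.
set G1 := expect ps (g \o cons true) in h1 tfg *.
set G0 := expect ps (g \o cons false) in h0 tfg *.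
set E1 := expect ps ((fun s => f s * g s) \o cons true).
set E0 := expect ps ((fun s => f s * g s) \o cons false).
have {}h1 : F1 * G1 <= E1 := h1.
have {}h0 : F0 * G0 <= E0 := h0.
have k1 := ler_wpM2l p0 h1.
have q0 : 0 <= 1 - p by rewrite subr_ge0.
have k0 := ler_wpM2l q0 h0.
have k2 : 0 <= p * (1 - p) * ((F0 - F1) * (G0 - G1)).
  by rewrite !mulr_ge0// ?subr_ge0.
apply: (le_trans _ (lerD k1 k0)).
by rewrite -subr_ge0; apply: le_trans k2 _; rewrite le_eqVlt; apply/orP; left; apply/eqP; ring.
Qed.

Lemma expect_cat ps qs f g :
  expect (ps ++ qs) (fun s => f (take (size ps) s) * g (drop (size ps) s)) =
  expect ps f * expect qs g.
Proof.
elim: ps f => [|p ps IH] f /=.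
  rewrite -expect_scale; apply: expect_eq => s _.
  by rewrite take0 drop0.
rewrite [RHS]mulrDl -[X in _ = X + _]mulrA -[X in _ = _ + X]mulrA.
by rewrite -(IH (f \o cons true)) -(IH (f \o cons false)).
Qed.

Definition weight ps (b : seq bool) : R :=
  \prod_(i < size ps) (if nth false b i then nth 0 ps i else 1 - nth 0 ps i).

Lemma weight_rcons ps p b c : size b = size ps ->
  weight (rcons ps p) (rcons b c) = weight ps b * (if c then p else 1 - p).
Proof.
move=> bs; rewrite /weight size_rcons big_ord_recr/=; congr (_ * _).
  by apply: eq_bigr => i _; rewrite !nth_rcons bs ltn_ord.
by rewrite !nth_rcons bs ltnn eqxx.
Qed.

Section Events.
Context {d : measure_display} {Omega : measurableType d} (P : probability Omega R).

Definition occ (L : seq (set Omega)) (w : Omega) : seq bool := [seq `[< A w >] | A <- L].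

Definition measurables (L : seq (set Omega)) := forall i, measurable (nth set0 L i).

Lemma measurables_cons A L : measurables (A :: L) <-> measurable A /\ measurables L.
Proof.
split => [h|[mA mL] [|i]//]; last exact: mL.
by split => [|i]; [exact: (h 0%N)|exact: (h i.+1)].
Qed.

Lemma measurable_occ L (Phi : seq bool -> Prop) : measurables L ->
  measurable [set w | Phi (occ L w)].
Proof.
elim: L Phi => [|A L IH] Phi.
  move=> _; have [h|h] := pselect (Phi [::]).
    by rewrite (_ : [set w | _] = setT)//; apply/seteqP; split.
  by rewrite (_ : [set w | _] = set0)//; apply/seteqP; split.
move=> /measurables_cons[mA mL].
have -> : [set w | Phi (occ (A :: L) w)] =
    (A `&` [set w | (Phi \o cons true) (occ L w)]) `|`
    (~` A `&` [set w | (Phi \o cons false) (occ L w)]).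
  apply/seteqP; split => w /=.
    by have [Aw|Aw] := pselect (A w); rewrite ?(asboolT Aw) ?(asboolF Aw); [left|right].
  by case=> -[Aw]; rewrite ?(asboolT Aw) ?(asboolF Aw).
apply: measurableU; apply: measurableI => //; [exact: IH|exact: measurableC|exact: IH].
Qed.

Definition independent_list (L : seq (set Omega)) := forall b : seq bool,
  size b = size L ->
  P [set w | occ L w = b] = (weight [seq fine (P A) | A <- L] b)%:E.

(** The events of [L2] are revealed one at a time: each splits the probability according to its bit
    and joins the prefix, until the law of complete bit patterns applies. *)
Lemma prob_occ_prefix L2 L1 b1 (Phi : seq bool -> Prop) :
  measurables (L1 ++ L2) -> independent_list (L1 ++ L2) ->
  (forall j, independent_list (take j (L1 ++ L2))) -> size b1 = size L1 ->
  P [set w | occ L1 w = b1 /\ Phi (occ L2 w)] =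
  (weight [seq fine (P A) | A <- L1] b1 *
   expect [seq fine (P A) | A <- L2] (fun s => (`[< Phi s >])%:R))%:E.
Proof.
elim: L2 L1 b1 Phi => [|A L2 IH] L1 b1 Phi mL iL pL sb.
  rewrite cats0 in mL iL; rewrite /=.
  have [h|h] := pselect (Phi [::]).
    rewrite (asboolT h) mulr1 -iL//; congr (P _).
    by apply/seteqP; split => w /=; tauto.
  rewrite (asboolF h) mulr0 (_ : [set w | _] = set0) ?measure0//.
  by apply/seteqP; split => w //= [].
rewrite -cat_rcons in mL iL pL.
have Et := IH (rcons L1 A) (rcons b1 true) (Phi \o cons true) mL iL pL.
have Ef := IH (rcons L1 A) (rcons b1 false) (Phi \o cons false) mL iL pL.
rewrite !size_rcons sb in Et Ef.
have sp : size b1 = size [seq fine (P A) | A <- L1] by rewrite size_map.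
rewrite map_rcons weight_rcons// in Et; rewrite map_rcons weight_rcons// in Ef.
have -> : [set w | occ L1 w = b1 /\ Phi (occ (A :: L2) w)] =
    [set w | occ (rcons L1 A) w = rcons b1 true /\ (Phi \o cons true) (occ L2 w)] `|`
    [set w | occ (rcons L1 A) w = rcons b1 false /\ (Phi \o cons false) (occ L2 w)].
  apply/seteqP; split => w /=; rewrite /occ map_rcons.
    by case: asboolP => Aw [<- ?]; [left|right].
  by case=> -[] /rcons_inj[<- e]; rewrite e.
have mm c : measurable [set w | occ (rcons L1 A) w = rcons b1 c /\ (Phi \o cons c) (occ L2 w)].
  have := @measurable_occ (rcons L1 A ++ L2) (fun s => take (size L1).+1 s = rcons b1 c /\
    Phi (c :: drop (size L1).+1 s)) mL.
  have e w : occ (rcons L1 A ++ L2) w = occ (rcons L1 A) w ++ occ L2 w by rewrite /occ map_cat.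
  have s1 w : (size L1).+1 = size (occ (rcons L1 A) w) by rewrite size_map size_rcons.
  by under eq_set => w do rewrite e {1}(s1 w) take_size_cat// (s1 w) drop_size_cat//.
transitivity
  (P [set w | occ (rcons L1 A) w = rcons b1 true /\ (Phi \o cons true) (occ L2 w)] +
   P [set w | occ (rcons L1 A) w = rcons b1 false /\ (Phi \o cons false) (occ L2 w)])%E.
  apply: measureU => //; apply/seteqP; split => // w /= [[+ _] [+ _]] => ->.
  by move=> /(congr1 (last false)); rewrite !last_rcons.
rewrite Et// Ef// -EFinD; congr EFin => /=.
by rewrite [RHS]mulrDr !mulrA.
Qed.

Lemma prob_occ L (Phi : seq bool -> Prop) : measurables L ->
  (forall j, independent_list (take j L)) ->
  P [set w | Phi (occ L w)] =
  (expect [seq fine (P A) | A <- L] (fun s => (`[< Phi s >])%:R))%:E.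
Proof.
move=> mL iL; have iL' := iL (size L); rewrite take_size in iL'.
have := @prob_occ_prefix L [::] [::] Phi mL iL' iL erefl.
rewrite /weight big_ord0 mul1r => <-; congr (P _).
by apply/seteqP; split => w //= [].
Qed.

End Events.
End BernoulliProduct.

(** * Configurations seen through the cells they occupy *)

Section Levels.
Context {R : realType} {d d' : measure_display}.
Context {Omega : measurableType d} {T : measurableType d'}.
Variables (P : probability Omega R) (nu : set T -> \bar R) (xi : Omega -> set T).
Hypothesis poisson : is_poisson_process P nu xi.
Variable sep : nat -> T -> bool.
Hypothesis msep : forall j, measurable [set s | sep j s].
Implicit Types (D : set T) (Psi : set T -> Prop).

Local Notation hit := (hit xi).

Definition pairwise_disjoint (L : seq (set T)) := forall i j,
  (i < size L)%N -> (j < size L)%N -> i != j -> nth set0 L i `&` nth set0 L j = set0.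

Lemma nth_map_hit L i : nth set0 [seq hit A | A <- L] i = hit (nth set0 L i).
Proof.
have [il|li] := ltnP i (size L); first by rewrite (nth_map set0).
rewrite !nth_default ?size_map//; by apply/seteqP; split => // w [s []].
Qed.

Lemma measurables_hit L : measurables L -> measurables [seq hit A | A <- L].
Proof. by move=> mL i; rewrite nth_map_hit; exact: (measurable_hit poisson (mL i)). Qed.

Lemma independent_hits L : measurables L -> pairwise_disjoint L ->
  independent_list P [seq hit A | A <- L].
Proof.
move=> mL dL b; rewrite size_map => sb.
pose A (i : 'I_(size L)) := nth set0 L i.
pose c (i : 'I_(size L)) := nth false b i.
have tA : trivIset setT A.
  by apply/trivIsetP => i j _ _ ij; exact: dL.
have := hit_indep poisson c (fun i => mL i) tA.
have -> : [set w | forall i, `[< hit (A i) w >] = c i] =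
    [set w | occ [seq hit A | A <- L] w = b].
  apply/seteqP; split => w /= h.
    apply: (@eq_from_nth _ false); first by rewrite !size_map sb.
    move=> i; rewrite !size_map => il; rewrite /occ -map_comp (nth_map set0)//.
    exact: (h (Ordinal il)).
  by move=> i; rewrite /c -h /occ -map_comp (nth_map set0).
move=> ->; rewrite /weight !size_map -prodEFin; apply: eq_bigr => i _.
rewrite -map_comp (nth_map set0)//= -/(A i) -/(c i).
have mh : measurable (hit (A i)) by exact: (measurable_hit poisson (mL i)).
case: (c i).
  have -> : [set w | `[< hit (A i) w >] = true] = hit (A i).
    by apply/seteqP; split => w /=; [move/asboolP|move=> h; apply/asboolP].
  by rewrite fineK// fin_num_measure.
have -> : [set w | `[< hit (A i) w >] = false] = ~` hit (A i).
  by apply/seteqP; split => w /=; [move/asboolP|move=> h; apply/asboolP].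
by rewrite probability_setC// EFinB fineK// fin_num_measure.
Qed.

Lemma independent_hits_take L : measurables L -> pairwise_disjoint L ->
  forall j, independent_list P (take j [seq hit A | A <- L]).
Proof.
move=> mL dL j; rewrite -map_take; apply: independent_hits.
  move=> i; have [ij|ji] := ltnP i (size (take j L)); last by rewrite nth_default.
  by rewrite nth_take//; apply: leq_trans ij _; rewrite size_take_min geq_minl.
move=> i i'; rewrite size_take_min !leq_min => /andP[ij iL] /andP[i'j i'L] ii'.
by rewrite !nth_take//; exact: dL.
Qed.

(* [sep] is a sequence of tests; the first [k] of them cut the space into the cells
   of level [k]. *)
Definition code k s : seq bool := [seq sep j s | j <- iota 0 k].
Definition codes k : seq (seq bool) := [seq tval t | t <- enum {: k.-tuple bool}].

Lemma code_in k s : code k s \in codes k.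
Proof.
have sk : size (code k s) == k by rewrite size_map size_iota.
by apply/mapP; exists (Tuple sk) => //; rewrite mem_enum.
Qed.

Lemma uniq_codes k : uniq (codes k).
Proof. by rewrite map_inj_uniq ?enum_uniq//; exact: val_inj. Qed.

Lemma measurable_code k c : measurable [set s | code k s = c].
Proof.
have [sc|sc] := eqVneq (size c) k; last first.
  rewrite (_ : [set s | _] = set0)//; apply/seteqP; split => // s /= e.
  by move: sc; rewrite -e size_map size_iota eqxx.
have -> : [set s | code k s = c] =
    \bigcap_(j in `I_k) (if nth false c j then [set s | sep j s] else ~` [set s | sep j s]).
  apply/seteqP; split => s /= h.
    move=> j /= jk; rewrite -h (nth_map 0%N) ?size_iota// nth_iota// add0n.
    by case: ifPn => //= /negP.
  apply: (@eq_from_nth _ false); first by rewrite size_map size_iota.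
  move=> j; rewrite size_map size_iota => jk; rewrite (nth_map 0%N) ?size_iota//.
  rewrite nth_iota// add0n; have := h j jk; case: (nth false c j) => //=.
  by move=> /negP /negbTE.
apply: bigcap_measurableType => j _; case: ifPn => _ //; exact: measurableC.
Qed.

Definition atoms k D : seq (set T) := [seq D `&` [set s | code k s = c] | c <- codes k].

Lemma measurables_atoms k D : measurable D -> measurables (atoms k D).
Proof.
move=> mD i; have [il|li] := ltnP i (size (codes k)); last by rewrite nth_default// size_map.
by rewrite (nth_map [::])//; apply: measurableI => //; exact: measurable_code.
Qed.

Lemma disjoint_atoms k D : pairwise_disjoint (atoms k D).
Proof.
move=> i j; rewrite !size_map => il jl ij; rewrite !(nth_map [::]) ?size_map//.
apply/seteqP; split => // s [[_ /= si] [_ /= sj]]; move/eqP: ij; apply.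
by apply/eqP; rewrite -(nth_uniq [::] _ _ (uniq_codes k)) ?size_map// -si -sj.
Qed.

(* increasing, and depends on a configuration only through the cells of level k
   that it occupies *)
Definition at_level k Psi := forall Y Z : set T,
  (forall s, Y s -> exists2 r, Z r & code k r = code k s) -> Psi Y -> Psi Z.

(** [Psi] is evaluated on the union of the occupied cells, which a functional [at_level k] cannot
    tell from the configuration itself. *)
Definition of_bits k Psi (b : seq bool) : Prop :=
  Psi [set s | nth false b (index (code k s) (codes k))].

Lemma of_bitsE k Psi D w : at_level k Psi ->
  Psi (xi w `&` D) <-> of_bits k Psi (occ [seq hit A | A <- atoms k D] w).
Proof.
move=> lev; rewrite /of_bits.
have E s : nth false (occ [seq hit A | A <- atoms k D] w) (index (code k s) (codes k)) <->
    exists2 r, (xi w `&` D) r & code k r = code k s.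
  have ic : (index (code k s) (codes k) < size (codes k))%N by rewrite index_mem code_in.
  rewrite /occ /atoms -2!map_comp (nth_map [::])// nth_index ?code_in//=.
  split; first by move=> /asboolP[r [xr [Dr cr]]]; exists r.
  by move=> [r [xr Dr] cr]; apply/asboolP; exists r.
split; apply: lev; first by move=> s sY; exists s => //; apply/E; exists s.
by move=> s /E[r rY cr]; exists r.
Qed.

Lemma of_bits_mono k Psi b b' : at_level k Psi -> le_bits b b' ->
  of_bits k Psi b -> of_bits k Psi b'.
Proof.
move=> lev bb'; apply: lev => s /= h; exists s => //.
have : forall i, nth false b i -> nth false b' i.
  elim: b b' bb' {h} => [|x b IH] [|y b'] //=.
  by move=> /andP[xy /IH h] [|i] //=; [move: xy; case: x; case: y|exact: h].
exact.
Qed.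

Lemma measurable_level k Psi D : at_level k Psi -> measurable D ->
  measurable [set w | Psi (xi w `&` D)].
Proof.
move=> lev mD.
have -> : [set w | Psi (xi w `&` D)] =
    [set w | of_bits k Psi (occ [seq hit A | A <- atoms k D] w)].
  by apply/seteqP; split => w /= /(of_bitsE _ _ lev).
by apply: measurable_occ; apply: measurables_hit; exact: measurables_atoms.
Qed.

Local Notation fP A := (fine (P A)).

Lemma probs_fine (L : seq (set Omega)) : measurables L -> probs [seq fP A | A <- L].
Proof.
elim: L => //= A L IH /measurables_cons[mA mL]; rewrite IH// andbT.
apply/andP; split; first exact: fine_ge0.
by rewrite -lee_fin fineK ?fin_num_measure// probability_le1.
Qed.

(** The occupation bits of disjoint cells are independent, and the failure of an increasing
    functional is decreasing in them, so [harris] applies. *)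
Lemma level_fkg k Psi1 Psi2 D : at_level k Psi1 -> at_level k Psi2 -> measurable D ->
  fP [set w | ~ Psi1 (xi w `&` D)] * fP [set w | ~ Psi2 (xi w `&` D)] <=
  fP [set w | ~ Psi1 (xi w `&` D) /\ ~ Psi2 (xi w `&` D)].
Proof.
move=> lev1 lev2 mD; set L := [seq hit A | A <- atoms k D].
have mA := measurables_atoms k mD.
have mL : measurables L by exact: measurables_hit.
have iL : forall j, independent_list P (take j L).
  by apply: independent_hits_take => //; exact: disjoint_atoms.
have PE (Phi : seq bool -> Prop) (A : set Omega) :
    (forall w, A w <-> Phi (occ L w)) ->
    fP A = expect [seq fP A | A <- L] (fun s => (`[< Phi s >])%:R).
  move=> h; have -> : A = [set w | Phi (occ L w)] by apply/seteqP; split => w /= /h.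
  by rewrite (prob_occ _ mL iL).
rewrite (PE (fun s => ~ of_bits k Psi1 s)); last first.
  by move=> w /=; rewrite (of_bitsE _ _ lev1).
rewrite (PE (fun s => ~ of_bits k Psi2 s)); last first.
  by move=> w /=; rewrite (of_bitsE _ _ lev2).
rewrite (PE (fun s => ~ of_bits k Psi1 s /\ ~ of_bits k Psi2 s)); last first.
  by move=> w /=; rewrite (of_bitsE _ _ lev1) (of_bitsE _ _ lev2).
have dec Psi : at_level k Psi -> decreasing_bits (fun s => (`[< ~ of_bits k Psi s >])%:R : R).
  move=> lev s t st; rewrite ler_nat; case: asboolP => // h.
  by rewrite asboolT// => /(of_bits_mono lev st).
apply: (le_trans (harris (probs_fine mL) (dec _ lev1) (dec _ lev2))).
apply: expect_le; first exact: probs_fine.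
by move=> s; rewrite -natrM ler_nat; do 3 case: asboolP => //; tauto.
Qed.

(** The cells of [D1] followed by those of [D2] form one list of disjoint sets, hence of independent
    bits; each event reads only its own part of the list. *)
Lemma level_indep k Psi1 Psi2 D1 D2 : at_level k Psi1 -> at_level k Psi2 ->
  measurable D1 -> measurable D2 -> D1 `&` D2 = set0 ->
  fP [set w | Psi1 (xi w `&` D1) /\ Psi2 (xi w `&` D2)] =
  fP [set w | Psi1 (xi w `&` D1)] * fP [set w | Psi2 (xi w `&` D2)].
Proof.
move=> lev1 lev2 mD1 mD2 D12.
set L1 := atoms k D1; set L2 := atoms k D2.
have nth_sub D i : nth set0 (atoms k D) i `<=` D.
  have [il|li] := ltnP i (size (codes k)); last by rewrite nth_default// size_map.
  by rewrite (nth_map [::])// => s [].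
have mL : measurables (L1 ++ L2).
  by move=> i; rewrite nth_cat; case: ifP => _;
  [exact: (measurables_atoms k mD1)|exact: (measurables_atoms k mD2)].
have dL : pairwise_disjoint (L1 ++ L2).
  move=> i j; rewrite size_cat !nth_cat => il jl ij.
  case: ltnP => iL1; case: ltnP => jL1.
  - exact: disjoint_atoms.
  - apply/seteqP; split => // s [/nth_sub h1 /nth_sub h2].
    by have : (D1 `&` D2) s by []; rewrite D12.
  - apply/seteqP; split => // s [/nth_sub h1 /nth_sub h2].
    by have : (D1 `&` D2) s by []; rewrite D12.
  - apply: disjoint_atoms; rewrite ?ltn_subLR//.
    by apply: contra ij => /eqP e; rewrite -(subnK iL1) -(subnK jL1) e.
have sub_take j : independent_list P (take j [seq hit A | A <- L1 ++ L2]).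
  exact: independent_hits_take.
have mh := measurables_hit mL.
have mh1 := measurables_hit (measurables_atoms k mD1).
have mh2 := measurables_hit (measurables_atoms k mD2).
have i1 := independent_hits_take (measurables_atoms k mD1) (@disjoint_atoms k D1).
have i2 := independent_hits_take (measurables_atoms k mD2) (@disjoint_atoms k D2).
have PE (L : seq (set Omega)) (mL' : measurables L)
    (iL' : forall j, independent_list P (take j L)) (Phi : seq bool -> Prop) (A : set Omega) :
    (forall w, A w <-> Phi (occ L w)) ->
    fP A = expect [seq fP A | A <- L] (fun s => (`[< Phi s >])%:R).
  move=> h; have -> : A = [set w | Phi (occ L w)] by apply/seteqP; split => w /= /h.
  by rewrite (prob_occ _ mL' iL').
rewrite (PE _ mh1 i1 (of_bits k Psi1) [set w | Psi1 (xi w `&` D1)]); last by move=> w /=; rewrite (of_bitsE _ _ lev1).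
rewrite (PE _ mh2 i2 (of_bits k Psi2) [set w | Psi2 (xi w `&` D2)]); last by move=> w /=; rewrite (of_bitsE _ _ lev2).
rewrite -expect_cat -map_cat -map_cat.
rewrite (PE _ mh sub_take (fun s => of_bits k Psi1 (take (size L1) s) /\
   of_bits k Psi2 (drop (size L1) s))); last first.
  move=> w /=; rewrite (of_bitsE _ _ lev1) (of_bitsE _ _ lev2) /occ !map_cat.
  by rewrite take_size_cat ?drop_size_cat// !size_map.
apply: expect_eq => s _; rewrite !size_map -natrM mulnb; congr (nat_of_bool _)%:R.
by rewrite asbool_and.
Qed.

End Levels.

(** * Passage to the limit over levels and windows *)

Section Limits.
Context {R : realType} {d : measure_display} {Omega : measurableType d}.
Variable P : probability Omega R.
Local Notation fP A := (fine (P A)).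
Implicit Types B : nat -> set Omega.

Lemma fine_prob_inc B : (forall k, measurable (B k)) -> (forall k, B k `<=` B k.+1) ->
  (fun k => fP (B k)) @ \oo --> fP (\bigcup_k B k).
Proof.
move=> mB iB; apply: fine_cvg; rewrite fineK; last first.
  by apply: fin_num_measure; exact: bigcup_measurable.
apply: nondecreasing_cvg_mu => //; first exact: bigcup_measurable.
by apply/nondecreasing_seqP => k; apply/subsetPset.
Qed.

Lemma fine_prob_dec B : (forall k, measurable (B k)) -> (forall k, B k.+1 `<=` B k) ->
  (fun k => fP (B k)) @ \oo --> fP (\bigcap_k B k).
Proof.
move=> mB iB; apply: fine_cvg; rewrite fineK; last first.
  by apply: fin_num_measure; exact: bigcap_measurableType.
apply: nonincreasing_cvg_mu => //; last 2 first.
- exact: bigcap_measurableType.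
- by apply/nonincreasing_seqP => k; apply/subsetPset.
- by apply: le_lt_trans (probability_le1 _ _) _ => //; rewrite ltry.
Qed.

Let lim_le (x y : nat -> R) (a b : R) : x @ \oo --> a -> y @ \oo --> b ->
  (forall n, x n <= y n) -> a <= b.
Proof. by move=> xa yb xy; apply: (ler_cvg_to xa yb); exact: nearW. Qed.

Variables A1 A2 : nat -> nat -> set Omega.
Hypothesis mA1 : forall m k, measurable (A1 m k).
Hypothesis mA2 : forall m k, measurable (A2 m k).
Hypothesis incA1 : forall m k, A1 m k `<=` A1 m.+1 k.
Hypothesis incA2 : forall m k, A2 m k `<=` A2 m.+1 k.
Hypothesis decA1 : forall m k, A1 m k.+1 `<=` A1 m k.
Hypothesis decA2 : forall m k, A2 m k.+1 `<=` A2 m k.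
Let C1 m := \bigcap_k A1 m k.
Let C2 m := \bigcap_k A2 m k.
Let mC1 m : measurable (C1 m). Proof. exact: bigcap_measurableType. Qed.
Let mC2 m : measurable (C2 m). Proof. exact: bigcap_measurableType. Qed.
Let incC1 m : C1 m `<=` C1 m.+1. Proof. by move=> w h k _; apply: incA1; exact: h. Qed.
Let incC2 m : C2 m `<=` C2 m.+1. Proof. by move=> w h k _; apply: incA2; exact: h. Qed.

(** [k] stands for the level and [m] for the window: the events decrease in [k] to the exact event
    in a window, and these increase in [m] to the event in the whole space. Monotone continuity of
    [P] carries the inequality through both limits. *)
Lemma indep_limit : (forall m k, fP (A1 m k `&` A2 m k) <= fP (A1 m k) * fP (A2 m k)) ->
  fP (\bigcup_m C1 m `&` \bigcup_m C2 m) <= fP (\bigcup_m C1 m) * fP (\bigcup_m C2 m).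
Proof.
move=> H.
have HC m : fP (C1 m `&` C2 m) <= fP (C1 m) * fP (C2 m).
  have e : \bigcap_k (A1 m k `&` A2 m k) = C1 m `&` C2 m by rewrite bigcapI.
  have := @fine_prob_dec (fun k => A1 m k `&` A2 m k).
  rewrite e => h; apply: lim_le (h _ _) (cvgM (fine_prob_dec _ _) (fine_prob_dec _ _)) _ => //.
  - by move=> k; exact: measurableI.
  - by move=> k; exact: setISS.
have e : \bigcup_m (C1 m `&` C2 m) = \bigcup_m C1 m `&` \bigcup_m C2 m.
  apply/seteqP; split => [w [m _ [h1 h2]]|w [[m _ h1] [n _ h2]]]; first by split; exists m.
  have mono (C : nat -> set Omega) (iC : forall m, C m `<=` C m.+1) i j :
      (i <= j)%N -> C i `<=` C j.
    by elim: j => [|j IH]; [rewrite leqn0 => /eqP->|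
      rewrite leq_eqVlt => /predU1P[->//|ij] v /(IH ij) /iC].
  by exists (maxn m n) => //; split;
    [apply: mono h1; rewrite ?leq_maxl|apply: mono h2; rewrite ?leq_maxr].
have := @fine_prob_inc (fun m => C1 m `&` C2 m).
rewrite e => h; apply: lim_le (h _ _) (cvgM (fine_prob_inc _ _) (fine_prob_inc _ _)) _ => //.
- by move=> k; exact: measurableI.
- by move=> k; exact: setISS.
Qed.

Lemma fkg_limit :
  (forall m k, fP (~` A1 m k) * fP (~` A2 m k) <= fP (~` A1 m k `&` ~` A2 m k)) ->
  fP (~` \bigcup_m C1 m) * fP (~` \bigcup_m C2 m) <=
  fP (~` (\bigcup_m C1 m) `&` ~` \bigcup_m C2 m).
Proof.
move=> H.
have HC m : fP (~` C1 m) * fP (~` C2 m) <= fP (~` C1 m `&` ~` C2 m).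
  have e1 : \bigcup_k ~` A1 m k = ~` C1 m by rewrite setC_bigcap.
  have e2 : \bigcup_k ~` A2 m k = ~` C2 m by rewrite setC_bigcap.
  have e : \bigcup_k (~` A1 m k `&` ~` A2 m k) = ~` C1 m `&` ~` C2 m.
    rewrite -e1 -e2; apply/seteqP; split => [w [k _ [h1 h2]]|w [[k _ h1] [n _ h2]]].
      by split; exists k.
    have mono (A : nat -> set Omega) (dA : forall m, A m.+1 `<=` A m) i j :
        (i <= j)%N -> ~` A i `<=` ~` A j.
      by elim: j => [|j IH]; [rewrite leqn0 => /eqP->|
        rewrite leq_eqVlt => /predU1P[->//|ij] v /(IH ij) h /dA].
    by exists (maxn k n) => //; split; [apply: mono h1|apply: mono h2];
      rewrite ?leq_maxl ?leq_maxr.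
  have h1 := @fine_prob_inc (fun k => ~` A1 m k).
  have h2 := @fine_prob_inc (fun k => ~` A2 m k).
  have := @fine_prob_inc (fun k => ~` A1 m k `&` ~` A2 m k).
  rewrite e; rewrite e1 in h1; rewrite e2 in h2 => h.
  apply: lim_le (cvgM (h1 _ _) (h2 _ _)) (h _ _) _ => //.
  - by move=> k; exact: measurableC.
  - by move=> k; exact: subsetC.
  - by move=> k; exact: measurableC.
  - by move=> k; exact: subsetC.
  - by move=> k; apply: measurableI; exact: measurableC.
  - by move=> k; apply: setISS; exact: subsetC.
  - exact: H.
have e1 : \bigcap_m ~` C1 m = ~` \bigcup_m C1 m by rewrite setC_bigcup.
have e2 : \bigcap_m ~` C2 m = ~` \bigcup_m C2 m by rewrite setC_bigcup.
have e : \bigcap_m (~` C1 m `&` ~` C2 m) = ~` (\bigcup_m C1 m) `&` ~` \bigcup_m C2 m.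
  by rewrite -e1 -e2 bigcapI.
have h1 := @fine_prob_dec (fun k => ~` C1 k).
have h2 := @fine_prob_dec (fun k => ~` C2 k).
have := @fine_prob_dec (fun k => ~` C1 k `&` ~` C2 k).
rewrite e; rewrite e1 in h1; rewrite e2 in h2 => h.
apply: lim_le (cvgM (h1 _ _) (h2 _ _)) (h _ _) _ => //.
- by move=> k; exact: measurableC.
- by move=> k; exact: subsetC.
- by move=> k; exact: measurableC.
- by move=> k; exact: subsetC.
- by move=> k; apply: measurableI; exact: measurableC.
- by move=> k; apply: setISS; exact: subsetC.
Qed.

End Limits.

Section Regular.
Context {R : realType} {d d' : measure_display}.
Context {Omega : measurableType d} {T : measurableType d'}.
Variables (P : probability Omega R) (nu : set T -> \bar R) (xi : Omega -> set T).
Hypothesis poisson : is_poisson_process P nu xi.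
Variable sep : nat -> T -> bool.
Hypothesis msep : forall j, measurable [set s | sep j s].
Variables (W : nat -> set T) (N0 : set Omega).
Hypothesis mW : forall m, measurable (W m).
Hypothesis incW : forall m, W m `<=` W m.+1.
Hypothesis coverW : forall w, xi w `<=` \bigcup_m W m.
Hypothesis mN0 : measurable N0.
Hypothesis PN0 : P N0 = 0%E.
Hypothesis finW : forall w m, ~ N0 w -> finite_set (xi w `&` W m).
Implicit Types (D : set T) (Psi : set T -> Prop).
Local Notation fP A := (fine (P A)).

(* [Psi] is increasing and finitary, and on finite configurations it is the
   decreasing limit of functionals that only see occupied cells *)
Definition regular Psi := exists Psik : nat -> set T -> Prop,
  [/\ forall k, at_level sep k (Psik k),
      forall k Y, Psik k.+1 Y -> Psik k Y,
      forall Y, finite_set Y -> (Psi Y <-> forall k, Psik k Y),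
      forall Y Z, Y `<=` Z -> Psi Y -> Psi Z &
      forall Y, Psi Y -> exists F, [/\ finite_set F, F `<=` Y & Psi F]].

(** If both disjuncts fail on a finite configuration, they fail at levels [k1] and [k2], hence
    together at the larger level. *)
Lemma regular_or Psi1 Psi2 : regular Psi1 -> regular Psi2 ->
  regular (fun Y => Psi1 Y \/ Psi2 Y).
Proof.
move=> [Q1 [l1 d1 f1 m1 e1]] [Q2 [l2 d2 f2 m2 e2]].
have mono (Q : nat -> set T -> Prop) (dQ : forall k Y, Q k.+1 Y -> Q k Y) i j Y :
    (i <= j)%N -> Q j Y -> Q i Y.
  by elim: j => [|j IH]; [rewrite leqn0 => /eqP->|
    rewrite leq_eqVlt => /predU1P[->//|ij] /dQ /(IH ij)].
exists (fun k Y => Q1 k Y \/ Q2 k Y); split.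
- by move=> k Y Z YZ [h|h]; [left; apply: l1 h|right; apply: l2 h].
- by move=> k Y [/d1|/d2]; [left|right].
- move=> Y fY; split; first by move=> [/(f1 _ fY) h|/(f2 _ fY) h] k; [left|right].
  move=> h; apply: contrapT => /not_orP[n1 n2].
  have /existsNP[k1 h1] : ~ forall k, Q1 k Y by move=> h'; apply: n1; apply/(f1 _ fY).
  have /existsNP[k2 h2] : ~ forall k, Q2 k Y by move=> h'; apply: n2; apply/(f2 _ fY).
  case: (h (maxn k1 k2)) => hh.
    by apply: h1; apply: mono hh => //; exact: leq_maxl.
  by apply: h2; apply: mono hh => //; exact: leq_maxr.
- by move=> Y Z YZ [/(m1 _ _ YZ)|/(m2 _ _ YZ)]; [left|right].
- move=> Y [/e1|/e2] [F [fF FY h]]; exists F; split => //; [left|right]; exact: h.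
Qed.

Definition approx (Q : nat -> set T -> Prop) D m k : set Omega :=
  [set w | Q k (xi w `&` (D `&` W m))].

(** Outside [N0] the configuration in a window is finite, so the levels together decide [Psi] there.
    A finite witness [F] fits into one window, since the windows increase and cover. *)
Lemma approxE Psi Q D : (forall Y, finite_set Y -> (Psi Y <-> forall k, Q k Y)) ->
  (forall Y Z, Y `<=` Z -> Psi Y -> Psi Z) ->
  (forall Y, Psi Y -> exists F, [/\ finite_set F, F `<=` Y & Psi F]) ->
  forall w, ~ N0 w -> Psi (xi w `&` D) <-> (\bigcup_m \bigcap_k approx Q D m k) w.
Proof.
move=> fQ mPsi ePsi w Nw.
have fin m : finite_set (xi w `&` (D `&` W m)).
  by apply: sub_finite_set (finW m Nw) => s [? []].
split; last first.
  move=> [m _ h]; have /(fQ _ (fin m)) : forall k, Q k (xi w `&` (D `&` W m)).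
    by move=> k; exact: h.
  by apply: mPsi => s [? []].
move=> /ePsi[F [fF FY PF]].
have incW' i j : (i <= j)%N -> W i `<=` W j.
  by elim: j => [|j IH]; [rewrite leqn0 => /eqP->|
    rewrite leq_eqVlt => /predU1P[->//|ij] v /(IH ij) /incW].
have [m Fm] : exists m, F `<=` W m.
  have idx s : exists m, F s -> W m s.
    have [Fs|nFs] := pselect (F s); last by exists 0%N.
    by have [m _ h] := coverW (FY s Fs).1; exists m.
  have [g hg] := choice idx.
  have /finite_setP[n Fn] : finite_set (g @` F) by exact: finite_image.
  have fg : finite_set (g @` F) by exact: finite_image.
  exists (\max_(i <- fset_set (g @` F)) i)%N => s Fs.
  apply: incW' (hg s Fs); apply: leq_bigmax_seq => //.
  by rewrite in_fset_set//; apply: mem_set; exists s.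
exists m => // k _; apply: (fQ _ (fin m)).1; apply: mPsi PF => s Fs.
by have [? ?] := FY s Fs; split => //; split => //; exact: Fm.
Qed.

Lemma prob_good (A : set Omega) : measurable A -> fP (~` N0 `&` A) = fP A.
Proof.
move=> mA; congr fine; rewrite setIC -setDE.
have -> : P (A `\` N0) = (P A - P (A `&` N0))%E.
  apply: measureD => //; apply: le_lt_trans (probability_le1 _ _) _ => //.
  by rewrite ltry.
have -> : P (A `&` N0) = 0%E.
  apply/eqP; rewrite eq_le measure_ge0 andbT -PN0.
  by apply: le_measure; [apply: mem_set; exact: measurableI|exact: mem_set|exact: subIsetr].
by rewrite sube0.
Qed.

(* Outside the null set [N0] the configuration is finite in every window; only
   there are these events known to be measurable. *)
Definition event Psi D : set Omega := ~` N0 `&` [set w | Psi (xi w `&` D)].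
Definition noevent Psi D : set Omega := ~` N0 `&` [set w | ~ Psi (xi w `&` D)].

Let approx_set Psi Q D (fQ : forall Y, finite_set Y -> (Psi Y <-> forall k, Q k Y))
  (mQ : forall Y Z, Y `<=` Z -> Psi Y -> Psi Z)
  (eQ : forall Y, Psi Y -> exists F, [/\ finite_set F, F `<=` Y & Psi F]) :
  event Psi D = ~` N0 `&` \bigcup_m \bigcap_k approx Q D m k /\
  noevent Psi D = ~` N0 `&` ~` \bigcup_m \bigcap_k approx Q D m k.
Proof.
have E w (Nw : ~ N0 w) := approxE D fQ mQ eQ Nw.
by split; apply/seteqP; split => w [Nw h]; split => //; move: h; rewrite /= E.
Qed.

Let m_approx Q D m k : (forall k, at_level sep k (Q k)) -> measurable D ->
  measurable (approx Q D m k).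
Proof.
by move=> lQ mD; apply: (measurable_level poisson msep (lQ k)); exact: measurableI.
Qed.

Let inc_approx Q D m k : (forall k, at_level sep k (Q k)) ->
  approx Q D m k `<=` approx Q D m.+1 k.
Proof.
by move=> lQ w; apply: lQ => s [? [? /incW ?]]; exists s.
Qed.

Let m_limit Q D : (forall k, at_level sep k (Q k)) -> measurable D ->
  measurable (\bigcup_m \bigcap_k approx Q D m k).
Proof.
move=> lQ mD; apply: bigcup_measurable => m _; apply: bigcap_measurableType => k _.
exact: m_approx.
Qed.

Lemma measurable_event Psi D : regular Psi -> measurable D -> measurable (event Psi D).
Proof.
move=> [Q [lQ dQ fQ mQ eQ]] mD; rewrite (approx_set D fQ mQ eQ).1.
by apply: measurableI; [exact: measurableC|exact: m_limit].
Qed.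

Lemma measurable_noevent Psi D : regular Psi -> measurable D -> measurable (noevent Psi D).
Proof.
move=> [Q [lQ dQ fQ mQ eQ]] mD; rewrite (approx_set D fQ mQ eQ).2.
by apply: measurableI; apply: measurableC; [|exact: m_limit].
Qed.

Lemma regular_indep Psi1 Psi2 D1 D2 : regular Psi1 -> regular Psi2 ->
  measurable D1 -> measurable D2 -> D1 `&` D2 = set0 ->
  fP (event Psi1 D1 `&` event Psi2 D2) <= fP (event Psi1 D1) * fP (event Psi2 D2).
Proof.
move=> [Q1 [l1 d1 f1 m1 e1]] [Q2 [l2 d2 f2 m2 e2]] mD1 mD2 D12.
rewrite (approx_set D1 f1 m1 e1).1 (approx_set D2 f2 m2 e2).1.
rewrite setIACA setIid !prob_good; [|exact: m_limit..|by apply: measurableI; exact: m_limit].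
apply: indep_limit.
- by move=> m k; exact: m_approx.
- by move=> m k; exact: m_approx.
- by move=> m k; exact: inc_approx.
- by move=> m k; exact: inc_approx.
- by move=> m k w; exact: d1.
- by move=> m k w; exact: d2.
move=> m k; rewrite -(level_indep poisson msep (l1 k) (l2 k)) => //.
- exact: measurableI.
- exact: measurableI.
- by rewrite setIACA D12 set0I.
Qed.

Lemma regular_fkg Psi1 Psi2 D : regular Psi1 -> regular Psi2 -> measurable D ->
  fP (noevent Psi1 D) * fP (noevent Psi2 D) <= fP (noevent Psi1 D `&` noevent Psi2 D).
Proof.
move=> [Q1 [l1 d1 f1 m1 e1]] [Q2 [l2 d2 f2 m2 e2]] mD.
rewrite (approx_set D f1 m1 e1).2 (approx_set D f2 m2 e2).2.
have mC Q : (forall k, at_level sep k (Q k)) -> measurable (~` \bigcup_m \bigcap_k approx Q D m k).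
  by move=> lQ; apply: measurableC; exact: m_limit.
rewrite setIACA setIid !prob_good; [|by apply: measurableI; exact: mC|exact: mC..].
apply: fkg_limit.
- by move=> m k; exact: m_approx.
- by move=> m k; exact: m_approx.
- by move=> m k; exact: inc_approx.
- by move=> m k; exact: inc_approx.
- by move=> m k w; exact: d1.
- by move=> m k w; exact: d2.
move=> m k; apply: (level_fkg poisson msep (l1 k) (l2 k)).
exact: measurableI.
Qed.

End Regular.

(** * Chains of sticks *)

Section Chains.
Context {T : Type}.
Implicit Types (Y : set T) (rel : T -> T -> Prop) (st en : T -> Prop).

Inductive reach Y rel st : T -> Prop :=
| reach_start s : Y s -> st s -> reach Y rel st s
| reach_step s t : reach Y rel st s -> rel s t -> Y t -> reach Y rel st t.

Definition chain rel st en Y := exists2 s, reach Y rel st s & en s.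

Lemma reach_in Y rel st s : reach Y rel st s -> Y s.
Proof. by case. Qed.

Lemma reach_mono Y Z rel rel' st st' s : Y `<=` Z ->
  (forall s t, Y s -> Y t -> rel s t -> rel' s t) -> (forall s, Y s -> st s -> st' s) ->
  reach Y rel st s -> reach Z rel' st' s.
Proof.
move=> YZ rr ss; elim=> [x Yx sx|x y rx IH xy Yy].
  by apply: reach_start; [exact: YZ|exact: ss].
apply: reach_step IH _ (YZ _ Yy); apply: rr => //; exact: reach_in rx.
Qed.

Lemma chain_mono Y Z rel rel' st st' en en' : Y `<=` Z ->
  (forall s t, Y s -> Y t -> rel s t -> rel' s t) -> (forall s, Y s -> st s -> st' s) ->
  (forall s, Y s -> en s -> en' s) -> chain rel st en Y -> chain rel' st' en' Z.
Proof.
move=> YZ rr ss ee [s rs es]; exists s; first exact: reach_mono rs.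
by apply: ee es; exact: reach_in rs.
Qed.

Lemma chain_finitary rel st en Y : chain rel st en Y ->
  exists F, [/\ finite_set F, F `<=` Y & chain rel st en F].
Proof.
move=> [s rs es]; suff [F [fF FY rF]] : exists F, [/\ finite_set F, F `<=` Y & reach F rel st s].
  by exists F; split => //; exists s.
elim: rs => [x Yx sx|x y rx [F [fF FY IH]] xy Yy].
  by exists [set x]; split; [exact: finite_set1|move=> _ ->|exact: reach_start].
exists (F `|` [set y]); split.
- by rewrite finite_setU; split => //; exact: finite_set1.
- by move=> z [/FY|->].
- apply: reach_step xy _; last by right.
  by apply: reach_mono IH => // z; left.
Qed.

Lemma chain_nat rel st en Y : chain rel st en Y -> exists (n : nat) (s : nat -> T),
  [/\ forall i, (i <= n)%N -> Y (s i), forall i, (i < n)%N -> rel (s i) (s i.+1),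
      st (s 0%N) & en (s n)].
Proof.
move=> [x rx ex].
have [n [s [h1 h2 h3 h4]]] : exists (n : nat) (s : nat -> T),
  [/\ forall i, (i <= n)%N -> Y (s i), forall i, (i < n)%N -> rel (s i) (s i.+1),
      st (s 0%N) & s n = x].
  elim: rx {ex} => [y Yy sy|y z _ [n [s [h1 h2 h3 h4]]] yz Yz].
    by exists 0%N, (fun=> y); split.
  exists n.+1, (fun i => if (i <= n)%N then s i else z); split => //.
  - by move=> i _; case: ifPn => // /h1.
  - move=> i; rewrite ltnS => ni; rewrite ni; case: ltnP => [/h2//|ni'].
    by have -> : i = n; [apply/eqP; rewrite eqn_leq ni ni'|rewrite h4].
  - by rewrite ltnn.
by exists n, s; split => //; rewrite h4.
Qed.

Lemma nat_chain rel st en Y (n : nat) (s : nat -> T) :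
  (forall i, (i <= n)%N -> Y (s i)) -> (forall i, (i < n)%N -> rel (s i) (s i.+1)) ->
  st (s 0%N) -> en (s n) -> chain rel st en Y.
Proof.
move=> h1 h2 h3 h4; exists (s n) => //; elim: n h1 h2 {h4} => [|n IH] h1 h2.
  by apply: reach_start => //; exact: h1.
apply: reach_step (h2 _ (ltnSn n)) (h1 _ (leqnn _)); apply: IH => i ni.
  by apply: h1; exact: leqW.
by apply: h2; exact: leqW.
Qed.

End Chains.

Section ChainRegular.
Context {d : measure_display} {T : measurableType d} (sep : nat -> T -> bool).
Implicit Types (Y : set T) (rel : T -> T -> Prop) (st en : T -> Prop).
Local Notation code := (code sep).

(** [rel] blurred to level [k], where only the cells of the two sticks are visible. [closed_rel]
    asks that a pair related at every level be related. *)
Definition rel_at rel (k : nat) (s t : T) := exists r q, [/\ code k r = code k s, code k q = code k t & rel r q].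
Definition set_at st (k : nat) (s : T) := exists2 r, code k r = code k s & st r.
Definition closed_rel rel := forall s t, (forall k, rel_at rel k s t) -> rel s t.
Definition closed_stick st := forall s, (forall k, set_at st k s) -> st s.

Lemma code_le k l s t : (k <= l)%N -> code l s = code l t -> code k s = code k t.
Proof.
move=> kl /(congr1 (take k)); rewrite /code -!map_take take_iota.
by rewrite (minn_idPl kl).
Qed.

Lemma rel_at_le rel k l s t : (k <= l)%N -> rel_at rel l s t -> rel_at rel k s t.
Proof. by move=> kl [r [q [h1 h2 h3]]]; exists r, q; split => //; exact: code_le kl _. Qed.

Lemma set_at_le st k l s : (k <= l)%N -> set_at st l s -> set_at st k s.
Proof. by move=> kl [r h1 h3]; exists r => //; exact: code_le kl _. Qed.

Lemma finite_eventually Y (A : nat -> T -> Prop) : finite_set Y ->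
  (forall s, Y s -> exists k, forall l, (k <= l)%N -> A l s) ->
  exists k, forall l, (k <= l)%N -> forall s, Y s -> A l s.
Proof.
move=> fY h.
have /choice[g hg] : forall s, exists k, Y s -> forall l, (k <= l)%N -> A l s.
  move=> s; have [Ys|nYs] := pselect (Y s); last by exists 0%N.
  by have [k hk] := h s Ys; exists k.
have fg : finite_set (g @` Y) by exact: finite_image.
exists (\max_(i <- fset_set (g @` Y)) i)%N => l gl s Ys; apply: (hg s Ys).
apply: leq_trans gl; apply: leq_bigmax_seq => //.
by rewrite in_fset_set//; apply: mem_set; exists s.
Qed.

Lemma reach_level rel st k Y Z s : (forall s, Y s -> exists2 r, Z r & code k r = code k s) ->
  reach Y (rel_at rel k) (set_at st k) s ->
  forall r, Z r -> code k r = code k s -> reach Z (rel_at rel k) (set_at st k) r.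
Proof.
move=> YZ; elim=> [x Yx [q qx sq] r Zr rx|x y rx IH [p [q [px qy pq]]] Yy r Zr ry].
  by apply: reach_start => //; exists q => //; rewrite qx rx.
have [r' Zr' r'x] := YZ _ (reach_in rx).
apply: reach_step (IH _ Zr' r'x) _ Zr; exists p, q; split => //; first by rewrite px r'x.
by rewrite qy ry.
Qed.

Lemma chain_level rel st en k :
  at_level sep k (chain (rel_at rel k) (set_at st k) (set_at en k)).
Proof.
move=> Y Z YZ [s rs [q qs eq]]; have [r Zr rs'] := YZ _ (reach_in rs).
exists r; first exact: reach_level YZ rs _ Zr rs'.
by exists q => //; rewrite qs rs'.
Qed.

(** In a finite configuration there are finitely many sticks and pairs, so from some level on the
    blurred conditions agree with the exact ones and a blurred chain is a chain. *)
Lemma chain_regular rel st en : closed_rel rel -> closed_stick st -> closed_stick en ->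
  regular sep (chain rel st en).
Proof.
move=> crel cst cen; exists (fun k => chain (rel_at rel k) (set_at st k) (set_at en k)).
split.
- exact: chain_level.
- move=> k Y; apply: chain_mono => //.
  + by move=> s t _ _; exact: rel_at_le.
  + by move=> s _; exact: set_at_le.
  + by move=> s _; exact: set_at_le.
- move=> Y fY; split=> [h k|h].
    by apply: chain_mono h => // [s t _ _ st'|s _ ss|s _ ss]; [exists s, t|exists s|exists s].
  have ev_set u : closed_stick u -> exists k, forall l, (k <= l)%N ->
      forall s, Y s -> set_at u l s -> u s.
    move=> cu; apply: (finite_eventually (A := fun l s => set_at u l s -> u s)) => // s Ys.
    have [us|nus] := pselect (u s); first by exists 0%N.
    have /existsNP[k hk] : ~ forall k, set_at u k s by move=> /cu.
    by exists k => l kl /(set_at_le kl).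
  have [k1 h1] := ev_set _ cst; have [k2 h2] := ev_set _ cen.
  have [k3 h3] : exists k, forall l, (k <= l)%N ->
      forall s, Y s -> forall t, Y t -> rel_at rel l s t -> rel s t.
    apply: (finite_eventually (A := fun l s => forall t, Y t -> rel_at rel l s t -> rel s t)) => // s Ys.
    apply: (finite_eventually (A := fun l t => rel_at rel l s t -> rel s t)) => // t Yt.
    have [rst|nrst] := pselect (rel s t); first by exists 0%N.
    have /existsNP[k hk] : ~ forall k, rel_at rel k s t by move=> /crel.
    by exists k => l kl /(rel_at_le kl).
  pose k := maxn k1 (maxn k2 k3); apply: chain_mono (h k) => //.
  + by move=> s t Ys Yt; apply: h3 => //; rewrite /k !leq_max leqnn !orbT.
  + by move=> s Ys; apply: h1 => //; rewrite /k !leq_max leqnn.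
  + by move=> s Ys; apply: h2 => //; rewrite /k !leq_max leqnn !orbT.
- by move=> Y Z YZ; exact: chain_mono.
- exact: chain_finitary.
Qed.

End ChainRegular.

(** * Cells of the stick space and closed conditions on sticks *)

Section StickCells.
Context {R : realType}.
Implicit Types (s r : stick R) (K : set (R * R)).

Definition coord (i : nat) s : R :=
  match i with 0%N => s.1.1.1 | 1%N => s.1.1.2 | 2%N => s.1.2 | _ => s.2 end.

(** Each test compares one coordinate with one rational, the pairs being enumerated by
    [choice.unpickle]; the resulting cells shrink to points, as [code_coord] shows. *)
Definition stick_sep (j : nat) s : bool :=
  if choice.unpickle j is Some (i, q) then coord i s < ratr (q : rat) else false.

Lemma measurable_stick_sep j : measurable [set s | stick_sep j s].
Proof.
rewrite /stick_sep; case: choice.unpickle => [[i q]|]; last first.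
  by rewrite (_ : [set s | _] = set0)//; apply/seteqP; split.
have mc : measurable_fun setT (coord i : stick R -> measurableTypeR R).
  case: i => [|[|[|i]]]; [exact: measurable_centre1|exact: measurable_centre2|
    exact: measurable_radius|exact: measurable_angle].
have -> : [set s | coord i s < ratr q] = setT `&` coord i @^-1` `]-oo, (ratr q)[%classic.
  by rewrite setTI; apply/seteqP; split => s /=; rewrite in_itv.
by apply: mc => //; exact: measurable_itv.
Qed.

Local Notation code := (code stick_sep).

Lemma code_coord s i (e : R) : 0 < e ->
  exists k, forall l r, (k <= l)%N -> code l r = code l s -> `|coord i r - coord i s| < e.
Proof.
move=> e0.
have [q q1] := rat_in_itvoo (ltac:(lra) : coord i s - e < coord i s).
have [q' q1'] := rat_in_itvoo (ltac:(lra) : coord i s < coord i s + e).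
move: q1 q1'; rewrite !in_itv/= => /andP[q1 q2] /andP[q1' q2'].
pose j := choice.pickle (i, q); pose j' := choice.pickle (i, q').
exists (maxn j j').+1 => l r jl rs.
have sep n : (n < l)%N -> stick_sep n r = stick_sep n s.
  move=> nl; have := congr1 (fun b => nth false b n) rs.
  by rewrite /code !(nth_map 0%N) ?size_iota// nth_iota.
have := sep j (leq_trans (leq_maxl _ _ : (j < (maxn j j').+1)%N) jl).
have := sep j' (leq_trans (leq_maxr _ _ : (j' < (maxn j j').+1)%N) jl).
rewrite /stick_sep !choice.pickleK q1' => h1.
by rewrite [X in _ = X]ltNge (ltW q2)/= => /negbT; rewrite -leNgt => h2; rewrite ltr_norml; lra.
Qed.

Definition point s (a : R) : R * R :=
  (s.1.1.1 + a * s.1.2 * cos s.2, s.1.1.2 + a * s.1.2 * sin s.2).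

Lemma point_segment s x : stick_segment s x <-> exists2 a, -1 <= a <= 1 & x = point s a.
Proof. exact: stick_segmentP. Qed.

Definition cell_filter s : set_system (stick R) :=
  filter_from setT (fun k => [set r | code k r = code k s]).

#[local] Instance cell_filter_filter s : Filter (cell_filter s).
Proof.
apply: filter_from_filter; first by exists 0%N.
move=> i j _ _; exists (maxn i j) => // r /= h; split.
  by apply: code_le h; exact: leq_maxl.
by apply: code_le h; exact: leq_maxr.
Qed.

Lemma cvg_coord s i : coord i r @[r --> cell_filter s] --> coord i s.
Proof.
apply/cvgrPdist_lt => e e0; have [k hk] := code_coord s i e0.
by exists k => // r /= h; rewrite distrC; exact: hk h.
Qed.

Lemma cvg_point s (a : R) :
  point x.2 x.1 @[x --> (nbhs a, cell_filter s)] --> point s a.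
Proof.
have c i : coord i x.2 @[x --> (nbhs a, cell_filter s)] --> coord i s.
  by apply: cvg_comp; [exact: cvg_snd|exact: cvg_coord].
have ca : x.1 @[x --> (nbhs a, cell_filter s)] --> a by exact: cvg_fst.
have cc : cos (coord 3 x.2) @[x --> (nbhs a, cell_filter s)] --> cos (coord 3 s).
  by apply: continuous_cvg; [exact: continuous_cos|exact: c].
have cs : sin (coord 3 x.2) @[x --> (nbhs a, cell_filter s)] --> sin (coord 3 s).
  by apply: continuous_cvg; [exact: continuous_sin|exact: c].
have h1 : coord 0 x.2 + x.1 * coord 2 x.2 * cos (coord 3 x.2)
    @[x --> (nbhs a, cell_filter s)] --> coord 0 s + a * coord 2 s * cos (coord 3 s).
  by apply: cvgD; [exact: c|apply: cvgM => //; apply: cvgM => //; exact: c].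
have h2 : coord 1 x.2 + x.1 * coord 2 x.2 * sin (coord 3 x.2)
    @[x --> (nbhs a, cell_filter s)] --> coord 1 s + a * coord 2 s * sin (coord 3 s).
  by apply: cvgD; [exact: c|apply: cvgM => //; apply: cvgM => //; exact: c].
exact: (cvg_pair h1 h2).
Qed.

Definition meet_in K s t := exists p, [/\ stick_segment s p, stick_segment t p & K p].

(** Compactness of the parameter square: if [s] and [t] do not meet in [K], then near each pair of
    parameters, and for sticks in small enough cells, the two points still differ or lie outside
    [K]. Finitely many neighbourhoods yield one level for the whole square, which contradicts [h] at
    that level. *)
Lemma closed_meet_in K : closed K -> closed_rel stick_sep (meet_in K).
Proof.
move=> cK s t h; apply: contrapT => nmeet.
pose F : set_system (stick R * stick R) := filter_prod (cell_filter s) (cell_filter t).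
have FF : Filter F by exact: filter_prod_filter.
pose I : set R := `[-1, 1]%classic.
have cI : compact (I `*` I) by apply: compact_setX; exact: segment_compact.
pose bad (x : stick R * stick R) (b : R * R) :=
  ~ (point x.1 b.1 = point x.2 b.2 /\ K (point x.1 b.1)).
have nb : forall b, (I `*` I) b -> \forall b' \near b & x \near F, bad x b'.
  move=> [a b] [/= Ia Ib].
  pose C : set ((R * R) * (R * R)) := [set y | y.1 = y.2 /\ K y.1].
  have cC : closed C.
    apply: closedI; last by apply: closed_comp cK => x _; exact: cvg_fst.
    have -> : (fun y : (R * R) * (R * R) => y.1 = y.2) =
        (fun y : (R * R) * (R * R) => y.1 - y.2) @^-1` [set 0].
      apply/seteqP; split => y /=; first by move=> ->; rewrite subrr.
      by move=> /eqP; rewrite subr_eq0 => /eqP.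
    apply: closed_comp; last exact/accessible_closed_set1/hausdorff_accessible/norm_hausdorff.
    by move=> x _; apply: cvgB; [exact: cvg_fst|exact: cvg_snd].
  have nC : (~` C) (point s a, point t b).
    move=> [/= e Ke]; apply: nmeet; exists (point s a); split => //.
      by apply/point_segment; exists a => //; move: Ia; rewrite /I /= in_itv.
    by apply/point_segment; exists b => //; move: Ib; rewrite /I /= in_itv.
  have oC : nbhs (point s a, point t b) (~` C).
    by apply: open_nbhs_nbhs; split => //; exact: closed_openC.
  have cvg1 : (point x.2.1 x.1.1, point x.2.2 x.1.2) @[x --> (nbhs (a, b), F)] -->
      (point s a, point t b).
    have f1 : x.1 @[x --> (nbhs (a, b), F)] --> nbhs (a, b) by exact: cvg_fst.
    have f2 : x.2 @[x --> (nbhs (a, b), F)] --> F by exact: cvg_snd.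
    have fa : x.1.1 @[x --> (nbhs (a, b), F)] --> nbhs a by exact: (cvg_comp _ _ f1 cvg_fst).
    have fb : x.1.2 @[x --> (nbhs (a, b), F)] --> nbhs b by exact: (cvg_comp _ _ f1 cvg_snd).
    have fs : x.2.1 @[x --> (nbhs (a, b), F)] --> cell_filter s.
      by exact: (cvg_comp _ _ f2 cvg_fst).
    have ft : x.2.2 @[x --> (nbhs (a, b), F)] --> cell_filter t.
      by exact: (cvg_comp _ _ f2 cvg_snd).
    have h1 : point x.2.1 x.1.1 @[x --> (nbhs (a, b), F)] --> point s a.
      by exact: (cvg_comp _ _ (cvg_pair fa fs) (@cvg_point s a)).
    have h2 : point x.2.2 x.1.2 @[x --> (nbhs (a, b), F)] --> point t b.
      by exact: (cvg_comp _ _ (cvg_pair fb ft) (@cvg_point t b)).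
    exact: (cvg_pair h1 h2).
  exact: (cvg1 _ oC).
have [[U V] /= [[k _ kU] [l _ lV]] UV] := (compact_near_coveringP _).1 cI _ F _ FF nb.
have [r [q [rs qt [p [/point_segment[a a1 pa] /point_segment[b b1 pb] Kp]]]]] := h (maxn k l).
have Ur : U r by apply: kU; apply: code_le rs; exact: leq_maxl.
have Vq : V q by apply: lV; apply: code_le qt; exact: leq_maxr.
have := UV (r, q) (conj Ur Vq) (a, b); apply.
  by split; rewrite /I /= in_itv.
by rewrite /= -pa -pb.
Qed.

Lemma closed_hits K : closed K -> closed_stick stick_sep (fun s => stick_segment s `&` K !=set0).
Proof.
move=> cK s h; have [|p [sp _ Kp]] := @closed_meet_in K cK s s; last by exists p.
move=> k; have [r rs [p [rp Kp]]] := h k.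
by exists r, r; split => //; exists p.
Qed.

Lemma closed_false : closed_rel stick_sep (fun _ _ => False).
Proof. by move=> s t /(_ 0%N)[r [q []]]. Qed.

(** The set is an intersection over the levels of unions of cells, finitely many at each level. *)
Lemma measurable_closed_stick (A : stick R -> Prop) : closed_stick stick_sep A ->
  measurable [set s | A s].
Proof.
move=> cA; have -> : [set s | A s] = \bigcap_k [set s | set_at stick_sep A k s].
  by apply/seteqP; split => s h; [move=> k _; exists s|apply: cA => k; exact: h].
apply: bigcap_measurableType => k _.
have -> : [set s | set_at stick_sep A k s] =
    \bigcup_(c in [set c | c \in codes k /\ exists2 r, code k r = c & A r])
      [set s | code k s = c].
  apply/seteqP; split => s.
    by move=> [r rs Ar]; exists (code k s) => //; split; [exact: code_in|exists r].
  by move=> [c [_ [r rc Ar]] /= sc]; exists r => //; rewrite rc sc.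
apply: fin_bigcup_measurable; last by move=> c _; exact: (measurable_code measurable_stick_sep).
by apply: (@sub_finite_set _ _ [set` codes k]); [move=> c []|exact: finite_seq].
Qed.

End StickCells.

(** * Almost sure properties of the soup *)

Section Windows.
Context {R : realType}.

Definition square (m : nat) : set (measurableTypeR R) := `[(- m.+1%:R)%R, m.+1%:R%R]%classic.
Definition radii (m : nat) : set (measurableTypeR R) := `[m.+1%:R^-1%R, m.+1%:R%R]%classic.
(** Half-lengths are kept away from 0 as well, where the intensity is infinite. The set [D] of
    angles is a parameter in order to single out vertical or nearly parallel sticks. *)
Definition window (m : nat) (D : set (measurableTypeR R)) : set (stick R) :=
  square m `*` square m `*` radii m `*` D.

Let measurable_square m : measurable (square m). Proof. exact: measurable_itv. Qed.
Let measurable_radii m : measurable (radii m). Proof. exact: measurable_itv. Qed.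

Lemma measurable_window m D : measurable D -> measurable (window m D).
Proof.
move=> mD; apply: measurableX => //; apply: measurableX => //.
by apply: measurableX.
Qed.

Let size_window m : \bar R := (lebesgue_measure (square m) * lebesgue_measure (square m) *
  radius_measure (radii m))%E.

Let inv_le m : m.+1%:R^-1 <= m.+1%:R :> R.
Proof. by apply: (@le_trans _ _ 1); [rewrite invf_le1 ?ler1n|rewrite ler1n]. Qed.

Let size_window_ge0 m : (0 <= size_window m)%E.
Proof. by rewrite /size_window !mule_ge0. Qed.

Let size_window_lty m : (size_window m < +oo)%E.
Proof.
have sq : lebesgue_measure (square m) \is a fin_num.
  rewrite ge0_fin_numE// /square lebesgue_measure_itv/=; case: ifPn => _; rewrite ?ltry//.
have rad : radius_measure (radii m) \is a fin_num.
  rewrite ge0_fin_numE//; apply: le_lt_trans (radius_measure_itv _ (inv_le m)) _.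
    by rewrite invr_gt0.
  by rewrite ltry.
by rewrite -ge0_fin_numE// /size_window !fin_numM.
Qed.

Lemma window_intensity m D : measurable D ->
  (stick_intensity (window m D) = size_window m * angle_measure D)%E.
Proof. by move=> mD; rewrite /window stick_intensityX. Qed.

Lemma window_inc m D : window m D `<=` window m.+1 D.
Proof.
move=> [[[x y] r] v] [[[/= hx hy] hr] hv]; split => //=.
have mm : m.+1%:R <= m.+2%:R :> R by rewrite ler_nat.
have mi : m.+2%:R^-1 <= m.+1%:R^-1 :> R by rewrite lef_pV2 ?posrE.
move: hx hy hr; rewrite /square /radii /= !in_itv/= => /andP[x1 x2] /andP[y1 y2] /andP[r1 r2].
split; [split|]; apply/andP; split.
- by apply: le_trans x1; rewrite lerN2.
- exact: le_trans x2 mm.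
- by apply: le_trans y1; rewrite lerN2.
- exact: le_trans y2 mm.
- exact: le_trans mi r1.
- exact: le_trans r2 mm.
Qed.

Lemma window_cover (s : stick R) : stick_space R s -> exists m, window m setT s.
Proof.
case: s => [[[x y] r] v] [/= r0 _].
pose f (z : R) := Num.truncn `|z|.
have fE z : `|z| <= (f z).+1%:R by exact/ltW/truncnS_gt.
pose m := maxn (maxn (f x) (f y)) (maxn (f r) (f r^-1)).
have le z : (f z <= m)%N -> `|z| <= m.+1%:R.
  by move=> zm; apply: le_trans (fE z) _; rewrite ler_nat ltnS.
have hx : `|x| <= m.+1%:R by apply: le; rewrite /m !leq_max leqnn.
have hy : `|y| <= m.+1%:R by apply: le; rewrite /m !leq_max leqnn orbT.
have hr : `|r| <= m.+1%:R by apply: le; rewrite /m !leq_max leqnn !orbT.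
have hr' : `|r^-1| <= m.+1%:R by apply: le; rewrite /m !leq_max leqnn !orbT.
exists m; split => //=; split; first by split; rewrite /square /= in_itv/= -ler_norml.
rewrite /radii /= in_itv/=; apply/andP; split; last by move: hr; rewrite ger0_norm// ltW.
by rewrite -[leRHS]invrK lef_pV2 ?posrE ?invr_gt0//; move: hr'; rewrite ger0_norm// invr_ge0 ltW.
Qed.

Context {d : measure_display} {Omega : measurableType d}.
Variables (u : R) (P : probability Omega R) (xi : Omega -> set (stick R)).
Hypothesis u0 : 0 < u.
Hypothesis ips : is_ips u P xi.

Let nu (A : set (stick R)) : \bar R := (u%:E * stick_intensity A)%E.
Let pois : is_poisson_process P nu xi := ips.2.

Lemma intensity_ge0 A : (0 <= nu A)%E.
Proof.
apply: mule_ge0; first by rewrite lee_fin ltW.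
exact: (measure_ge0 (@stick_measure R)).
Qed.

Lemma bigcup_null (N : nat -> set Omega) : (forall k, measurable (N k)) ->
  (forall k, P (N k) = 0%E) -> measurable (\bigcup_k N k) /\ P (\bigcup_k N k) = 0%E.
Proof.
move=> mN N0; have mU : measurable (\bigcup_k N k) by exact: bigcup_measurable.
split => //; apply: measure_negligible => //; apply: negligible_bigcup => k.
by exists (N k); split => //; exact: N0.
Qed.

Lemma ips_locally_finite : exists N : set Omega, [/\ measurable N, P N = 0%E &
  forall w m, ~ N w -> finite_set (xi w `&` window m setT)].
Proof.
have h m : exists N : set Omega, [/\ measurable N, P N = 0%E &
    forall w, ~ N w -> finite_set (xi w `&` window m setT)].
  apply: (points_finite pois); first exact: measurable_window.
  rewrite /nu window_intensity//; apply: lte_mul_pinfty => //; first by rewrite lee_fin ltW.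
  apply: le_lt_trans (size_window_lty m); rewrite -[leRHS]mule1.
  by apply: lee_wpmul2l => //; exact: angle_measureT.
have [N hN] := choice h.
have [mU PU] := @bigcup_null N (fun k => let: And3 a _ _ := hN k in a)
  (fun k => let: And3 _ b _ := hN k in b).
exists (\bigcup_k N k); split => // w m Nw.
by have [_ _] := hN m; apply => Nm; apply: Nw; exists m.
Qed.

Let window_nu_le m D (c : R) : measurable D -> (angle_measure D <= c%:E)%E ->
  (nu (window m D) <= (u * fine (size_window m) * c)%:E)%E.
Proof.
move=> mD Dc; rewrite /nu window_intensity// -mulrA EFinM; apply: lee_wpmul2l.
  by rewrite lee_fin ltW.
rewrite EFinM fineK; last by rewrite ge0_fin_numE.
exact: lee_wpmul2l.
Qed.

Lemma ips_no_vertical : exists N : set Omega, [/\ measurable N, P N = 0%E &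
  forall w s, ~ N w -> xi w s -> s.2 != pi / 2].
Proof.
pose V : set (measurableTypeR R) := [set pi / 2].
have mV : measurable V by exact: measurable_set1.
pose N m := hit xi (window m V).
have mN m : measurable (N m).
  by apply: (measurable_hit pois); exact: measurable_window.
have N0 m : P (N m) = 0%E.
  apply/eqP; rewrite eq_le measure_ge0 andbT.
  apply: (hit_le pois) (intensity_ge0 _) _; first exact: measurable_window.
  apply: (le_trans (@window_nu_le m V 0 mV _)); last by rewrite mulr0.
  apply: (le_trans (angle_measure_le mV)); rewrite lebesgue_measure_set1 mule0.
  by [].
have [mU PU] := bigcup_null mN N0.
exists (\bigcup_m N m); split => // w s Nw xs; apply/eqP => sv; apply: Nw.
have [m [h1 _]] := window_cover (ips.1 w _ xs).
by exists m => //; exists s; split => //; split.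
Qed.

(** For [i < n.+1] these cover [[-2, 2]], which contains every angle because [pi / 2 < 2]. *)
Let cell (n i : nat) : set (measurableTypeR R) :=
  `[(- 2 + 4 * i%:R / n.+1%:R)%R, (- 2 + 4 * i.+1%:R / n.+1%:R)%R]%classic.

Let cell_cover n v : angle_range v -> exists2 i, (i < n.+1)%N & cell n i v.
Proof.
rewrite /angle_range /= in_itv/= => /andP[v1 v2].
have [/andP[_ p2] _] := @pihalf_02_cos_pihalf R.
have n0 : 0 < n.+1%:R :> R by [].
pose x := (v + 2) * n.+1%:R / 4.
have x0 : 0 <= x by rewrite /x divr_ge0// mulr_ge0//; lra.
have [h1 h2] : (Num.truncn x)%:R <= x /\ x < (Num.truncn x).+1%:R.
  by have /andP[] := truncn_itv x0.
have vE : v = - 2 + 4 * x / n.+1%:R by rewrite /x; field; rewrite gt_eqF.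
exists (minn (Num.truncn x) n); first by rewrite ltnS geq_minr.
rewrite /cell /= in_itv/=.
have [xn|nx] := leqP (Num.truncn x) n.
  by rewrite vE !lerD2l !ler_pM2r ?invr_gt0// !ler_pM2l// h1 ltW.
have xn : x <= n.+1%:R by rewrite /x ler_pdivrMr// mulrC ler_pM2l//; lra.
rewrite vE !lerD2l !ler_pM2r ?invr_gt0// !ler_pM2l// xn andbT.
by apply: le_trans h1; rewrite ler_nat ltnW.
Qed.

Let cell_angle n i : (angle_measure (cell n i) <= (4 / n.+1%:R)%:E)%E.
Proof.
have n0 : 0 < n.+1%:R :> R by [].
have mc : measurable (cell n i) by exact: measurable_itv.
apply: (le_trans (angle_measure_le mc)).
rewrite /cell lebesgue_measure_itv/=; case: ifPn => _; last first.
  by rewrite mule0 lee_fin divr_ge0.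
rewrite -EFinB -EFinM lee_fin.
have -> : - 2 + 4 * i.+1%:R / n.+1%:R - (- 2 + 4 * i%:R / n.+1%:R) = 4 / n.+1%:R :> R.
  by rewrite -[i.+1]addn1 natrD; ring.
rewrite ler_piMl ?divr_ge0// invf_le1 ?pi_gt0//.
by have := @pi_ge2 R; lra.
Qed.

(** Two sticks of a window with equal angles share a cell for every [n]. A given cell holds two
    sticks with probability at most [(K m * (4 / n.+1%:R)) ^+ 2], so some cell does with probability
    at most [16 * K m ^+ 2 / n.+1%:R], which tends to 0. *)
Lemma ips_distinct_angles : exists N : set Omega, [/\ measurable N, P N = 0%E &
  forall w s t, ~ N w -> xi w s -> xi w t -> s.2 = t.2 -> s = t].
Proof.
have mc n i : measurable (cell n i) by exact: measurable_itv.
pose K m := u * fine (size_window m).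
have K0 m : 0 <= K m.
  by apply: mulr_ge0; [exact: ltW|exact: fine_ge0 (size_window_ge0 m)].
have h m n i := double_le pois (measurable_window m (mc n i)) (intensity_ge0 _)
  (window_nu_le m (mc n i) (cell_angle n i)).
have /choice[D hD] : forall x : nat * nat * nat, exists D : set Omega, [/\ measurable D,
    (P D <= ((K x.1.1 * (4 / x.1.2.+1%:R)) ^+ 2)%:E)%E &
    forall w s t, s <> t -> (xi w `&` window x.1.1 (cell x.1.2 x.2)) s ->
      (xi w `&` window x.1.1 (cell x.1.2 x.2)) t -> D w].
  by move=> [[m n] i]; exact: h.
pose E m n := \big[setU/set0]_(i < n.+1) D (m, n, nat_of_ord i).
have mE m n : measurable (E m n).
  by apply: bigsetU_measurable => i _; have [] := hD (m, n, nat_of_ord i).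
pose N m := \bigcap_n E m n.
have mN m : measurable (N m) by exact: bigcap_measurableType.
have N0 m : P (N m) = 0%E.
  apply/eqP; rewrite eq_le measure_ge0 andbT; apply/lee_addgt0Pr => e e0.
  rewrite add0e.
  pose n := Num.truncn (16 * (K m) ^+ 2 / e).
  apply: (@le_trans _ _ (P (E m n))).
    by apply: le_measure; [exact: mem_set|exact: mem_set|move=> w; exact].
  apply: (@le_trans _ _ (\sum_(i < n.+1) P (D (m, n, nat_of_ord i)))%E).
    apply: (content_subadditive P (F := fun i => D (m, n, i))) => //.
    by move=> i _; have [] := hD (m, n, i).
  apply: (@le_trans _ _ (\sum_(i < n.+1) ((K m * (4 / n.+1%:R)) ^+ 2)%:E)%E).
    by apply: lee_sum => i _; have [] := hD (m, n, nat_of_ord i).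
  rewrite sumEFin lee_fin sumr_const card_ord -[X in X <= _]mulr_natr.
  have n0 : 0 < n.+1%:R :> R by [].
  have -> : (K m * (4 / n.+1%:R)) ^+ 2 * n.+1%:R = 16 * K m ^+ 2 / n.+1%:R.
    by field; rewrite gt_eqF.
  rewrite ler_pdivrMr// [e * _]mulrC; apply/ltW; rewrite -ltr_pdivrMr//.
  exact: truncnS_gt.
have [mU PU] := bigcup_null mN N0.
exists (\bigcup_m N m); split => // w s t Nw xs xt st; apply: contrapT => nst; apply: Nw.
have [m1 h1] := window_cover (ips.1 w _ xs).
have [m2 h2] := window_cover (ips.1 w _ xt).
have inc i j : (i <= j)%N -> window i setT `<=` window j setT.
  by elim: j => [|j IH]; [rewrite leqn0 => /eqP->|
    rewrite leq_eqVlt => /predU1P[->//|ij] x /(IH ij) /window_inc].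
pose m := maxn m1 m2.
have {h1}h1 : window m setT s by apply: inc h1; exact: leq_maxl.
have {h2}h2 : window m setT t by apply: inc h2; exact: leq_maxr.
exists m => // n _.
have [i il ci] := cell_cover n (ips.1 w _ xs).2.
rewrite /E -(bigcup_mkord n.+1 (fun i => D (m, n, i))); exists i => //.
have [_ _ hd] := hD (m, n, i); apply: (hd w s t nst); split => //.
  by case: h1 => h1 _; split.
by case: h2 => h2 _; split => //; rewrite -st.
Qed.

End Windows.

(** * Walks along sticks *)

Section Connections.
Context {R : realType}.
Implicit Types (Y : set (stick R)) (K : set (R * R)) (x y z : R * R) (s : stick R).

(** Only the end and turning points of the walk are required to lie in [K]; for convex [K] the
    pieces in between follow. Unlike [chain], this form keeps the contact points and can be cut in
    the middle of a stick. *)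
Inductive conn Y K x : R * R -> Prop :=
| conn_refl : K x -> conn Y K x x
| conn_step y z s : conn Y K x y -> Y s -> stick_segment s y -> stick_segment s z ->
    K z -> conn Y K x z.

Lemma conn_in_l Y K x y : conn Y K x y -> K x.
Proof. by elim. Qed.

Lemma conn_in_r Y K x y : conn Y K x y -> K y.
Proof. by case. Qed.

Lemma conn_trans Y K x y z : conn Y K x y -> conn Y K y z -> conn Y K x z.
Proof.
move=> xy; elim=> // y' z' s _ IH Ys sy sz Kz; exact: conn_step IH Ys sy sz Kz.
Qed.

Lemma conn_sym Y K x y : conn Y K x y -> conn Y K y x.
Proof.
elim=> [|y' z s xy IH Ys sy sz Kz]; first exact: conn_refl.
apply: conn_trans IH; apply: conn_step (conn_refl _ Kz) Ys sz sy _.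
exact: conn_in_r xy.
Qed.

Lemma conn_mono Y Y' K K' x y : Y `<=` Y' -> K `<=` K' -> conn Y K x y -> conn Y' K' x y.
Proof.
move=> YY KK; elim=> [Kx|y' z s _ IH Ys sy sz Kz]; first by apply: conn_refl; exact: KK.
by apply: conn_step IH (YY _ Ys) sy sz (KK _ Kz).
Qed.

Definition convex_set K := forall x y (t : R), 0 <= t <= 1 -> K x -> K y ->
  K (x + t *: (y - x)).

Lemma convex_stick s : convex_set (stick_segment s).
Proof.
move=> x y t t01 /point_segment[a a1 ->] /point_segment[b b1 ->].
apply/point_segment; exists (a + t * (b - a)).
  have /andP[t0 t1] := t01; have := andP a1; have := andP b1 => -[b2 b3] [a2 a3].
  by apply/andP; split; nra.
by congr pair; rewrite /= !scaleRE; ring.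
Qed.

Lemma level_point (phi : R * R -> R) (c : R) x y : continuous phi -> phi x <= c <= phi y ->
  exists2 t, 0 <= t <= 1 & phi (x + t *: (y - x)) = c.
Proof.
move=> cphi /andP[h1 h2].
pose g (t : R) := phi (x + t *: (y - x)).
have cg : {within `[0, 1], continuous g}.
  apply: continuous_subspaceT => t; apply: continuous_comp; last exact: cphi.
  by apply: cvgD; [exact: cvg_cst|apply: cvgZr_tmp; exact: cvg_id].
have g0 : g 0 = phi x by rewrite /g scale0r addr0.
have g1 : g 1 = phi y by rewrite /g scale1r addrC subrK.
have [|t + gt] := @IVT R g 0 1 c ler01 cg.
  by rewrite g0 g1 ge_min h1 le_max h2 orbT.
by rewrite in_itv/=; exists t.
Qed.

(** The walk is followed up to the first piece whose target has [phi] above [c]. By the intermediate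
    value theorem this piece contains a point of level [c], which convexity keeps in the stick and
    in [K]. *)
Lemma conn_truncate Y K (phi : R * R -> R) (c : R) x y :
  convex_set K -> continuous phi -> phi x <= c -> conn Y K x y ->
  conn Y (K `&` [set p | phi p <= c]) x y \/
  exists2 z, conn Y (K `&` [set p | phi p <= c]) x z & phi z = c.
Proof.
move=> cK cphi xc; elim=> [Kx|y' z s xy IH Ys sy sz Kz]; first by left; exact: conn_refl.
case: IH => [h|]; last by right.
have [zc|cz] := leP (phi z) c; first by left; apply: (conn_step h Ys sy sz).
have [Ky yc] := conn_in_r h.
have [t t01 pt] := @level_point phi c y' z cphi (introT andP (conj yc (ltW cz))).
right; exists (y' + t *: (z - y')) => //.
apply: (conn_step h Ys sy); first exact: convex_stick.
by split; [exact: cK|rewrite /= pt].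
Qed.

Lemma chain_of_conn Y K (B C : set (R * R)) x y : conn Y K x y -> B x -> C y ->
  x = y \/ chain (meet_in K) (fun s => stick_segment s `&` (K `&` B) !=set0)
    (fun s => stick_segment s `&` (K `&` C) !=set0) Y.
Proof.
move=> xy Bx Cy.
have [->|[s [rs sy Ky]]] : x = y \/ exists s, [/\ reach Y (meet_in K)
    (fun s => stick_segment s `&` (K `&` B) !=set0) s, stick_segment s y & K y].
- elim: xy {Cy} => [|y' z s xy' IH Ys sy sz Kz]; first by left.
  right; exists s; split => //; case: IH => [xE|[s' [rs' s'y Ky]]].
    apply: reach_start => //; exists x; split; first by rewrite xE.
    by split => //; exact: conn_in_l xy'.
  by apply: reach_step rs' _ Ys; exists y'; split.
- by left.
- by right; exists s => //; exists y.
Qed.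

Lemma conn_of_chain Y K (B C : set (R * R)) :
  chain (meet_in K) (fun s => stick_segment s `&` (K `&` B) !=set0)
    (fun s => stick_segment s `&` (K `&` C) !=set0) Y ->
  exists x y, [/\ conn Y K x y, B x & C y].
Proof.
move=> [s rs [y [sy [Ky Cy]]]].
have [x [Bx hx]] : exists x, B x /\ forall p, stick_segment s p -> K p -> conn Y K x p.
  elim: rs {sy} => [s' Ys [x [sx [Kx Bx]]]|s' t _ [x [Bx IH]] [q [sq tq Kq]] Yt].
    by exists x; split => // p sp Kp; apply: conn_step (conn_refl _ Kx) Ys sx sp Kp.
  by exists x; split => // p tp Kp; apply: conn_step (IH _ sq Kq) Yt tq tp Kp.
by exists x, y; split => //; exact: hx.
Qed.

Lemma conn_nat Y K x y : conn Y K x y -> x = y \/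
  exists (n : nat) (s : nat -> stick R) (p : nat -> R * R),
  [/\ forall i, (i <= n)%N -> [/\ Y (s i), stick_segment (s i) (p i) & stick_segment (s i) (p i.+1)],
      forall i, (i <= n.+1)%N -> K (p i), p 0%N = x & p n.+1 = y].
Proof.
elim=> [|y' z s xy IH Ys sy sz Kz]; first by left.
right; case: IH => [xE|[n [s' [p [h1 h2 h3 h4]]]]].
  exists 0%N, (fun=> s), (fun i => if i is 0%N then x else z); split => //.
    by case=> //= _; split => //; rewrite xE.
  by case=> [|[|]] //= _; exact: conn_in_l xy.
exists n.+1, (fun i => if (i <= n)%N then s' i else s),
  (fun i => if (i <= n.+1)%N then p i else z); split.
- move=> i hi; have [->|ni] : i = n.+1 \/ (i <= n)%N.
  + by move: hi; rewrite leq_eqVlt => /predU1P.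
  + by rewrite !ltnn leqnn h4; split.
  + by rewrite ni (leqW ni) ltnS ni; exact: h1.
- by move=> i _; case: ifPn => // /h2.
- by rewrite leq0n.
- by rewrite ltnn.
Qed.

Lemma norm_box (r : R) x : (`|x| <= r) = (`|x.1| <= r) && (`|x.2| <= r).
Proof. by rewrite prod_normE ge_max. Qed.

Lemma norm_out (r : R) x : (r <= `|x|) = (r <= `|x.1|) || (r <= `|x.2|).
Proof. by rewrite prod_normE le_max. Qed.

Lemma convex_box (r : R) : convex_set [set x | `|x| <= r].
Proof.
move=> x y t /andP[t0 t1] /= hx hy.
have -> : x + t *: (y - x) = (1 - t) *: x + t *: y.
  by rewrite scalerBr scalerBl scale1r addrCA addrC.
apply: (le_trans (ler_normD _ _)); rewrite !normrZ (ger0_norm t0) ger0_norm ?subr_ge0//.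
have := ler_wpM2l t0 hy; have t1' : 0 <= 1 - t by rewrite subr_ge0.
by have := ler_wpM2l t1' hx; lra.
Qed.

Definition arm_box (a b : R) : set (stick R) -> Prop :=
  chain (meet_in setT) (fun s => stick_segment s `&` [set x | `|x| <= a] !=set0)
    (fun s => stick_segment s `&` [set x | b <= `|x|] !=set0).

Definition rectY (l a b : R) : set (R * R) := [set x | `|x.1| <= 3 * l /\ a <= x.2 <= b].
Definition rectX (l a b : R) : set (R * R) := [set x | `|x.2| <= 3 * l /\ a <= x.1 <= b].

(* [rectY] and [rectX] are 6l long; the chains join their long sides. *)
Definition coverY (l a b : R) : set (stick R) -> Prop :=
  chain (meet_in (rectY l a b))
    (fun s => stick_segment s `&` (rectY l a b `&` [set x | x.2 <= a]) !=set0)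
    (fun s => stick_segment s `&` (rectY l a b `&` [set x | b <= x.2]) !=set0).
Definition coverX (l a b : R) : set (stick R) -> Prop :=
  chain (meet_in (rectX l a b))
    (fun s => stick_segment s `&` (rectX l a b `&` [set x | x.1 <= a]) !=set0)
    (fun s => stick_segment s `&` (rectX l a b `&` [set x | b <= x.1]) !=set0).

Lemma arm_box_conn a b Y : arm_box a b Y -> exists x y, [/\ conn Y setT x y, `|x| <= a & b <= `|y|].
Proof.
move=> h; have [|x [y [xy xa yb]]] := @conn_of_chain Y setT [set x | `|x| <= a] [set x | b <= `|x|].
  by apply: chain_mono h => // s _; rewrite setTI.
by exists x, y.
Qed.

(** The walk is cut at a first point [z] of norm [3 * l], where some signed coordinate equals
    [3 * l]. Going back from [z] until that coordinate has dropped to [l] crosses one of the four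
    rectangles that surround the box. *)
Lemma arm_box_cover (l b : R) Y : 0 < l -> 3 * l <= b -> arm_box l b Y ->
  (coverY l l (3 * l) Y \/ coverY l (- (3 * l)) (- l) Y) \/
  (coverX l l (3 * l) Y \/ coverX l (- (3 * l)) (- l) Y).
Proof.
move=> l0 lb /arm_box_conn[x [y [xy xl yb]]].
pose K0 : set (R * R) := [set p | `|p| <= 3 * l].
have [z xz z3] : exists2 z, conn Y K0 x z & `|z| = 3 * l.
  have xc : `|x| <= 3 * l by lra.
  have := @conn_truncate Y setT (fun p => `|p|) (3 * l) x y _ (@norm_continuous _ _) xc xy.
  rewrite setTI => -[//|h|//]; exists y => //.
  by apply/eqP; rewrite eq_le (conn_in_r h : `|y| <= _)/=; lra.
have zx := conn_sym xz.
have [x1 x2] : `|x.1| <= l /\ `|x.2| <= l by move: xl; rewrite norm_box => /andP.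
have cut (phi : R * R -> R) : continuous phi -> phi z = 3 * l -> phi x <= l ->
    exists2 x', conn Y (K0 `&` [set p | l <= phi p]) z x' & phi x' <= l.
  move=> cphi pz px.
  have cphi' : continuous (fun p => - phi p) by move=> p; apply: cvgN; exact: cphi.
  have zc : - phi z <= - l by lra.
  have := conn_truncate (@convex_box (3 * l)) cphi' zc zx.
  have -> : [set p | - phi p <= - l] = [set p | l <= phi p].
    by apply/seteqP; split => p /=; rewrite lerN2.
  by move=> [h|[x' h e]]; [exists x|exists x' => //; lra].
have c1 : continuous (fun p : R * R => p.1) by move=> p; exact: cvg_fst.
have c2 : continuous (fun p : R * R => p.2) by move=> p; exact: cvg_snd.
have [x1a x1b] : - l <= x.1 /\ x.1 <= l by move: x1; rewrite ler_norml => /andP.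
have [x2a x2b] : - l <= x.2 /\ x.2 <= l by move: x2; rewrite ler_norml => /andP.
have four : [\/ z.1 = 3 * l, - z.1 = 3 * l, z.2 = 3 * l | - z.2 = 3 * l].
  have : (`|z.1| == 3 * l) || (`|z.2| == 3 * l).
    move/eqP: z3; rewrite prod_normE /Num.max; case: ifP => _ ->; by rewrite ?orbT.
  case/orP => /eqP; [case: (ger0P z.1)|case: (ger0P z.2)] => _ h.
  - by apply: Or41.
  - by apply: Or42.
  - by apply: Or43.
  - by apply: Or44.
have boxE p : K0 p -> (- (3 * l) <= p.1 <= 3 * l) /\ (- (3 * l) <= p.2 <= 3 * l).
  by rewrite /K0 /= norm_box => /andP[]; rewrite !ler_norml.
have sub1 (K : set (R * R)) x' : (forall p, (K0 `&` [set p | l <= p.1]) p -> K p) ->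
    conn Y (K0 `&` [set p | l <= p.1]) z x' -> conn Y K z x'.
  by move=> KK; exact: conn_mono.
case: four => zE.
- have [x' zx' x'l] := cut _ c1 zE x1b; right; left.
  have zx'' : conn Y (rectX l l (3 * l)) z x'.
    apply: conn_mono zx' => // p [/boxE[/andP[? ?] /andP[? ?]] /= ?].
    by split; [rewrite ler_norml; apply/andP|apply/andP].
  have zl : 3 * l <= z.1 by rewrite zE.
  have [e|h] := @chain_of_conn Y (rectX l l (3 * l)) [set p | p.1 <= l] [set p | 3 * l <= p.1]
    _ _ (conn_sym zx'') x'l zl; last exact: h.
  by move: x'l; rewrite e zE; lra.
- have [|x' zx' x'l] := cut (fun p => - p.1) (fun p => cvgN (c1 p)) zE; first by rewrite lerNl.
  right; right.
  have zx'' : conn Y (rectX l (- (3 * l)) (- l)) z x'.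
    apply: conn_mono zx' => // p [/boxE[/andP[? ?] /andP[? ?]] /= ?].
    by split; [rewrite ler_norml; apply/andP|apply/andP; split; lra].
  have [||e|h] := @chain_of_conn Y (rectX l (- (3 * l)) (- l)) [set p | p.1 <= - (3 * l)]
    [set p | - l <= p.1] _ _ zx''.
  + by rewrite /=; lra.
  + by rewrite /=; lra.
  + by move: x'l; rewrite -e; lra.
  + exact: h.
- have [x' zx' x'l] := cut _ c2 zE x2b; left; left.
  have zx'' : conn Y (rectY l l (3 * l)) z x'.
    apply: conn_mono zx' => // p [/boxE[/andP[? ?] /andP[? ?]] /= ?].
    by split; [rewrite ler_norml; apply/andP|apply/andP].
  have zl : 3 * l <= z.2 by rewrite zE.
  have [e|h] := @chain_of_conn Y (rectY l l (3 * l)) [set p | p.2 <= l] [set p | 3 * l <= p.2]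
    _ _ (conn_sym zx'') x'l zl; last exact: h.
  by move: x'l; rewrite e zE; lra.
- have [|x' zx' x'l] := cut (fun p => - p.2) (fun p => cvgN (c2 p)) zE; first by rewrite lerNl.
  left; right.
  have zx'' : conn Y (rectY l (- (3 * l)) (- l)) z x'.
    apply: conn_mono zx' => // p [/boxE[/andP[? ?] /andP[? ?]] /= ?].
    by split; [rewrite ler_norml; apply/andP|apply/andP; split; lra].
  have [||e|h] := @chain_of_conn Y (rectY l (- (3 * l)) (- l)) [set p | p.2 <= - (3 * l)]
    [set p | - l <= p.2] _ _ zx''.
  + by rewrite /=; lra.
  + by rewrite /=; lra.
  + by move: x'l; rewrite -e; lra.
  + exact: h.
Qed.

End Connections.

Lemma chain_restrict (T : Type) (Y H : set T) (rel : T -> T -> Prop) (st en : T -> Prop) :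
  (forall s, st s -> H s) -> (forall s t, rel s t -> H t) ->
  chain rel st en Y -> chain rel st en (Y `&` H).
Proof.
move=> sH rH [s rs es]; exists s => //; elim: rs => [t Yt tt|t t' _ IH tt Yt].
  by apply: reach_start => //; split => //; exact: sH.
by apply: (reach_step IH tt); split => //; exact: rH tt.
Qed.

Section Deterministic.
Context {R : realType}.
Implicit Types (Y : set (stick R)) (K : set (R * R)) (x y z : R * R) (s : stick R).

Lemma closed_sublevel (phi : R * R -> R) (c : R) : continuous phi ->
  closed [set p | phi p <= c].
Proof.
by move=> cphi; apply: (closed_comp (f := phi)) (@closed_le R c) => p _; exact: cphi.
Qed.

Lemma continuous_fst : continuous (fun p : R * R => p.1). Proof. by move=> p; exact: cvg_fst. Qed.
Lemma continuous_snd : continuous (fun p : R * R => p.2). Proof. by move=> p; exact: cvg_snd. Qed.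

Lemma closed_box (r : R) : closed [set x : R * R | `|x| <= r].
Proof. by apply: closed_sublevel; exact: norm_continuous. Qed.

Lemma closed_out (r : R) : closed [set x : R * R | r <= `|x|].
Proof.
have -> : [set x : R * R | r <= `|x|] = [set x | - `|x| <= - r].
  by apply/seteqP; split => x /=; rewrite lerN2.
by apply: closed_sublevel => x; apply: cvgN; exact: norm_continuous.
Qed.

Lemma closed_ge (phi : R * R -> R) (c : R) : continuous phi -> closed [set p | c <= phi p].
Proof.
move=> cphi; have -> : [set p | c <= phi p] = [set p | - phi p <= - c].
  by apply/seteqP; split => x /=; rewrite lerN2.
by apply: closed_sublevel => x; apply: cvgN; exact: cphi.
Qed.

Lemma closed_rectY (l a b : R) : closed (rectY l a b).
Proof.
have -> : rectY l a b = [set x | `|x.1| <= 3 * l] `&` ([set x | a <= x.2] `&` [set x | x.2 <= b]).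
  by apply/seteqP; split => x [h1]; [move=> /andP[h2 h3]|move=> [h2 h3]; split => //; apply/andP].
apply: closedI; last first.
  by apply: closedI; [apply: closed_ge|apply: closed_sublevel]; exact: continuous_snd.
apply: closed_sublevel => x; apply: continuous_comp; first exact: continuous_fst.
exact: norm_continuous.
Qed.

Lemma closed_rectX (l a b : R) : closed (rectX l a b).
Proof.
have -> : rectX l a b = [set x | `|x.2| <= 3 * l] `&` ([set x | a <= x.1] `&` [set x | x.1 <= b]).
  by apply/seteqP; split => x [h1]; [move=> /andP[h2 h3]|move=> [h2 h3]; split => //; apply/andP].
apply: closedI; last first.
  by apply: closedI; [apply: closed_ge|apply: closed_sublevel]; exact: continuous_fst.
apply: closed_sublevel => x; apply: continuous_comp; first exact: continuous_snd.
exact: norm_continuous.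
Qed.

Lemma continuous_euclid_norm : continuous (@euclid_norm R).
Proof.
move=> x; rewrite /euclid_norm.
have h : (fun x : R * R => x.1 ^+ 2 + x.2 ^+ 2) y @[y --> x] --> x.1 ^+ 2 + x.2 ^+ 2.
  apply: cvgD; rewrite expr2; under eq_fun do rewrite expr2.
    by apply: cvgM; exact: continuous_fst.
  by apply: cvgM; exact: continuous_snd.
by apply: continuous_cvg h; exact: sqrt_continuous.
Qed.

Lemma closed_circle (r : R) : closed (circle r : set (R * R)).
Proof.
have -> : (circle r : set (R * R)) = [set x | euclid_norm x <= r] `&` [set x | r <= euclid_norm x].
  apply/seteqP; split => x; rewrite /circle /=; first by move=> ->.
  by move=> [h1 h2]; apply/eqP; rewrite eq_le h1 h2.
by apply: closedI; [apply: closed_sublevel|apply: closed_ge]; exact: continuous_euclid_norm.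
Qed.

Definition arm_chain (a b : R) : set (stick R) -> Prop :=
  chain (meet_in setT) (fun s => stick_segment s `&` circle a !=set0)
    (fun s => stick_segment s `&` circle b !=set0).

(* With the empty relation a chain is a single stick. *)
Definition far (a b : R) : set (stick R) -> Prop :=
  chain (fun _ _ => False) (fun s => stick_segment s `&` [set x | `|x| <= a] !=set0)
    (fun s => stick_segment s `&` [set x | b <= `|x|] !=set0).

Let regular_crossing K B C : closed K -> closed B -> closed C -> regular stick_sep
  (chain (meet_in K) (fun s => stick_segment s `&` (K `&` B) !=set0)
    (fun s => stick_segment s `&` (K `&` C) !=set0)).
Proof.
move=> cK cB cC; apply: chain_regular; first exact: closed_meet_in.
  by apply: closed_hits; exact: closedI.
by apply: closed_hits; exact: closedI.
Qed.

Lemma regular_coverY (l a b : R) : regular stick_sep (coverY l a b).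
Proof.
apply: regular_crossing; first exact: closed_rectY.
  by apply: closed_sublevel; exact: continuous_snd.
by apply: closed_ge; exact: continuous_snd.
Qed.

Lemma regular_coverX (l a b : R) : regular stick_sep (coverX l a b).
Proof.
apply: regular_crossing; first exact: closed_rectX.
  by apply: closed_sublevel; exact: continuous_fst.
by apply: closed_ge; exact: continuous_fst.
Qed.

Lemma regular_arm_box (a b : R) : regular stick_sep (arm_box a b).
Proof.
apply: chain_regular; first exact: (closed_meet_in closedT).
  by apply: closed_hits; exact: closed_box.
by apply: closed_hits; exact: closed_out.
Qed.

Lemma regular_arm (a b : R) : regular stick_sep (arm_chain a b).
Proof.
apply: chain_regular; first exact: (closed_meet_in closedT).
  by apply: closed_hits; exact: closed_circle.
by apply: closed_hits; exact: closed_circle.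
Qed.

Lemma regular_far (a b : R) : regular stick_sep (far a b).
Proof.
apply: chain_regular; first exact: closed_false.
  by apply: closed_hits; exact: closed_box.
by apply: closed_hits; exact: closed_out.
Qed.

(** In [arm] the circles may be met by any two sticks of the sequence; the part between these two,
    reversed if necessary, is a chain from one circle to the other. *)
Lemma armE (Omega : Type) (xi : Omega -> set (stick R)) (a b : R) (w : Omega) :
  arm xi a b w <-> arm_chain a b (xi w).
Proof.
split.
  move=> [n [s [Ys st [x [[i /= i_n sx] cx]] [y [[j /= jn sy] cy]]]]].
  have meets k : (k < n)%N -> meet_in setT (s k) (s k.+1).
    by move=> /st[p [p1 p2]]; exists p.
  have [ij|ji] := leqP i j.
    apply: (@nat_chain _ _ _ _ _ (j - i) (fun k => s (i + k)%N)) => /=.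
    - by move=> k kj; apply: Ys; lia.
    - by move=> k kj; rewrite addnS; apply: meets; lia.
    - by rewrite addn0; exists x.
    - by rewrite subnKC//; exists y.
  apply: (@nat_chain _ _ _ _ _ (i - j) (fun k => s (i - k)%N)) => /=.
  - by move=> k kj; apply: Ys; lia.
  - move=> k kj; have -> : (i - k)%N = (i - k.+1).+1 by lia.
    have [|p [p1 p2 _]] := meets (i - k.+1)%N; first by lia.
    by exists p.
  - by rewrite subn0; exists x.
  - by rewrite subKn 1?ltnW//; exists y.
move=> /chain_nat[n [s [Ys st [x [sx cx]] [y [sy cy]]]]]; exists n, s; split => //.
- by move=> k /st[p [p1 p2 _]]; exists p.
- by exists x; split => //; exists 0%N.
- by exists y; split => //; exists n => /=.
Qed.

(** The sup norm lies between half the Euclidean norm and the Euclidean norm. *)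
Lemma arm_chain_box (a b : R) Y : 0 < b -> arm_chain a b Y -> arm_box a (b / 2) Y.
Proof.
move=> b0; apply: chain_mono => //.
  move=> s _ [x [sx cx]]; exists x; split => //=; rewrite norm_box -cx /euclid_norm.
  by apply/andP; split; rewrite -sqrtr_sqr ler_wsqrtr// ?lerDl ?lerDr sqr_ge0.
move=> s _ [x [sx cx]]; exists x; split => //=; rewrite norm_out -[_ || _]negbK negb_or -!ltNge.
apply/negP => /andP[h1 h2].
have e : x.1 ^+ 2 + x.2 ^+ 2 = b ^+ 2.
  by rewrite -cx /euclid_norm sqr_sqrtr// addr_ge0 ?sqr_ge0.
have := normr_ge0 x.1; have := normr_ge0 x.2.
rewrite -(real_normK (num_real x.1)) -(real_normK (num_real x.2)) in e.
move: (`|x.1|) (`|x.2|) h1 h2 e => c d h1 h2 e c0 d0; nra.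
Qed.

Lemma arm_box_mono (a a' b b' : R) Y : a <= a' -> b' <= b -> arm_box a b Y -> arm_box a' b' Y.
Proof.
move=> aa bb; apply: chain_mono => // s _ [x [sx /= h]]; exists x; split => //=.
  exact: le_trans h aa.
exact: le_trans bb h.
Qed.

(** The walk is restarted whenever it is back in the box; afterwards each piece ends outside, so its
    stick reaches beyond [c]. *)
Lemma conn_last_visit Y (c : R) x y : `|x| <= c -> conn Y setT x y ->
  exists2 x', `|x'| <= c &
    conn (Y `&` [set s | exists2 p, stick_segment s p & c < `|p|]) setT x' y.
Proof.
move=> xc; elim=> [_|y' z s _ [x' x'c IH] Ys sy sz _]; first by exists x => //; exact: conn_refl.
have [zc|cz] := leP `|z| c; first by exists z => //; exact: conn_refl.
by exists x' => //; apply: (conn_step IH _ sy sz) => //; split => //; exists z.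
Qed.

Definition near_box (l : R) : set (stick R) :=
  [set s | stick_segment s `&` [set x | `|x| <= l] !=set0].

Lemma measurable_near_box (l : R) : measurable (near_box l).
Proof. by apply: measurable_closed_stick; apply: closed_hits; exact: closed_box. Qed.

Lemma far_near_box (l b : R) Y : far l b Y -> far l b (Y `&` near_box l).
Proof. by apply: chain_restrict. Qed.

Definition cross (l : R) Y :=
  (coverY l l (3 * l) Y \/ coverY l (- (3 * l)) (- l) Y) \/
  (coverX l l (3 * l) Y \/ coverX l (- (3 * l)) (- l) Y).

Lemma cross_near_box (l : R) Y : 0 < l -> cross l Y -> cross l (Y `&` near_box (3 * l)).
Proof.
move=> l0.
have hX a b p : - (3 * l) <= a -> b <= 3 * l -> rectX l a b p -> `|p| <= 3 * l.
  by move=> ? ? [p1 /andP[p2 p3]]; rewrite norm_box p1 andbT ler_norml; apply/andP; split; lra.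
have hY a b p : - (3 * l) <= a -> b <= 3 * l -> rectY l a b p -> `|p| <= 3 * l.
  by move=> ? ? [p1 /andP[p2 p3]]; rewrite norm_box p1 /= ler_norml; apply/andP; split; lra.
have cX a b : - (3 * l) <= a -> b <= 3 * l -> coverX l a b Y ->
    coverX l a b (Y `&` near_box (3 * l)).
  move=> al bl; apply: chain_restrict => [s [p [sp [rp _]]]|s t [p [_ tp rp]]]; exists p;
    by split => //; exact: hX rp.
have cY a b : - (3 * l) <= a -> b <= 3 * l -> coverY l a b Y ->
    coverY l a b (Y `&` near_box (3 * l)).
  move=> al bl; apply: chain_restrict => [s [p [sp [rp _]]]|s t [p [_ tp rp]]]; exists p;
    by split => //; exact: hY rp.
by move=> [[h|h]|[h|h]]; [left; left|left; right|right; left|right; right];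
  (apply: cY || apply: cX) => //; lra.
Qed.

(** After its last visit to the box of radius [a] the arm only uses sticks that reach beyond [a].
    One of them meeting the box of radius [3 * l] would be a far stick. *)
Lemma arm_box_outer (l a b : R) Y : a < b -> l <= a -> ~ far (3 * l) a Y ->
  arm_box l b Y -> arm_box a b (Y `&` ~` near_box (3 * l)).
Proof.
move=> ab la nfar /arm_box_conn[x [y [xy xl yb]]].
have [x' x'a x'y] := conn_last_visit (le_trans xl la) xy.
have sub : Y `&` [set s | exists2 p, stick_segment s p & a < `|p|] `<=` Y `&` ~` near_box (3 * l).
  move=> s [Ys [p sp pa]]; split => // ns; apply: nfar; exists s; first exact: reach_start.
  by exists p; split => //; exact: ltW.
have {}x'y := conn_mono sub (@subset_refl _ setT) x'y.
have [e|h] := @chain_of_conn _ _ _ [set x | `|x| <= a] [set x | b <= `|x|] _ _ x'y x'a yb.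
  by exfalso; move: (le_lt_trans x'a ab); rewrite e ltNge yb.
by apply: chain_mono h => // s _; rewrite setTI.
Qed.

End Deterministic.

(** * Covered rectangles exclude vacant crossings *)

Section Blocking.
Context {R : realType}.
Implicit Types (Y : set (stick R)) (x y z p t : R * R) (s : stick R).

Lemma chain_image (T T' : Type) (g : T -> T') (Z : set T) (rel : T -> T -> Prop)
    (rel' : T' -> T' -> Prop) (st en : T -> Prop) (st' en' : T' -> Prop) :
  (forall a b, rel a b -> rel' (g a) (g b)) -> (forall a, st a -> st' (g a)) ->
  (forall a, en a -> en' (g a)) -> chain rel st en Z -> chain rel' st' en' (g @` Z).
Proof.
move=> gr gs ge [a ra ea]; exists (g a); last exact: ge.
elim: ra {ea} => [b Zb sb|b b' _ IH bb Zb].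
  by apply: reach_start; [exists b|exact: gs].
by apply: (reach_step IH (gr _ _ bb)); exists b'.
Qed.

Lemma swap_segment s x : stick_segment s x -> stick_segment (stick_swap s) (x.2, x.1).
Proof.
move=> /point_segment[a a1 ->]; have [b [hc hs]] := cos_sin_swap s.2.
apply/point_segment; exists ((-1) ^+ b * a).
  by case: (b); rewrite ?expr0 ?expr1; lra.
rewrite /point /stick_swap /= hc hs.
by case: (b); rewrite ?expr0 ?expr1; congr pair; ring.
Qed.

Lemma coverX_swap (l a b : R) Y : coverX l a b Y -> coverY l a b (stick_swap @` Y).
Proof.
have sR x : rectX l a b x -> rectY l a b (x.2, x.1) by [].
apply: chain_image => [s s' [x [sx s'x xR]]|s [x [sx [xR h]]]|s [x [sx [xR h]]]];
  exists (x.2, x.1).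
- by split; [exact: swap_segment|exact: swap_segment|exact: sR].
- by split; [exact: swap_segment|split => //; exact: sR].
- by split; [exact: swap_segment|split => //; exact: sR].
Qed.

Lemma cos_stick_gt0 s : stick_space R s -> s.2 != pi / 2 -> 0 < cos s.2.
Proof.
move=> [_]; rewrite /angle_range /= in_itv/= /angle => /andP[v1 v2] v3.
by apply: cos_gt0_pihalf; rewrite v1 lt_neqAle v3.
Qed.

Lemma stick_diff s : stick_right s - stick_left s =
  (2 * s.1.2 * cos s.2, 2 * s.1.2 * sin s.2).
Proof.
rewrite /stick_left /stick_right /half_stick /centre /Defs.radius /angle.
by case: s => [[[z1 z2] r] v] /=; congr pair; rewrite /= !scaleRE; ring.
Qed.

Lemma stick_ends_lt s : stick_space R s -> s.2 != pi / 2 -> (stick_left s).1 < (stick_right s).1.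
Proof.
move=> Ys sv; have := cos_stick_gt0 Ys sv; have r0 : 0 < s.1.2 by case: Ys.
have /(congr1 fst)/= := stick_diff s; move: (stick_right s) (stick_left s) => [a b] [a' b'] /= e c0.
by rewrite -subr_gt0 e; do 2 apply: mulr_gt0 => //.
Qed.

(** In units of the original half-length a point of the stick has parameter in [[-1, 1]], while the
    ends of the lengthened stick are at [- c] and [c]. *)
Lemma move_open_segment t (c : R) s p : 1 < c -> stick_space R s -> s.2 != pi / 2 ->
  stick_segment s p ->
  open_segment (stick_left (stick_move t c s)) (stick_right (stick_move t c s)) (p + t).
Proof.
move=> c1 Ys sv sp; have c0 : 0 < c by lra.
apply/open_segmentE; first exact: stick_ends_lt (stick_space_move t c0 Ys) sv.
  move: sp => /point_segment[a a1 ->].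
  rewrite /side /stick_left /stick_right /half_stick /centre /Defs.radius /angle /point.
  by case: s t {Ys sv} => [[[z1 z2] r] v] [t1 t2] /=; rewrite !scaleRE; ring.
have := cos_stick_gt0 Ys sv; have r0 : 0 < s.1.2 by case: Ys.
move: sp => /point_segment[a /andP[a1 a2] ->].
rewrite /side /stick_left /stick_right /half_stick /centre /Defs.radius /angle /point.
case: s t r0 {Ys sv} => [[[z1 z2] r] v] [t1 t2] /= r0 v0; rewrite !scaleRE.
have h1 : 0 < (c + a) * (r * cos v) by do 2?apply: mulr_gt0 => //; lra.
have h2 : 0 < (c - a) * (r * cos v) by do 2?apply: mulr_gt0 => //; lra.
by apply/andP; split; nra.
Qed.

(** Up to the positive factor [4 * s.1.2 * s'.1.2] the determinant is the sine of the difference of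
    the angles, and two angles of the half-open range differ by less than [pi]. *)
Lemma turn_neq0 s s' : stick_space R s -> stick_space R s' -> s.2 <> s'.2 ->
  slope_det (stick_right s - stick_left s) (stick_right s' - stick_left s') != 0.
Proof.
move=> [r0 v0] [r0' v0'] vv; rewrite !stick_diff /slope_det /=.
have -> : 2 * s.1.2 * cos s.2 * (2 * s'.1.2 * sin s'.2) - 2 * s.1.2 * sin s.2 * (2 * s'.1.2 * cos s'.2)
   = 4 * s.1.2 * s'.1.2 * sin (s'.2 - s.2) by rewrite sinB; ring.
move: r0 r0' v0 v0'; rewrite /angle_range /Defs.radius /angle /= !in_itv/=.
move=> r0 r0' /andP[v1 v2] /andP[v3 v4].
have q (v : R) : v != 0 -> - pi < v < pi -> sin v != 0.
  move=> v5 /andP[v6 v7]; have [h|h|/eqP h] := ltgtP v 0; last by rewrite (eqP h) eqxx in v5.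
    by rewrite -oppr_eq0 -sinN gt_eqF// sin_gt0_pi//; apply/andP; split; lra.
  by rewrite gt_eqF// sin_gt0_pi// h.
apply: mulf_neq0; last first.
  by apply: q; [rewrite subr_eq0; apply/eqP => e; apply: vv|apply/andP; split; lra].
by rewrite !mulf_neq0// gt_eqF.
Qed.

(* The shift moves the rectangle [-7l/2, 7l/2] x [a + l/2, a + 3l/2], whose short
   sides lie outside the 6l-long rectangle, onto the one of [vacant_crossing]. *)
Lemma cover_blocks (l a c : R) Y : 0 < l -> 1 < c -> Y `<=` stick_space R ->
  (forall s, Y s -> s.2 != pi / 2) -> (forall s s', Y s -> Y s' -> s.2 = s'.2 -> s = s') ->
  coverY l a (a + 2 * l) Y ->
  ~ vacant_crossing (fun _ : unit => stick_move (7 * l / 2, - a - l / 2) c @` Y) 7 l tt.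
Proof.
move=> l0 c1 Ysp Yv Yd /conn_of_chain[x [y [xy /= xa yb]]] [f [fp fbox f0 f1 fnc]].
set t := (_, _) in fnc.
have [e|[n [s [p [Ys pR p0 pn]]]]] := conn_nat xy; first by move: yb; rewrite -e; lra.
have c0 : 0 < c by lra.
have fb u : 0 <= u <= 1 -> 0 <= (f u).2 <= l.
  move=> u01; have [|_ /=] := fbox (f u); last by rewrite in_itv.
  by exists u => //=; rewrite in_itv.
apply: (@chain_blocks_path R f n (fun i => stick_left (stick_move t c (s i)))
  (fun i => stick_right (stick_move t c (s i))) (fun i => p i + t)) => //.
- by move=> i /Ys[Yi _ _]; apply: fnc; exists (s i).
- move=> i /Ys[Yi _ _]; apply: stick_ends_lt; first exact: stick_space_move (Ysp _ Yi).
  exact: (Yv _ Yi).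
- by move=> i /Ys[Yi sp _]; apply: move_open_segment => //; [exact: Ysp|exact: Yv].
- by move=> i /Ys[Yi _ sp]; apply: move_open_segment => //; [exact: Ysp|exact: Yv].
- move=> i lin; have [Yi _ _] := Ys i (ltnW lin); have [Yj _ _] := Ys _ lin.
  have [e|ne] := pselect ((s i).2 = (s i.+1).2).
    by left; rewrite (Yd _ _ Yi Yj e).
  right; apply: turn_neq0 => //; apply: stick_space_move => //; exact: Ysp.
- move=> i /pR[/= + _]; rewrite ler_norml f0 => /andP[h1 h2].
  suff : 0 < (p i).1 + 7 * l / 2 by [].
  by lra.
- move=> i /pR[/= + _]; rewrite ler_norml f1 => /andP[h1 h2].
  suff : (p i).1 + 7 * l / 2 < 7 * l by [].
  by lra.
- move=> u /fb/andP[h1 h2].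
  suff : (p 0%N).2 + (- a - l / 2) < (f u).2 by [].
  by rewrite p0; lra.
- move=> u /fb/andP[h1 h2].
  suff : (f u).2 < (p n.+1).2 + (- a - l / 2) by [].
  by rewrite pn; lra.
Qed.

End Blocking.

(** * Crossing probabilities *)

Section RealProbability.
Context {R : realType} {d : measure_display} {Omega : measurableType d}.
Variable P : probability Omega R.
Implicit Types A B N : set Omega.
Local Notation fP A := (fine (P A)).

Lemma fine_prob_le A B : measurable A -> measurable B -> A `<=` B -> fP A <= fP B.
Proof.
move=> mA mB AB; apply: fine_le; [exact: fin_num_measure|exact: fin_num_measure|].
by apply: le_measure => //; exact: mem_set.
Qed.

Lemma fine_prob_le1 A : measurable A -> fP A <= 1.
Proof.
move=> mA; have := fine_prob_le mA measurableT (@subsetT _ A).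
by rewrite probability_setT.
Qed.

Lemma fine_probU A B : measurable A -> measurable B -> fP (A `|` B) <= fP A + fP B.
Proof.
move=> mA mB; rewrite -fineD; [|exact: fin_num_measure|exact: fin_num_measure].
have mAB : measurable (A `|` B) by exact: measurableU.
apply: fine_le; first exact: fin_num_measure.
  by rewrite fin_numD !fin_num_measure.
exact: measureU2.
Qed.

Lemma fine_probC A : measurable A -> fP (~` A) = 1 - fP A.
Proof.
by move=> mA; rewrite probability_setC// fineB//; exact: fin_num_measure.
Qed.

Lemma fine_prob_le_null A B N : measurable A -> measurable B -> measurable N -> P N = 0%E ->
  A `<=` B `|` N -> fP A <= fP B.
Proof.
move=> mA mB mN PN AB.
have := fine_prob_le mA (measurableU _ _ mB mN) AB.
by move=> /le_trans; apply; have := fine_probU mB mN; rewrite PN /= addr0.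
Qed.

End RealProbability.

Section Estimates.
Context {R : realType}.
Variables (u u' delta : R).
Hypothesis u0 : 0 < u.
Hypothesis uu' : u < u'.
Hypothesis delta0 : 0 < delta.
Hypothesis blocked : forall l, 0 < l ->
  forall d (Omega : measurableType d) (P : probability Omega R) xi,
    is_ips u' P xi -> exists2 p, has_prob P (vacant_crossing xi 7 l) p & delta <= p <= 1 - delta.

(** Lengths act on the intensity through their square, hence the square root in [c]. Off the null
    sets of vertical and of parallel sticks, being covered excludes the vacant crossing of the
    lengthened soup, whose probability is at least [delta]. As [a] is arbitrary, this serves
    rectangles at every height. *)
Lemma cover_prob {d} {Omega : measurableType d} (P : probability Omega R)
    (xi : Omega -> set (stick R)) (l a : R) (A : set Omega) :
  is_ips u P xi -> 0 < l -> measurable A ->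
  (forall w, A w -> coverY l a (a + 2 * l) (xi w)) -> fine (P A) <= 1 - delta.
Proof.
move=> ips l0 mA cA.
pose c := Num.sqrt (u' / u).
have u1 : 1 < u' / u by rewrite ltr_pdivlMr// mul1r.
have c1 : 1 < c by rewrite -sqrtr1 ltr_sqrt// (lt_trans ltr01).
have c2 : c ^+ 2 * u = u'.
  by rewrite sqr_sqrtr ?divfK ?gt_eqF// (le_trans ler01)// ltW.
have := is_ips_move (7 * l / 2, - a - l / 2) (lt_trans ltr01 c1) ips; rewrite c2.
move=> /(blocked l0)[p [A0 [N [mA0 [N' [mN' N'0 NN']] VE PA0]]] /andP[dp _]].
have [N1 [mN1 PN1 h1]] := ips_no_vertical u0 ips.
have [N2 [mN2 PN2 h2]] := ips_distinct_angles u0 ips.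
have mN12 : measurable (N1 `|` N2) by exact: measurableU.
have PN12 : P (N1 `|` N2) = 0%E.
  apply/eqP; rewrite eq_le measure_ge0 andbT.
  have h : (P (N1 `|` N2) <= P N1 + P N2)%E by exact: measureU2.
  by apply: (le_trans h); rewrite PN1 PN2 adde0.
(* [A0] is the measurable part of the vacant event and carries its whole probability, so it suffices
   to place [A] in the complement of [A0], up to a null set. *)
have mC : measurable (~` A0) by exact: measurableC.
apply: (@le_trans _ _ (fine (P (~` A0)))); last first.
  by rewrite fine_probC// PA0 /=; lra.
apply: (fine_prob_le_null mA mC mN12 PN12) => w Aw.
have [N12|nN] := pselect ((N1 `|` N2) w); first by right.
left => A0w; have : (A0 `|` N) w by left.
rewrite -VE.
apply: (@cover_blocks R l a c (xi w) l0 c1 (ips.1 w)) (cA w Aw).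
  by move=> s xs; apply: h1 xs => N1w; apply: nN; left.
by move=> s s' xs xs'; apply: h2 xs xs' => N2w; apply: nN; right.
Qed.

Context {d : measure_display} {Omega : measurableType d}.
Variables (P : probability Omega R) (xi : Omega -> set (stick R)) (N0 : set Omega).
Hypothesis ips : is_ips u P xi.
Hypothesis mN0 : measurable N0.
Hypothesis PN0 : P N0 = 0%E.
Hypothesis finN0 : forall w m, ~ N0 w -> finite_set (xi w `&` window m setT).
Local Notation fP A := (fine (P A)).
Local Notation ev := (event xi N0).
Local Notation noev := (noevent xi N0).

Let mW m : measurable (window m setT : set (stick R)).
Proof. exact: measurable_window. Qed.
Let incW m : window m setT `<=` (window m.+1 setT : set (stick R)).
Proof. exact: window_inc. Qed.
Let coverW w : xi w `<=` \bigcup_m window m setT.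
Proof. by move=> s /(ips.1 w s)/window_cover[m ?]; exists m. Qed.

Lemma measurable_ev Psi D : regular stick_sep Psi -> measurable D -> measurable (ev Psi D).
Proof. exact: (measurable_event ips.2 measurable_stick_sep mW incW coverW mN0 finN0). Qed.

Lemma measurable_noev Psi D : regular stick_sep Psi -> measurable D -> measurable (noev Psi D).
Proof. exact: (measurable_noevent ips.2 measurable_stick_sep mW incW coverW mN0 finN0). Qed.

Lemma ev_indep Psi1 Psi2 D1 D2 : regular stick_sep Psi1 -> regular stick_sep Psi2 ->
  measurable D1 -> measurable D2 -> D1 `&` D2 = set0 ->
  fP (ev Psi1 D1 `&` ev Psi2 D2) <= fP (ev Psi1 D1) * fP (ev Psi2 D2).
Proof.
exact: (regular_indep ips.2 measurable_stick_sep mW incW coverW mN0 PN0 finN0).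
Qed.

Lemma ev_fkg Psi1 Psi2 : regular stick_sep Psi1 -> regular stick_sep Psi2 ->
  fP (noev Psi1 setT) * fP (noev Psi2 setT) <= fP (noev (fun Y => Psi1 Y \/ Psi2 Y) setT).
Proof.
move=> r1 r2.
have -> : noev (fun Y => Psi1 Y \/ Psi2 Y) setT = noev Psi1 setT `&` noev Psi2 setT.
  apply/seteqP; split => w /=.
    by move=> [h1 h2]; split; split => // h; apply: h2; [left|right].
  by move=> [[h1 h2] [_ h3]]; split => // -[].
exact: (regular_fkg ips.2 measurable_stick_sep mW incW coverW mN0 PN0 finN0).
Qed.

Lemma noev_prob Psi (c : R) : regular stick_sep Psi -> fP (ev Psi setT) <= 1 - c ->
  c <= fP (noev Psi setT).
Proof.
move=> r h; have mn := measurable_noev r measurableT.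
have : fP (~` noev Psi setT) <= fP (ev Psi setT).
  apply: (fine_prob_le_null _ _ mN0 PN0); [exact: measurableC|exact: measurable_ev|].
  move=> w nw; have [N0w|nN0] := pselect (N0 w); first by right.
  by left; split => //=; apply: contrapT => h'; apply: nw.
by rewrite fine_probC//; lra.
Qed.

Lemma regular_cross l : regular stick_sep (@cross R l).
Proof.
by apply: regular_or; apply: regular_or;
  [exact: regular_coverY|exact: regular_coverY|exact: regular_coverX|exact: regular_coverX].
Qed.

(** Each of the four rectangles is left uncovered with probability at least [delta], the upright
    ones by invariance of the soup under [stick_swap]. Positive association, applied to the two
    pairs and then to both together, multiplies these bounds. *)
Lemma cross_prob l : 0 < l -> fP (ev (cross l) setT) <= 1 - delta ^+ 4.
Proof.
move=> l0.
have hY a : delta <= fP (noev (coverY l a (a + 2 * l)) setT).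
  apply: noev_prob; first exact: regular_coverY.
  apply: (cover_prob ips l0 (a := a)); first by apply: measurable_ev => //; exact: regular_coverY.
  by move=> w [_ /=]; rewrite setIT.
have hX a : delta <= fP (noev (coverX l a (a + 2 * l)) setT).
  apply: noev_prob; first exact: regular_coverX.
  apply: (cover_prob (is_ips_swap ips) l0 (a := a)).
    by apply: measurable_ev => //; exact: regular_coverX.
  by move=> w [_ /=]; rewrite setIT; exact: coverX_swap.
have e1 : l + 2 * l = 3 * l by ring.
have e2 : - (3 * l) + 2 * l = - l by ring.
have := hY l; have := hY (- (3 * l)); have := hX l; have := hX (- (3 * l)).
rewrite e1 e2 => h1 h2 h3 h4.
have rX a b := @regular_coverX R l a b; have rY a b := @regular_coverY R l a b.
have k1 := ev_fkg (rY l (3 * l)) (rY (- (3 * l)) (- l)).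
have k2 := ev_fkg (rX l (3 * l)) (rX (- (3 * l)) (- l)).
have k3 := ev_fkg (regular_or (rY l (3 * l)) (rY (- (3 * l)) (- l)))
  (regular_or (rX l (3 * l)) (rX (- (3 * l)) (- l))).
have d0 := ltW delta0.
have k4 : delta ^+ 2 * delta ^+ 2 <= fP (noev (cross l) setT).
  apply: le_trans k3; apply: ler_pM; rewrite ?sqr_ge0//.
    by apply: le_trans k1; rewrite expr2; exact: ler_pM.
  by apply: le_trans k2; rewrite expr2; exact: ler_pM.
have mn : measurable (noev (cross l) setT) by apply: measurable_noev => //; exact: regular_cross.
have : fP (ev (cross l) setT) <= fP (~` noev (cross l) setT).
  apply: fine_prob_le; [|exact: measurableC|by move=> w [_ h] [_ +]].
  by apply: measurable_ev => //; exact: regular_cross.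
by rewrite fine_probC// -[4%N]/(2 + 2)%N exprD; lra.
Qed.

(** Wherever the configuration is restricted, such a stick belongs to [long_strips a b], and
    [hit_le] applies to that set. *)
Lemma far_prob a b D : 0 < a -> 3 * a <= b -> measurable D ->
  fP (ev (far a b) D) <= u * (1536 * a / b).
Proof.
move=> a0 ab mD; have b0 : 0 < b by lra.
have mL : measurable (long_strips a b) by exact: measurable_long_strips.
have mH : measurable (hit xi (long_strips a b)) by exact: (measurable_hit ips.2).
have h : (P (hit xi (long_strips a b)) <= (u * (1536 * a / b))%:E)%E.
  apply: (hit_le ips.2 mL); first exact: intensity_ge0.
  rewrite EFinM; apply: lee_wpmul2l; first by rewrite lee_fin ltW.
  exact: long_strips_intensity.
have mE : measurable (ev (far a b) D) by apply: measurable_ev => //; exact: regular_far.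
apply: (@le_trans _ _ (fP (hit xi (long_strips a b)))); last first.
  by rewrite -lee_fin fineK//; exact: fin_num_measure.
apply: fine_prob_le => // w [_ [s rs [y [sy yb]]]].
have [[xs Ds] [x [sx xa]]] : (xi w `&` D) s /\ stick_segment s `&` [set x | `|x| <= a] !=set0.
  by case: rs => // ? ? _ [].
exists s; split => //; move: xa yb; rewrite /= norm_box norm_out => /andP xa /orP yb.
have r0 : 0 < s.1.2 by case: (ips.1 w s xs).
by have [j hj] := long_stick_strip a0 ab r0 sx xa sy yb; exists j.
Qed.

End Estimates.

(** The point is a place [k] after which [F] stops holding; the exceptions are the start, where [F]
    may fail at once, and the end of the range. *)
Lemma last_index (F : nat -> Prop) (J : nat) : exists k, [/\ (k <= J)%N, k = 0%N \/ F k &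
  k = J \/ ~ F k.+1].
Proof.
elim: J => [|J [k [kJ h1 h2]]]; first by exists 0%N; split => //; left.
have [FJ|nFJ] := pselect (F J.+1).
  by case: h2 => [e|nF]; [exists J.+1; split; [|right|left]|exists k; split; [exact: leqW| |right]].
by exists k; split; [exact: leqW| |right; case: h2 => // ->].
Qed.

Lemma geometric_sum (R : realFieldType) (x : R) (n : nat) : 1 < x ->
  \sum_(k < n) x ^- k.+1 <= (x - 1)^-1.
Proof.
move=> x1; have x0 : 0 < x by apply: lt_trans x1.
suff -> : \sum_(k < n) x ^- k.+1 = (x - 1)^-1 * (1 - x ^- n).
  apply: ler_piMr; first by rewrite invr_ge0 subr_ge0 ltW.
  by rewrite gerBl invr_ge0 exprn_ge0// ltW.
elim: n => [|n IH]; first by rewrite big_ord0 expr0 invr1 subrr mulr0.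
rewrite big_ord_recr /= IH exprS.
by field; rewrite gt_eqF ?exprn_gt0//= gt_eqF//= subr_eq0 gt_eqF.
Qed.

Lemma fine_prob_bigU {R : realType} {d : measure_display} {Omega : measurableType d}
    (P : probability Omega R) (A : nat -> set Omega) (n : nat) :
  (forall k, measurable (A k)) ->
  fine (P (\big[setU/set0]_(k < n) A k)) <= \sum_(k < n) fine (P (A k)).
Proof.
move=> mA; elim: n => [|n IH]; first by rewrite !big_ord0 measure0.
rewrite !big_ord_recr /=; apply: (le_trans (fine_probU _ _ (mA n))).
  by apply: bigsetU_measurable.
by rewrite lerD2r.
Qed.

(** * Recursion over the scales *)

Section Recursion.
Context {R : realType} {d : measure_display} {Omega : measurableType d}.
Variables (u c q lam N : R) (P : probability Omega R) (xi : Omega -> set (stick R)).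
Variable N0 : set Omega.
Hypothesis u0 : 0 < u.
Hypothesis ips : is_ips u P xi.
Hypothesis mN0 : measurable N0.
Hypothesis PN0 : P N0 = 0%E.
Hypothesis finN0 : forall w m, ~ N0 w -> finite_set (xi w `&` window m setT).
Local Notation fP A := (fine (P A)).
Local Notation ev := (event xi N0).
Hypothesis crossP : forall l, 0 < l -> fP (ev (cross l) setT) <= q.
Hypothesis N4 : 4 <= N.
(* 4608 = 3 * 1536: [far_prob] with [a = 3 * l] *)
Hypothesis cE : c = 4608 * u.
Hypothesis Nq : c / (N - 1) <= (1 - q) / 2.
Hypothesis lam2 : 1 / 2 <= lam.
Hypothesis lam1 : lam <= 1.
Hypothesis lamq : q <= lam * ((1 + q) / 2).

Let M := N ^+ 2.

Let mev Psi D : regular stick_sep Psi -> measurable D -> measurable (ev Psi D).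
Proof. exact: (measurable_ev ips mN0 finN0). Qed.

(** [M ^- k] consists of two factors [N ^- k]. One of them absorbs the missing powers of [lam], at
    most [2 * k] in number, because [lam ^+ 2 * N >= 1]; the other is kept for the geometric series.
    For [k = i] the truncated subtraction gives exponent 0, as it should when no outer arm is
    left. *)
Let scales (k i : nat) : (0 < k)%N -> (k <= i)%N ->
  c * M ^- k * lam ^+ (i - k.+1) <= lam ^+ i * c * N ^- k.
Proof.
move=> k0 ki; have [n4 l2] := (N4, lam2); have N0' : 0 < N by lra.
have c0 : 0 <= c by rewrite cE; apply: mulr_ge0; [exact: ler0n|exact: ltW].
have l0 : 0 < lam by lra.
have lam4 : 1 / 4 <= lam ^+ 2 by rewrite expr2; nra.
have h : 1 <= (lam ^+ 2 * N) ^+ k by apply: exprn_ege1; move: (lam ^+ 2) lam4 n4 => y; nra.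
have ik : (i <= i - k.+1 + 2 * k)%N by clear -k0 ki; lia.
have h2 : lam ^+ (i - k.+1) * (lam ^+ 2) ^+ k <= lam ^+ i.
  by rewrite -exprM -exprD; apply: ler_wiXn2l; [exact: ltW|exact: lam1|exact: ik].
have Nk : 0 < N ^+ k by exact: exprn_gt0.
have e : M ^- k = N ^- k * N ^- k by rewrite /M -exprM mulnC exprM expr2 invfM.
rewrite e -[_ * c * _]mulrA [lam ^+ i * _]mulrC -!mulrA; apply: ler_wpM2l => //.
apply: ler_wpM2l; first by rewrite invr_ge0 ltW.
rewrite mulrC ler_pdivrMr// (le_trans _ (ler_wpM2r (ltW Nk) h2))//.
by rewrite -mulrA -exprMn ler_peMr// exprn_ge0// ltW.
Qed.

Lemma arm_box_prob (J : nat) : forall l, 0 < l ->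
  fP (ev (arm_box l (M ^+ J * l)) setT) <= lam ^+ J.
Proof.
elim/ltn_ind: J => J IH l l0.
have [n4 l2] := (N4, lam2); have [l1 lq] := (lam1, lamq).
have l30 : 0 < 3 * l by lra.
have lam0 : 0 < lam by lra.
have M16 : 16 <= M by rewrite /M expr2; nra.
have M0 : 0 < M by lra.
have [J0|J0] := posnP J.
  rewrite J0 expr0; apply: fine_prob_le1; apply: mev => //; exact: regular_arm_box.
pose b k := M ^+ k * l.
have bS k : b k.+1 = M * b k by rewrite /b exprS -mulrA.
have b0 k : 0 < b k by apply: mulr_gt0 => //; exact: exprn_gt0.
have lb k : l <= b k.
  by apply: ler_peMl; [exact: ltW|apply: exprn_ege1; lra].
(* The condition [3 * a <= b] of [far_prob] with [a = 3 * l]; it holds from scale 1 on because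
   [M >= 16]. *)
have lbS k : 3 * (3 * l) <= b k.+1 by rewrite bS; have := lb k; nra.
pose H := near_box (3 * l).
have mH : measurable H by exact: measurable_near_box.
have mHC : measurable (~` H) by exact: measurableC.
(* From scale [J] on no outer arm remains and the event is replaced by the sure one. *)
pose B k := if (k < J)%N then ev (arm_box (b k) (b J)) (~` H) else setT.
have mB k : measurable (B k).
  by rewrite /B; case: ifP => // _; apply: mev => //; exact: regular_arm_box.
have indep Psi k : regular stick_sep Psi -> (0 < k)%N ->
    fP (ev Psi H `&` B k) <= fP (ev Psi H) * lam ^+ (J - k).
  move=> rPsi k0; rewrite /B; case: ltnP => [kJ|Jk]; last first.
    by rewrite setIT (eqP (Jk : (J - k == 0)%N)) expr0 mulr1.
  have rA := regular_arm_box (b k) (b J).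
  apply: (le_trans (ev_indep ips mN0 PN0 finN0 rPsi rA mH mHC _)); first exact: setICr.
  apply: ler_wpM2l; first exact: fine_ge0.
  (* From [b k] to [b J] there are [J - k] scales, and forgetting the restriction to sticks outside
     [H] only enlarges the event. *)
  have := IH (J - k)%N _ (b k) (b0 k); rewrite ltn_subrL k0 J0 => /(_ isT).
  have -> : M ^+ (J - k) * b k = b J by rewrite /b mulrA -exprD subnK// ltnW.
  apply: le_trans; apply: fine_prob_le; [exact: mev|exact: mev|].
  move=> w [h1 /= h2]; split => //=; apply: chain_mono h2 => // s [xs _]; by split.
pose A k := ev (far (3 * l) (b k)) H `&` B k.+1.
have mA k : measurable (A k).
  by apply: measurableI => //; apply: mev => //; exact: regular_far.
have mX : measurable (ev (cross l) H) by apply: mev => //; exact: regular_cross.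
(* For [k = 0] in [last_index] the crossing of the rectangles is kept as a factor; for [k > 0] it is
   given up in favour of the far stick that reaches [b k]. In both cases the outer arm starts one
   scale later, at [b k.+1]. *)
have sub : ev (arm_box l (b J)) setT `<=`
    (ev (cross l) H `&` B 1%N) `|` \big[setU/set0]_(k < J) A k.+1.
  move=> w [Nw /=]; rewrite setIT => arm.
  have [k [kJ h1 h2]] := last_index (fun k => far (3 * l) (b k) (xi w)) J.
  have Bk : B k.+1 w.
    rewrite /B; case: ifP => // kJ'; split => //=.
    have bb : b k.+1 < b J by rewrite /b ltr_pM2r// ltr_eXn2l//; lra.
    apply: (arm_box_outer bb (lb _)) arm.
    by case: h2 => // e; move: kJ'; rewrite e ltnNge leqnSn.
  case: k kJ h1 {h2} Bk => [_ _ B1|k kJ [//|fk] Bk].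
    left; split => //; split => //=; apply: cross_near_box => //.
    apply: arm_box_cover arm => //.
    by case: (J) J0 => // j _; have := lbS j; lra.
  right; rewrite -(bigcup_mkord J (fun k => A k.+1)); exists k => //.
  by split => //; split => //=; exact: far_near_box.
have mU : measurable (\big[setU/set0]_(k < J) A k.+1).
  by apply: bigsetU_measurable => k _; exact: mA.
have mE := mev (regular_arm_box l (b J)) measurableT.
have mXB := measurableI _ _ mX (mB 1%N).
apply: (le_trans (fine_prob_le P mE (measurableU _ _ mXB mU) sub)).
apply: (le_trans (fine_probU P mXB mU)).
have PX : fP (ev (cross l) H `&` B 1%N) <= q * lam ^+ J.-1.
  rewrite -subn1; apply: (le_trans (indep _ 1%N (regular_cross l) _)) => //.
  apply: ler_wpM2r; first by rewrite exprn_ge0 ?ltW.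
  apply: le_trans (crossP l0); apply: fine_prob_le => //.
    by apply: mev => //; exact: regular_cross.
  move=> w [h1 /= h2]; split => //=; rewrite setIT.
  have sub' : xi w `&` H `<=` xi w by move=> s [].
  by case: h2 => -[h|h]; [left; left|left; right|right; left|right; right];
    apply: chain_mono h.
have PA k : (k < J)%N -> fP (A k.+1) <= lam ^+ J * c * N ^- k.+1.
  move=> kJ; apply: le_trans (scales (ltn0Sn k) kJ).
  apply: (le_trans (indep _ k.+2 (regular_far _ _) _)) => //.
  apply: ler_wpM2r; first by rewrite exprn_ge0 ?ltW.
  apply: (le_trans (far_prob u0 ips mN0 finN0 l30 (lbS k) mH)).
  rewrite le_eqVlt; apply/orP; left; apply/eqP; rewrite cE /b; move: (M ^+ k.+1) (exprn_gt0 k.+1 M0) => y y0.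
  by field; rewrite !gt_eqF.
have PU := fine_prob_bigU P J (fun k => mA k.+1).
have PS : \sum_(k < J) fP (A k.+1) <= lam ^+ J * c * (N - 1)^-1.
  apply: (@le_trans _ _ (\sum_(k < J) lam ^+ J * c * N ^- k.+1)).
    by apply: ler_sum => k _; exact: PA.
  rewrite -mulr_sumr; apply: ler_wpM2l; last by apply: geometric_sum; lra.
  apply: mulr_ge0; first by rewrite exprn_ge0 ?ltW.
  by rewrite cE; apply: mulr_ge0; [exact: ler0n|exact: ltW].
have PT := le_trans PU PS.
(* By the hypotheses on [lam] and [N] the two bounds add up to at most
   [lam ^+ J * ((1 + q) / 2 + (1 - q) / 2)]. *)
apply: (le_trans (lerD PX PT)).
have -> : lam ^+ J = lam * lam ^+ J.-1 by rewrite -exprS prednK.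
have L0 : 0 <= lam ^+ J.-1 by rewrite exprn_ge0 ?ltW.
have k1 := ler_wpM2r L0 lamq.
have LL0 : 0 <= lam * lam ^+ J.-1 by rewrite mulr_ge0// ltW.
have k2 := ler_wpM2l LL0 Nq.
rewrite -[_ * c * _]mulrA; move: k1 k2.
by move: (c / (N - 1)) (lam ^+ J.-1) => y z; nra.
Qed.

End Recursion.

(** [J = 0] is exempt from the first inequality, so that [b < a] is allowed; probabilities are then
    bounded by 1. *)
Lemma scale_between {R : realType} (M a b : R) : 2 <= M -> 0 < a -> exists J : nat,
  (J = 0%N \/ M ^+ J * a <= b) /\ b < M ^+ J.+1 * a.
Proof.
move=> M2 a0.
have Mn (n : nat) : n%:R <= M ^+ n.
  elim: n => [|n IH]; first by rewrite expr0.
  have h : 1 <= M ^+ n by apply: exprn_ege1; lra.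
  by rewrite exprS -natr1; nra.
have ex : exists j, b < M ^+ j.+1 * a.
  exists (Num.truncn (b / a)); rewrite -ltr_pdivrMr//.
  exact: lt_le_trans (truncnS_gt _) (Mn _).
have [J bJ minJ] := ex_minnP ex; exists J; split => //.
case: J bJ minJ => [|J] _ minJ; [by left|right].
by rewrite leNgt; apply/negP => /minJ; rewrite ltnn.
Qed.

(** The exponent is the one for which [lam] is the power of [M^-1], so [lam ^+ J] is the same power
    of [M ^- J]. *)
Lemma power_rate {R : realType} (M lam x : R) (J : nat) : 1 < M -> 0 < lam ->
  M ^- J < x -> lam <= 1 -> lam ^+ J <= x `^ (- ln lam / ln M).
Proof.
move=> M1 lam0 Jx lam1; have M0 : 0 < M by lra.
have MJ : 0 < M ^- J by rewrite invr_gt0 exprn_gt0.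
have x0 : 0 < x by exact: lt_trans Jx.
have lM : 0 < ln M by exact: ln_gt0.
have ll : ln lam <= 0 by exact: ln_le0.
rewrite /powR gt_eqF// -[lam ^+ J]lnK ?posrE ?exprn_gt0// ler_expR lnXn//.
have : ln (M ^- J) <= ln x by rewrite ler_ln ?posrE// ltW.
rewrite lnV ?posrE ?exprn_gt0// lnXn// => h.
have -> : ln lam *+ J = - ln lam / ln M * (- (ln M *+ J)).
  by rewrite -[ln lam *+ J]mulr_natr -[ln M *+ J]mulr_natr; field; rewrite gt_eqF.
by apply: ler_wpM2l => //; rewrite divr_ge0 ?oppr_ge0// ltW.
Qed.

Theorem proposition5p5 (R : realType) (u : R) (u_gt0 : 0 < u)
    (u_lt_ubar : (u%:E < ubar R)%E) :
  exists K eta : R,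
    [/\ 0 < K, 0 < eta < 1 &
      forall (d : measure_display) (Omega : measurableType d)
        (P : probability Omega R) (xi : Omega -> set (stick R)),
        is_ips u P xi ->
        forall l1 l2 : R, 0 < l1 -> l1 < l2 ->
          exists2 p : R, has_prob P (arm xi l1 l2) p &
                         p <= K * (l1 / l2) `^ eta].
Proof.
have [_ [u' [u'0 bcp] <-]] := ereal_sup_gt u_lt_ubar; rewrite lte_fin => uu'.
have [delta0 d0 hd0] := bcp 7 (ltac:(lra)).
(* The cap 1/2 gives [q >= 15 / 16] and thus [lam >= 1 / 2], on which both the recursion and
   [eta < 1] rely. *)
pose delta := Num.min delta0 (1 / 2).
have [dd0 dd2] : delta <= delta0 /\ delta <= 1 / 2 by rewrite /delta !ge_min !lexx orbT.
have dpos : 0 < delta by rewrite /delta lt_min d0/=; lra.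
have hd l : 0 < l -> forall d (Omega : measurableType d) (P : probability Omega R) xi,
    is_ips u' P xi ->
    exists2 p, has_prob P (vacant_crossing xi 7 l) p & delta <= p <= 1 - delta.
  move=> l0 d Omega P xi ips; have [p hp /andP[h1 h2]] := hd0 l l0 d Omega P xi ips.
  by exists p => //; apply/andP; split; lra.
pose q := 1 - delta ^+ 4.
have [q0 q1] : 15 / 16 <= q /\ q < 1.
  have h : delta ^+ 2 <= 1 / 4 by rewrite expr2; nra.
  have h' : 0 < delta ^+ 2 by exact: exprn_gt0.
  have e : delta ^+ 4 = delta ^+ 2 * delta ^+ 2 by rewrite -exprD.
  by rewrite /q e; move: (delta ^+ 2) h h' => y ? ?; split; nra.
have [c cE] : exists c, c = 4608 * u by exists (4608 * u).
have c0 : 0 < c by rewrite cE; lra.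
(* Large enough for the total contribution of the far sticks, [c / (N - 1)], to stay below
   [(1 - q) / 2]. *)
pose N := 4 + 2 * c / (1 - q).
have y0 : 0 < 2 * c / (1 - q) by apply: divr_gt0; lra.
have N4 : 4 <= N by rewrite /N; lra.
have Nq : c / (N - 1) <= (1 - q) / 2.
  rewrite ler_pdivrMr; last by lra.
  have e : 2 * c / (1 - q) * (1 - q) = 2 * c by rewrite divfK// gt_eqF//; lra.
  by rewrite /N; move: (2 * c / (1 - q)) y0 e => y y0 e; nra.
(* The solution of [q / lam + (1 - q) / 2 = 1], which balances the recursion. *)
pose lam := 2 * q / (1 + q).
have lamq : lam * ((1 + q) / 2) = q by rewrite /lam; field; rewrite gt_eqF//; lra.
have lam1 : lam < 1 by rewrite /lam ltr_pdivrMr; lra.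
have lam2 : 1 / 2 <= lam by rewrite /lam ler_pdivlMr; lra.
have lam0 : 0 < lam by lra.
pose M := N ^+ 2.
have M16 : 16 <= M by rewrite /M expr2; nra.
have M1 : 1 < M by lra.
pose eta := - ln lam / ln M.
have lM : 0 < ln M by exact: ln_gt0.
have ll : ln lam < 0 by apply: ln_lt0; rewrite lam0.
have eta0 : 0 < eta by apply: divr_gt0 => //; rewrite oppr_gt0.
have eta1 : eta < 1.
  have Mlam : lam^-1 < M by rewrite -div1r ltr_pdivrMr; nra.
  by rewrite /eta ltr_pdivrMr// mul1r -lnV ?posrE// ltr_ln ?posrE ?invr_gt0//; lra.
(* The factor [1 / lam] pays for replacing [J] by [J.+1], and 2 bounds the power [eta] of 2 lost in
   passing from [l2] to [l2 / 2]. *)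
exists (2 / lam), eta; split; [by apply: divr_gt0; lra|by rewrite eta0|].
move=> d Omega P xi ips l1 l2 l10 l12.
have [N0 [mN0 PN0 finN0]] := ips_locally_finite u_gt0 ips.
pose A := event xi N0 (arm_chain l1 l2) setT.
have mA : measurable A by apply: (measurable_ev ips mN0 finN0) => //; exact: regular_arm.
exists (fine (P A)).
  (* The arm event is known to be measurable off [N0]; the rest of it lies in this null set, which
     is where the completion enters. *)
  exists A, (arm xi l1 l2 `&` N0); split => //.
  - by exists N0; split => // w [].
  - apply/seteqP; split => w.
      have [N0w|nN0] := pselect (N0 w); first by right.
      by move=> /armE h; left; split => //=; rewrite setIT.
    by move=> [[_ /=]|[]//]; rewrite setIT => /armE.
  - by rewrite fineK//; exact: fin_num_measure.
have l20 : 0 < l2 by lra.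
have [J [hJ Jb]] := scale_between (l2 / 2) (ltac:(lra) : 2 <= M) l10.
have PJ : fine (P A) <= lam ^+ J.
  case: hJ => [->|hJ].
    by rewrite expr0; exact: fine_prob_le1.
  have crossP l : 0 < l -> fine (P (event xi N0 (cross l) setT)) <= q.
    exact: (cross_prob u_gt0 uu' dpos hd ips mN0 PN0 finN0).
  have lamq' : q <= lam * ((1 + q) / 2) by rewrite lamq.
  have := arm_box_prob u_gt0 ips mN0 PN0 finN0 crossP N4 cE Nq lam2 (ltW lam1) lamq' J l10.
  apply: le_trans; apply: fine_prob_le => //.
    by apply: (measurable_ev ips mN0 finN0) => //; exact: regular_arm_box.
  move=> w [h1 /= h2]; split => //=.
  exact: arm_box_mono (lexx _) hJ (arm_chain_box l20 h2).
have x0 : 0 < l1 / l2 by exact: divr_gt0.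
have rate : lam ^+ J.+1 <= (2 * (l1 / l2)) `^ eta.
  apply: power_rate => //; last exact: ltW.
  have MJ : 0 < M ^+ J.+1 by rewrite exprn_gt0//; lra.
  by rewrite -div1r ltr_pdivrMr// mulrA mulrAC ltr_pdivlMr// mul1r; lra.
apply: (le_trans PJ).
have -> : lam ^+ J = lam ^+ J.+1 / lam by rewrite exprS mulrC mulKf// gt_eqF.
rewrite ler_pdivrMr// (le_trans rate)//.
have -> : 2 / lam * (l1 / l2) `^ eta * lam = 2 * (l1 / l2) `^ eta by field; rewrite gt_eqF.
rewrite powRM//; last exact: ltW.
apply: ler_wpM2r; first exact: powR_ge0.
by rewrite -[leRHS]powRr1//; apply: ler_powR; lra.
Qed.
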